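(* Let $q_D\in L^2(0,1)$ be real (i.e. $q_1,q_2\in L^2(0,1)$ real) and let $T_D$ be the corresponding periodic Dirac operator, with gaps $g_n=(z_n^-,z_n^+)$ and effective masses $m_n^\pm$ as in the context. Put $z_n^0=\frac{z_n^-+z_n^+}{2}$, $h_n^\pm=\sqrt{\frac{|g_n||m_n^\pm|}{2}}$ and $m_n=\frac{2h_n^2}{|g_n|}$. Then for each $n\in\mathbb Z$ the following estimates hold (for both choices of the sign $\pm$ where it appears): $$|z_n-z_n^0|\le\frac{|g_n|^2}{4}M_n',$$ $$\big|2h_n-|g_n|(1+V_n(z_n))\big|\le\frac{|g_n|^3}{8}(M_n')^2,$$ $$|h_n-h_n^\pm|\le\frac{|g_n|^2}{2}M_n'\Big(1+\frac{M_n'}{8}\sqrt{2|g_n||m_n^\pm|}\Big),$$ $$|m_n^++m_n^-|\le|g_n|^2(1+M_n)M_n',$$ $$|m_n^\pm\mp m_n|\le|g_n|^2(1+M_n)M_n'\Big(1+\frac{M_n'}{8}\sqrt{2|g_n||m_n^\pm|}\Big).$$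
   Context: The Dirac operator $T_D=\mathcal J\frac{d}{dt}+q_D(t)$ acts in $L^2(\mathbb R)\oplus L^2(\mathbb R)$, where $\mathcal J=\begin{pmatrix}0&1\\ -1&0\end{pmatrix}$, $q_D=\begin{pmatrix}q_1&q_2\\ q_2&-q_1\end{pmatrix}$ and $q_1,q_2\in L^2(0,1)$ are real 1-periodic functions. Its spectrum is $\bigcup_{n\in\mathbb Z}[z_{n-1}^+,z_n^-]$ with $z_{n-1}^+<z_n^-\le z_n^+$; the gaps are $g_n=(z_n^-,z_n^+)$ with length $|g_n|\ge0$, $n\in\mathbb Z$, and $g=\bigcup_n g_n$. Let $\psi(t,z)$ be the $2\times2$ matrix solution of $\mathcal J\psi'+q_D\psi=z\psi$, $\psi(0,z)=I_2$, and $\Delta(z)=\frac12\operatorname{Tr}\psi(1,z)$. Then $\Delta(z_n^\pm)=(-1)^n$ and $\Delta'$ has a zero $z_n\in[z_n^-,z_n^+]$. The quasimomentum $k=u+iv$ is the unique conformal mapping from $\mathbb C\setminus\overline g$ onto $\mathbb C\setminus\bigcup_{n\in\mathbb Z}[\pi n-ih_n,\pi n+ih_n]$ with $\cos k(z)=\Delta(z)$ and $k(z)=z+o(1)$ as $|z|\to\infty$, where $h_n\ge0$ is defined by $\cosh h_n=(-1)^n\Delta(z_n)\ge1$. On $\mathbb R$, $v(x)=\operatorname{Im}k(x+i0)\ge0$. For each nonempty gap $g_n$ the effective masses $m_n^\pm$ are defined by $z=z_n^\pm+\frac{(k(z)-\pi n)^2}{2m_n^\pm}(1+o(1))$ as $z\to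 z_n^\pm$. For a nonempty gap $g_n$ put $v_n(x)=|(x-z_n^-)(x-z_n^+)|^{1/2}$ and $V_n(x)=\frac{v(x)}{v_n(x)}-1\ge0$ for $x\in g_n$; $V_n$ extends analytically across the endpoints of $g_n$. Put $M_n=\max_{\overline{g_n}}V_n$ and $M_n'=\max_{\overline{g_n}}|V_n'|$. Convention: if the gap is empty, then $h_n=0$ and $m_n^\pm,m_n,V_n,M_n,M_n'$ are taken to be $0$. *)

(* Defs.v *)
From HB Require Import structures.
From mathcomp Require Import all_boot all_order all_algebra.
From mathcomp Require Import complex.
From mathcomp Require Import all_classical all_reals all_analysis.

Set Implicit Arguments.
Unset Strict Implicit.
Unset Printing Implicit Defensive.

Import Order.TTheory GRing.Theory Num.Theory.
Import numFieldNormedType.Exports.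

Local Open Scope classical_set_scope.
Local Open Scope complex_scope.
Local Open Scope ring_scope.

Section Dirac.
Context {R : realType}.
Notation C := R[i].
Notation mu := (@lebesgue_measure R).

Definition mx22 (T : nzRingType) (a b c d : T) : 'M[T]_2 :=
  \matrix_(i < 2, j < 2)
    (if i == ord0 then (if j == ord0 then a else b)
     else (if j == ord0 then c else d)).

Definition calJ : 'M[C]_2 := mx22 0 1 (-1) 0.

Definition dirac_potential (q1 q2 : R -> R) (t : R) : 'M[C]_2 :=
  mx22 (q1 t)%:C (q2 t)%:C (q2 t)%:C (- q1 t)%:C.

(* [f \_ D] is the extension of [f] restricted to [D] by zero, so the second
   conjunct says that f is square integrable on ]0, 1[. *)
Definition periodic_L2 (f : R -> R) : Prop :=
  (forall t, f (t + 1) = f t) /\ f \_ `]0, 1[ \in Lfun mu 2%:E.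

(* f is locally absolutely continuous with almost everywhere derivative f',
   i.e. f is an indefinite Lebesgue integral of f'. *)
Definition ac_derivative (f f' : R -> R) : Prop :=
  locally_integrable [set: R] f' /\
  (forall a b, a <= b -> f b - f a = \int[mu]_(t in `[a, b]) f' t).

Definition ac_derivative_mx (m n : nat) (f f' : R -> 'M[C]_(m, n)) : Prop :=
  forall i j,
    ac_derivative (fun t => complex.Re (f t i j)) (fun t => complex.Re (f' t i j)) /\
    ac_derivative (fun t => complex.Im (f t i j)) (fun t => complex.Im (f' t i j)).

(* The differential expression: calJ f' + q_D f = g, for a locally absolutely
   continuous f, with equality almost everywhere. *)
Definition dirac_eq (q1 q2 : R -> R) (n : nat) (f g : R -> 'M[C]_(2, n)) : Prop :=
  exists f', ac_derivative_mx f f' /\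
    {ae mu, forall t, calJ *m f' t + dirac_potential q1 q2 t *m f t = g t}.

Definition L2_vec (f : R -> 'cV[C]_2) : Prop :=
  forall i, (fun t => complex.Re (f t i ord0)) \in Lfun mu 2%:E /\
            (fun t => complex.Im (f t i ord0)) \in Lfun mu 2%:E.

Definition L2_norm_sq (f : R -> 'cV[C]_2) : \bar R :=
  (\int[mu]_t (\sum_(i < 2) Normc.normc (f t i ord0) ^+ 2)%:E)%E.

(* Graph of T_D in L^2(R) (+) L^2(R), on the maximal domain (on which T_D is
   self-adjoint). *)
Definition TD_graph (q1 q2 : R -> R) (f g : R -> 'cV[C]_2) : Prop :=
  [/\ L2_vec f, L2_vec g & dirac_eq q1 q2 f g].

(* T_D - z has a bounded everywhere defined inverse. *)
Definition TD_resolvent_set (q1 q2 : R -> R) : set C :=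
  [set z |
    (exists c : R, forall f g : R -> 'cV[C]_2,
       TD_graph q1 q2 f (fun t => z *: f t + g t) -> L2_vec g ->
       (L2_norm_sq f <= c%:E * L2_norm_sq g)%E) /\
    (forall g : R -> 'cV[C]_2, L2_vec g ->
       exists f, TD_graph q1 q2 f (fun t => z *: f t + g t))].

Definition TD_spectrum (q1 q2 : R -> R) : set C := ~` TD_resolvent_set q1 q2.

Definition fundamental_solution (q1 q2 : R -> R) (psi : R -> C -> 'M[C]_2) : Prop :=
  forall z, psi 0 z = 1%:M /\
    dirac_eq q1 q2 (fun t => psi t z) (fun t => z *: psi t z).

Definition Lyapunov (psi : R -> C -> 'M[C]_2) (z : C) : C := \tr (psi 1 z) / 2.

(* The regular module C^o is the copy of R[i] carrying its norm topology. *)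
Definition is_complex_derive (f : C -> C) (z df : C) : Prop :=
  is_derive (z : C^o) (1 : C^o) (f : C^o -> C^o) (df : C^o).

Definition cexp (z : C) : C :=
  (expR (complex.Re z))%:C * (cos (complex.Im z) +i* sin (complex.Im z)).

Definition ccos (z : C) : C := (cexp ((0 +i* 1) * z) + cexp (- ((0 +i* 1) * z))) / 2.

Definition cosh (x : R) : R := (expR x + expR (- x)) / 2.

Definition bands (zm zp : int -> R) : set C :=
  \bigcup_(n : int) [set x%:C | x in `[zp (n - 1), zm n]].

Definition gaps (zm zp : int -> R) : set R :=
  \bigcup_(n : int) `]zm n, zp n[%classic.

Definition gap_domain (zm zp : int -> R) : set C :=
  ~` [set x%:C | x in closure (gaps zm zp)].

(* Only nonempty gaps contribute a slit: an empty gap is not removed from the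
   z-plane, so the point pi n (where h n = 0) is not removed either. *)
Definition slits (zm zp h : int -> R) : set C :=
  \bigcup_(n in [set n : int | zm n < zp n])
    [set w | complex.Re w = pi * n%:~R /\ `|complex.Im w| <= h n].

Definition conformal (D E : set C) (k : C -> C) : Prop :=
  set_bij D E k /\
  (forall z, D z -> derivable (k : C^o -> C^o) (z : C^o) (1 : C^o)).

Definition asymptotic_to_id (D : set C) (k : C -> C) : Prop :=
  forall e : R, 0 < e ->
    exists r : R, forall z, D z -> r < Normc.normc z -> Normc.normc (k z - z) < e.

Definition quasimomentum (zm zp h : int -> R) (Delta k : C -> C) : Prop :=
  [/\ conformal (gap_domain zm zp) (~` slits zm zp h) k,
      forall z, gap_domain zm zp z -> ccos (k z) = Delta z &
      asymptotic_to_id (gap_domain zm zp) k].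

(* z = c + (k(z) - pi n)^2 / (2 m) (1 + o(1)) as z tends to c inside D. *)
Definition effective_mass (D : set C) (k : C -> C) (n : int) (c m : R) : Prop :=
  exists eps : C -> C,
    (eps z @[z --> within D (nbhs (c%:C : C^o))] --> (0 : C^o)) /\
    \forall z \near within D (nbhs (c%:C : C^o)),
      z = c%:C + (k z - (pi * n%:~R)%:C) ^+ 2 / (2 * m)%:C * (1 + eps z).

Definition real_analytic_at (f : R -> R) (x0 : R) : Prop :=
  exists (c : R^nat) (r : R), 0 < r /\
    forall x, `|x - x0| < r ->
      series (fun j => c j * (x - x0) ^+ j) @ \oo --> f x.

Definition gap_root (a b x : R) : R := Num.sqrt `|(x - a) * (x - b)|.

(* V is v / v_n - 1 on the gap ]a, b[, extended analytically across a and b;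
   only the values of V on [a, b] are determined. *)
Definition gap_ratio (v V : R -> R) (a b : R) : Prop :=
  (forall x, x \in `]a, b[ -> V x = v x / gap_root a b x - 1) /\
  (forall x, x \in `[a, b] -> real_analytic_at V x).

Definition is_max (A : set R) (f : R -> R) (m : R) : Prop :=
  (f @` A) m /\ ubound (f @` A) m.

End Dirac.

(* Main.v *)
Require Import Defs.
From HB Require Import structures.
From mathcomp Require Import all_boot all_order all_algebra.
From mathcomp Require Import complex.
From mathcomp Require Import all_classical all_reals all_analysis.
From mathcomp Require Import ring lra.
Import Order.TTheory GRing.Theory Num.Theory.
Import numFieldNormedType.Exports.
Local Open Scope classical_set_scope.
Local Open Scope complex_scope.
Local Open Scope ring_scope.

(** On a nonempty gap ]a, b[ write v = v_n (1 + V), where v_n is the square root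
    of (x - a) (b - x).  The estimates are elementary consequences
    ([gap_estimates]) of four facts about V.

    - The effective masses are read off from the square of k - pi n at the two
      endpoints, where it is asymptotic to - v^2 = - (x - a) (b - x) (1 + V)^2:
      m^- = - g (1 + V(a))^2 / 2 and m^+ = g (1 + V(b))^2 / 2
      ([mass_left_eq], [mass_right_eq]).
    - Since cosh v = (-1)^n Delta on the gap, v equals h_n at the critical point
      z_n of Delta and is stationary there, which gives
      (z_n^0 - z_n) (1 + V(z_n)) = - v_n(z_n)^2 V'(z_n)
      ([v_critical], [v_stationary]).
    - V is Lipschitz with constant M' on the closed gap.
    - V >= 0, that is v >= v_n ([v_lower_bound]).

    The last fact carries the weight: it is a global property of the conformal
    map k.  For x in the gap put
    P(z) = (z - x) ((k(z) - pi n) / f(z) - 1), f^2 = (z - a) (z - b),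
    on the upper half-plane.  Outside of the gap (z - x) / f is positive on the
    real axis and Im k >= 0, on the gap (k - pi n) / f is real, and P has a real
    limit at infinity because k(z) - z tends to 0 there.  So the boundary values
    of Im P are nonnegative, and Im P >= 0 by the maximum principle
    ([comparison_ge0]).  At z = x + iy this says that the real part of
    (k - pi n) / f is at least 1, and y -> 0 gives v / v_n >= 1
    ([gap_lower_bound]).

    Three properties of k are used for this.  Its real part tends to pi n at the
    gap, because k is proper: near the gap its values avoid the boundary of a
    rectangle around the n-th slit, so they are trapped inside
    ([k_near_gap]).  Its real part is bounded on bounded sets, because the
    inverse images of the vertical lines far from the origin stay far from the
    origin ([Re_k_bounded]); this also shows that the gaps do not accumulate
    ([real_not_domain]).  Finally Im k > 0 on the upper half-plane
    ([Im_k_pos]): the real part of k(z) - conj k(conj z) vanishes on the real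
    axis and at infinity, so that k commutes with conjugation ([k_conj]), and an
    injective map with this symmetry takes real values only on the real axis.

    The function theory behind these arguments is the maximum principle for the
    real part of a function that is merely complex differentiable at each point
    ([max_principle]), and the open mapping theorem for injective maps which
    follows from it ([open_mapping]).  By Goursat's theorem for rectangles the
    mean of f over a short horizontal segment has a real part with vanishing
    Laplacian in the sense of iterated partial derivatives; after adding a
    quadratic polynomial with positive Laplacian it has no interior maximum
    ([no_local_max]). *)

Set Implicit Arguments.
Unset Strict Implicit.
Unset Printing Implicit Defensive.

Local Notation normc := Normc.normc.

(** * Complex and real differentiability with explicit moduli *)

(** Stated over an arbitrary field with a norm, so that it serves both for real
    functions and for complex differentiability. *)
Lemma is_derive_expansion (K : numFieldType) (f : K^o -> K^o) (x d : K^o) :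
  is_derive x (1 : K^o) f d <->
  forall e : K, 0 < e -> exists2 r : K, 0 < r & forall y : K, `|y - x| < r ->
    `|f y - f x - d * (y - x)| <= e * `|y - x|.
Proof.
split.
  move=> [df <-] e e0.
  have /eqaddoP/(_ _ e0) := derivable_nbhs df.
  move=> /nbhs_normP[r /= r0 H]; exists r => // y yr.
  have := H (y - x); rewrite /ball_ /= sub0r normrN => /(_ yr).
  have E : (y - x) *: (1 : K^o) = y - x by exact: mulr1.
  have E' t : (y - x) *: (t : K^o) = t * (y - x) by exact: mulrC.
  by rewrite !fctE /= E E' subrK opprD addrA.
move=> H.
have H' : (fun h : K^o => h^-1 *: ((f \o shift x) (h *: (1 : K^o)) - f x)) @ 0^' --> d.
  apply/cvgrPdist_le => e e0; have [r r0 {}H] := H _ e0.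
  apply/nbhs_normP; exists r => //= h /=; rewrite sub0r normrN => hr h0.
  have := H (h + x); rewrite addrK => /(_ hr) {}H.
  have E : h *: (1 : K^o) = h by exact: mulr1.
  have E' (t : K^o) : h^-1 *: t = h^-1 * t by [].
  rewrite /= E E' distrC.
  rewrite -[X in _ - X](mulKf h0) -mulrBr normrM normfV.
  rewrite ler_pdivrMl ?normr_gt0// [_ * e]mulrC (_ : h * d = d * h) //.
  exact: mulrC.
by split; [apply/cvg_ex; exists d | apply: cvg_lim].
Qed.

Section Basics.
Variable R : realType.
Notation C := R[i].
Implicit Types (z w : C) (x y : R).

Lemma complex_normE z : `|z| = (normc z)%:C.
Proof. by rewrite normc_def; case: z. Qed.

Lemma normc_ge0 z : 0 <= normc z.
Proof. by rewrite -ler0c -complex_normE. Qed.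

Lemma normcB z w : normc (z - w) = normc (w - z).
Proof. by apply: complexI; rewrite -!complex_normE distrC. Qed.

Lemma normc_tri w z t : normc (z - t) <= normc (z - w) + normc (w - t).
Proof. by rewrite -lecR rmorphD /= -!complex_normE ler_distD. Qed.

Lemma le_Re_normc z : `|complex.Re z| <= normc z.
Proof.
case: z => a b /=; rewrite -sqrtr_sqr ler_wsqrtr // lerDl; exact: sqr_ge0.
Qed.

Lemma le_Im_normc z : `|complex.Im z| <= normc z.
Proof.
case: z => a b /=; rewrite -sqrtr_sqr ler_wsqrtr // lerDr; exact: sqr_ge0.
Qed.

Lemma normc_le_ReIm z : normc z <= `|complex.Re z| + `|complex.Im z|.
Proof.
case: z => a b /=.
rewrite -[leRHS]ger0_norm ?addr_ge0 // -sqrtr_sqr ler_wsqrtr //.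
have A := real_normK (num_real a); have B := real_normK (num_real b).
have := mulr_ge0 (normr_ge0 a) (normr_ge0 b); rewrite -A -B; nra.
Qed.

Lemma normc_real x : normc x%:C = `|x|.
Proof. by rewrite /= expr0n /= addr0 sqrtr_sqr. Qed.

Lemma normc_eq0 z : (normc z == 0) = (z == 0).
Proof.
by apply/eqP/eqP => [/Normc.eq0_normc //|->]; rewrite Normc.normc0.
Qed.

Lemma normc_gt0 z : (0 < normc z) = (z != 0).
Proof. by rewrite lt_def normc_ge0 andbT normc_eq0. Qed.

(** Rewriting rules that turn a goal about complex numbers into one about
    their coordinates in R; the generic 'Re and 'Im take complex values. *)
Lemma cReD z w : complex.Re (z + w) = complex.Re z + complex.Re w.
Proof. by case: z; case: w. Qed.
Lemma cImD z w : complex.Im (z + w) = complex.Im z + complex.Im w.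
Proof. by case: z; case: w. Qed.
Lemma cReN z : complex.Re (- z) = - complex.Re z. Proof. by case: z. Qed.
Lemma cImN z : complex.Im (- z) = - complex.Im z. Proof. by case: z. Qed.
Lemma cReM z w : complex.Re (z * w)
  = complex.Re z * complex.Re w - complex.Im z * complex.Im w.
Proof. by case: z; case: w. Qed.
Lemma cImM z w : complex.Im (z * w)
  = complex.Re z * complex.Im w + complex.Im z * complex.Re w.
Proof. by case: z; case: w. Qed.

(** Complex differentiability with moduli in R, since the norm of R[i] itself
    takes its values in R[i]. *)
Definition cderiv (f : C -> C) z (d : C) :=
  forall e : R, 0 < e -> exists2 r : R, 0 < r & forall w, normc (w - z) < r ->
    normc (f w - f z - d * (w - z)) <= e * normc (w - z).

Definition ccont (f : C -> C) z :=
  forall e : R, 0 < e -> exists2 r : R, 0 < r & forall w, normc (w - z) < r ->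
    normc (f w - f z) < e.

Lemma pos_complex (e : C) : 0 < e -> exists2 r : R, 0 < r & e = r%:C.
Proof.
by case: e => a b; rewrite ltcE /= => /andP[/eqP -> a0]; exists a.
Qed.

Lemma cderivP f z d : cderiv f z d <-> is_derive (z : C^o) (1 : C^o) (f : C^o -> C^o) d.
Proof.
split.
  move=> H; apply/is_derive_expansion => e /pos_complex[{}e e0 ->].
  have [r r0 {}H] := H _ e0; exists r%:C; first by rewrite ltcR.
  by move=> y; rewrite !complex_normE ltcR -rmorphM /= lecR; apply: H.
move=> /is_derive_expansion H e e0.
have e0' : 0 < e%:C by rewrite ltcR.
have [_ /pos_complex[r r0 ->] {}H] := H _ e0'.
exists r => // w wr; have := H w; rewrite !complex_normE ltcR -rmorphM /= lecR.
by apply.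
Qed.

Lemma cderiv_cst (c : C) z : cderiv (fun=> c) z 0.
Proof. apply/cderivP; exact: is_derive_cst. Qed.

Lemma cderiv_id z : cderiv id z 1.
Proof. apply/cderivP; exact: is_derive_id. Qed.

Lemma cderivD f g z a b : cderiv f z a -> cderiv g z b ->
  cderiv (fun w => f w + g w) z (a + b).
Proof. by move=> /cderivP ? /cderivP ?; apply/cderivP; apply: is_deriveD. Qed.

Lemma cderivN f z a : cderiv f z a -> cderiv (fun w => - f w) z (- a).
Proof. by move=> /cderivP ?; apply/cderivP; apply: is_deriveN. Qed.

Lemma cderivB f g z a b : cderiv f z a -> cderiv g z b ->
  cderiv (fun w => f w - g w) z (a - b).
Proof. by move=> ? ?; apply: cderivD => //; apply: cderivN. Qed.

Lemma cderivM f g z a b : cderiv f z a -> cderiv g z b ->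
  cderiv (fun w => f w * g w) z (f z * b + g z * a).
Proof. by move=> /cderivP ? /cderivP ?; apply/cderivP; apply: is_deriveM. Qed.

Lemma cderivV f z a : f z != 0 -> cderiv f z a ->
  cderiv (fun w => (f w)^-1) z (- (f z) ^- 2 * a).
Proof.
move=> fz0 /cderivP[df <-]; apply/cderivP; split.
  exact: (@derivableV _ _ (f : C^o -> C^o)).
exact: (@deriveV _ _ (f : C^o -> C^o)).
Qed.

Lemma cderiv_cont f z d : cderiv f z d -> ccont f z.
Proof.
move=> H e e0; have [r r0 {}H] := H _ ltr01.
have N0 : 0 < normc d + 1 by rewrite ltr_wpDl // normc_ge0.
exists (Num.min r (e / (normc d + 1))); first by rewrite lt_min r0 divr_gt0.
move=> w; rewrite lt_min => /andP[/H {}H].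
rewrite ltr_pdivlMr // => /(le_lt_trans _); apply.
have := normc_tri (d * (w - z)) (f w - f z) 0; rewrite !subr0 => /le_trans; apply.
rewrite Normc.normcM; lra.
Qed.

Lemma conjcB z w : conjc (z - w) = conjc z - conjc w.
Proof. by case: z => a b; case: w => c d; congr (_ +i* _); ring. Qed.

Lemma conjcM z w : conjc (z * w) = conjc z * conjc w.
Proof. by case: z => a b; case: w => c d; congr (_ +i* _); ring. Qed.

Lemma normc_conj z : normc (conjc z) = normc z.
Proof. by case: z => a b /=; rewrite sqrrN. Qed.

(** Conjugating both the argument and the value preserves complex
    differentiability, although conjugation alone is not differentiable. *)
Lemma cderiv_conj f z d : cderiv f (conjc z) d ->
  cderiv (fun w => conjc (f (conjc w))) z (conjc d).
Proof.
move=> H e e0; have [r r0 {}H] := H _ e0; exists r => // w wr.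
have := H (conjc w); rewrite -conjcB normc_conj => /(_ wr).
rewrite -[X in X <= _]normc_conj.
rewrite (conjcB (f (conjc w) - f (conjc z))) (conjcB (f (conjc w))) conjcM.
by rewrite conjcK.
Qed.

Definition rderiv (f : R -> R) x (d : R) :=
  forall e : R, 0 < e -> exists2 r : R, 0 < r & forall y, `|y - x| < r ->
    `|f y - f x - d * (y - x)| <= e * `|y - x|.

Definition rcont (f : R -> R) x :=
  forall e : R, 0 < e -> exists2 r : R, 0 < r & forall y, `|y - x| < r ->
    `|f y - f x| < e.

Lemma rderivP f x d : rderiv f x d <-> is_derive x 1 f d.
Proof. by split => [H|H]; [apply/is_derive_expansion|apply/is_derive_expansion]. Qed.

Lemma rcontP f x : rcont f x <-> {for x, continuous f}.
Proof.
split=> [H|/cvgrPdist_lt H e e0].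
  apply/cvgrPdist_lt => e e0; have [r r0 {}H] := H _ e0.
  by apply/nbhs_normP; exists r => //= y; rewrite /= distrC => /H; rewrite distrC.
have /nbhs_normP[r /= r0 {}H] := H _ e0; exists r => // y yr.
by rewrite distrC; apply: H; rewrite /= distrC.
Qed.

Lemma rderiv_cont f x d : rderiv f x d -> rcont f x.
Proof.
move=> /rderivP[df _]; apply/rcontP.
by apply: differentiable_continuous; apply/derivable1_diffP.
Qed.

Lemma rcont_within f a b : (forall x, a <= x <= b -> rcont f x) ->
  {within `[a, b], continuous f}.
Proof.
move=> H; apply: continuous_in_subspaceT => x; rewrite inE /= in_itv /= => /H.
by move/rcontP.
Qed.

Lemma rderiv_MVT f f' a b : a <= b ->
  (forall x, a <= x <= b -> rderiv f x (f' x)) ->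
  exists2 c, a <= c <= b & f b - f a = f' c * (b - a).
Proof.
move=> ab H.
have [||c] := @MVT_segment R f f' a b ab.
- by move=> x; rewrite in_itv /= => /andP[? ?]; apply/rderivP/H; rewrite !ltW.
- by apply: rcont_within => x /H /rderiv_cont.
- by rewrite in_itv /=; exists c.
Qed.

Lemma rderiv_ext (f g : R -> R) x d : (forall y, f y = g y) -> rderiv f x d -> rderiv g x d.
Proof. by move=> /funext <-. Qed.

Lemma rderiv_local (f g : R -> R) x d (r : R) : 0 < r ->
  (forall y, `|y - x| < r -> f y = g y) -> rderiv f x d -> rderiv g x d.
Proof.
move=> r0 fg H e e0; have [s s0 {}H] := H _ e0.
exists (Num.min r s); first by rewrite lt_min r0.
move=> w; rewrite lt_min => /andP[wr ws].
by rewrite -!fg //; [exact: H | rewrite subrr normr0].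
Qed.

Lemma rderiv_cst c x : rderiv (fun=> c) x 0.
Proof. apply/rderivP; exact: is_derive_cst. Qed.

Lemma rderiv_id x : rderiv id x 1.
Proof. apply/rderivP; exact: is_derive_id. Qed.

Lemma rderivD f g x a b : rderiv f x a -> rderiv g x b ->
  rderiv (fun y => f y + g y) x (a + b).
Proof. by move=> /rderivP ? /rderivP ?; apply/rderivP; apply: is_deriveD. Qed.

Lemma rderivN f x a : rderiv f x a -> rderiv (fun y => - f y) x (- a).
Proof. by move=> /rderivP ?; apply/rderivP; apply: is_deriveN. Qed.

Lemma rderivB f g x a b : rderiv f x a -> rderiv g x b ->
  rderiv (fun y => f y - g y) x (a - b).
Proof. by move=> ? ?; apply: rderivD => //; apply: rderivN. Qed.

Lemma rderivM f g x a b : rderiv f x a -> rderiv g x b ->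
  rderiv (fun y => f y * g y) x (f x * b + g x * a).
Proof. by move=> /rderivP ? /rderivP ?; apply/rderivP; apply: is_deriveM. Qed.

Lemma rderiv_eq f x a b : rderiv f x a -> a = b -> rderiv f x b.
Proof. by move=> ? <-. Qed.

Lemma rderiv_unique f x a b : rderiv f x a -> rderiv f x b -> a = b.
Proof. by move=> /rderivP[_ <-] /rderivP[_ <-]. Qed.

Lemma rderiv_shift f x t d : rderiv f (x + t) d -> rderiv (fun s => f (s + t)) x d.
Proof.
move=> H e /H[r r0 {}H]; exists r => // y yr.
by have := H (y + t); rewrite (_ : y + t - (x + t) = y - x); [apply|ring].
Qed.

(** Line integrals along horizontal and vertical segments are handled through
    increments of primitives; this is where integration enters the argument. *)
Lemma primitive (f : R -> R) a b : (forall x, a <= x <= b -> rcont f x) ->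
  exists G : R -> R, forall x, a < x < b -> rderiv G x (f x).
Proof.
move=> cf.
exists (fun x => \int[lebesgue_measure]_(t in `[a, x]) (f t)) => x /andP[ax xb].
have fi : lebesgue_measure.-integrable `[a, b] (EFin \o f).
  apply: continuous_compact_integrable; first exact: segment_compact.
  exact: rcont_within.
have [|dF <-] := continuous_FTC1_closed xb fi ax.
  by apply/rcontP/cf; rewrite !ltW.
by apply/rderivP; split => //; rewrite derive1E.
Qed.

End Basics.

(** * Bisection and compactness in the complex plane *)

Section Compactness.
Variable R : realType.
Notation C := R[i].

Lemma bisection1 (s : nat -> R) (a : R) :
  (forall n, s n <= s n.+1 /\ s n.+1 + a / 2 ^+ n.+1 <= s n + a / 2 ^+ n) ->
  0 <= a ->
  exists p : R, forall n, s n <= p <= s n + a / 2 ^+ n.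
Proof.
move=> H a0.
have up n m : s n <= s (n + m)%N.
  by elim: m => [|m IH]; rewrite ?addn0 // addnS (le_trans IH) // (H _).1.
have down n m : s (n + m)%N + a / 2 ^+ (n + m) <= s n + a / 2 ^+ n.
  by elim: m => [|m IH]; rewrite ?addn0 // addnS (le_trans _ IH) // (H _).2.
have pos n : 0 <= a / 2 ^+ n by rewrite divr_ge0 // exprn_ge0.
have bnd n m : s m <= s n + a / 2 ^+ n.
  case: (leqP n m) => [nm|/ltnW mn].
    rewrite -(subnKC nm) (le_trans _ (down n (m - n)%N)) // lerDl; exact: pos.
  rewrite (le_trans (up m (n - m)%N)) // subnKC // lerDl; exact: pos.
have hs : has_sup (range s).
  split; first by exists (s 0%N), 0%N.
  by exists (s 0%N + a / 2 ^+ 0) => _ [m _ <-].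
exists (sup (range s)) => n; apply/andP; split.
  by apply: sup_upper_bound => //; exists n.
by apply: ge_sup; [exists (s 0%N), 0%N|move=> _ [m _ <-]].
Qed.

(** The bisection argument common to Goursat's theorem and to the
    Heine--Borel theorem: halving both sides again and again, the rectangles
    shrink to a point. *)
Lemma bisection (Bad : R -> R -> R -> R -> Prop) (x y a b : R) :
  0 <= a -> 0 <= b ->
  (forall x y a b, Bad x y a b ->
     exists x' y', [/\ x' = x \/ x' = x + a / 2, y' = y \/ y' = y + b / 2 &
                       Bad x' y' (a / 2) (b / 2)]) ->
  Bad x y a b ->
  exists p q, forall n : nat, exists x' y',
    [/\ Bad x' y' (a / 2 ^+ n) (b / 2 ^+ n),
        x' <= p <= x' + a / 2 ^+ n, y' <= q <= y' + b / 2 ^+ n,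
        x <= x' /\ x' + a / 2 ^+ n <= x + a &
        y <= y' /\ y' + b / 2 ^+ n <= y + b].
Proof.
move=> a0 b0 step bad0.
have /choice[f Hf] (t : R * R * R * R) : exists t' : R * R,
    Bad t.1.1.1 t.1.1.2 t.1.2 t.2 ->
    [/\ t'.1 = t.1.1.1 \/ t'.1 = t.1.1.1 + t.1.2 / 2,
        t'.2 = t.1.1.2 \/ t'.2 = t.1.1.2 + t.2 / 2 &
        Bad t'.1 t'.2 (t.1.2 / 2) (t.2 / 2)].
  have [/step[x' [y' H]]|nb] := pselect (Bad t.1.1.1 t.1.1.2 t.1.2 t.2).
    by exists (x', y').
  by exists (0, 0).
pose fix s n := match n with
  | O => (x, y)
  | S m => f ((s m).1, (s m).2, a / 2 ^+ m, b / 2 ^+ m) end.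
have E (c : R) n : c / 2 ^+ n.+1 = c / 2 ^+ n / 2.
  by rewrite exprSr invfM mulrA.
have badn n : Bad (s n).1 (s n).2 (a / 2 ^+ n) (b / 2 ^+ n).
  elim: n => [|n IH] /=; first by rewrite expr0 !divr1.
  by have [_ _] := Hf (_, _, _, _) IH; rewrite !E.
have pos (c : R) n : 0 <= c -> 0 <= c / 2 ^+ n.
  by move=> c0; rewrite divr_ge0 // exprn_ge0.
have sx n : (s n).1 <= (s n.+1).1 /\
    (s n.+1).1 + a / 2 ^+ n.+1 <= (s n).1 + a / 2 ^+ n.
  have [+ _ _] := Hf (_, _, _, _) (badn n); rewrite -/(s n.+1) E /=.
  have := pos _ n a0; set c := a / _ => c0 [] ->; split; lra.
have sy n : (s n).2 <= (s n.+1).2 /\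
    (s n.+1).2 + b / 2 ^+ n.+1 <= (s n).2 + b / 2 ^+ n.
  have [_ + _] := Hf (_, _, _, _) (badn n); rewrite -/(s n.+1) E /=.
  have := pos _ n b0; set c := b / _ => c0 [] ->; split; lra.
have [p Hp] := bisection1 (s := fun n => (s n).1) sx a0.
have [q Hq] := bisection1 (s := fun n => (s n).2) sy b0.
exists p, q => n; exists (s n).1, (s n).2; split => //.
  elim: n => [|n [IH1 IH2]] /=; first by rewrite expr0 divr1.
  have [A B] := sx n; split; [exact: le_trans A | exact: le_trans IH2].
elim: n => [|n [IH1 IH2]] /=; first by rewrite expr0 divr1.
have [A B] := sy n; split; [exact: le_trans A | exact: le_trans IH2].
Qed.

Lemma exists_halving (a r : R) : 0 < r -> exists n : nat, a / 2 ^+ n < r.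
Proof.
move=> r0; exists (Num.truncn (`|a| / r)).+1.
rewrite ltr_pdivrMr ?exprn_gt0 //.
have H : `|a| / r < 2 ^+ (Num.truncn (`|a| / r)).+1.
  have := truncnS_gt (`|a| / r); move=> /lt_le_trans; apply.
  by rewrite -natrX ler_nat ltnW // ltn_expl.
by rewrite (le_lt_trans (ler_norm a)) // mulrC -ltr_pdivrMr.
Qed.

(** Heine--Borel as an induction principle.  If [P] failed for a ball, it would
    fail for one of the quarters of a square around it, and bisection would
    produce a point at which [P] is not local. *)
Lemma compact_induction (P : set C -> Prop) :
  (forall A B, P A -> P B -> P (A `|` B)) ->
  (forall A B, A `<=` B -> P B -> P A) ->
  (forall p, exists2 r : R, 0 < r & P [set z | normc (z - p) < r]) ->
  forall r : R, P [set z | normc z <= r].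
Proof.
move=> PU PS Ploc r; apply: contrapT => NP.
have r0 : 0 <= r.
  rewrite leNgt; apply/negP => r0; apply: NP.
  have [s s0 +] := Ploc 0; apply: PS => z /= zr.
  by have := le_lt_trans zr r0; rewrite ltNge normc_ge0.
pose box (x y a b : R) := [set z : C | x <= complex.Re z <= x + a /\
  y <= complex.Im z <= y + b].
have [||||p [q H]] := @bisection (fun x y a b => ~ P (box x y a b)) (- r) (- r)
  (2 * r) (2 * r).
- by rewrite mulr_ge0.
- by rewrite mulr_ge0.
- move=> x y a b N; apply: contrapT => NN; apply: N.
  have Q x' y' : x' = x \/ x' = x + a / 2 -> y' = y \/ y' = y + b / 2 ->
      P (box x' y' (a / 2) (b / 2)).
    by move=> hx hy; apply: contrapT => N; apply: NN; exists x', y'.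
  apply: (PS _ ((box x y (a / 2) (b / 2) `|` box (x + a / 2) y (a / 2) (b / 2))
    `|` (box x (y + b / 2) (a / 2) (b / 2)
    `|` box (x + a / 2) (y + b / 2) (a / 2) (b / 2)))); last first.
    by apply: (PU); apply: (PU); apply: Q; (by left) || (by right).
  move=> z [/andP[? ?] /andP[? ?]] /=.
  have [h1|h1] := leP (complex.Re z) (x + a / 2);
    have [h2|h2] := leP (complex.Im z) (y + b / 2).
  + by left; left; split; apply/andP; split.
  + by right; left; split; apply/andP; split => //; lra.
  + by left; right; split; apply/andP; split => //; lra.
  + by right; right; split; apply/andP; split; lra.
- apply: contra_not NP; apply: PS => z /= zr.
  have := le_trans (le_Re_normc z) zr; have := le_trans (le_Im_normc z) zr.
  rewrite !ler_norml => /andP[? ?] /andP[? ?].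
  by split; apply/andP; split; lra.
have [s s0 Ps] := Ploc (p +i* q).
have [n hn] := exists_halving (2 * r) (divr_gt0 s0 (ltr0Sn R 1)).
have [x' [y' [+ hp hq _ _]]] := H n; apply.
apply: PS Ps => z [/andP[? ?] /andP[? ?]] /=.
apply: le_lt_trans (normc_le_ReIm _) _.
move: hp hq => /andP[? ?] /andP[? ?].
rewrite cReD cImD cReN cImN /= [ltRHS](splitr s).
apply: ltrD; rewrite ltr_norml; apply/andP; split; lra.
Qed.

(** Upper semicontinuity suffices.  If no point were a maximum, each point
    would have a neighbourhood on which phi stays below the value at some point
    of K; finitely many of these values have a largest one, which is below
    itself. *)
Lemma attains_max (K : set C) (phi : C -> R) (r : R) (p0 : C) :
  K p0 -> (forall z, K z -> normc z <= r) ->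
  (forall p, ~ K p -> exists2 d : R, 0 < d & forall z, K z -> d <= normc (z - p)) ->
  (forall p, K p -> forall e : R, 0 < e -> exists2 d : R, 0 < d &
     forall z, K z -> normc (z - p) < d -> phi z < phi p + e) ->
  exists2 p, K p & forall z, K z -> phi z <= phi p.
Proof.
move=> Kp0 Kr Kcl usc; apply: contrapT => N.
have N' p : K p -> exists2 z, K z & phi p < phi z.
  move=> Kp; apply: contrapT => N'; apply: N; exists p => // z Kz.
  by rewrite leNgt; apply/negP => lt; apply: N'; exists z.
have [|||z0 Kz0 H] := @compact_induction (fun A => exists2 z0, K z0 &
    forall z, A z -> K z -> phi z < phi z0) _ _ _ r.
- move=> A B [z1 K1 H1] [z2 K2 H2].
  have [l|l] := leP (phi z1) (phi z2).
    exists z2 => // z [Az|Bz] Kz; last exact: H2.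
    exact: lt_le_trans (H1 _ Az Kz) l.
  exists z1 => // z [Az|Bz] Kz; first exact: H1.
  exact: lt_trans (H2 _ Bz Kz) l.
- by move=> A B AB [z0 K0 H]; exists z0 => // z /AB; apply: H.
- move=> p; have [Kp|NKp] := pselect (K p).
    have [z0 K0 lt] := N' _ Kp.
    have e0 : 0 < phi z0 - phi p by rewrite subr_gt0.
    have [d d0 H] := usc _ Kp _ e0; exists d => //.
    by exists z0 => // z /= zd Kz; have := H _ Kz zd; rewrite addrC subrK.
  have [d d0 H] := Kcl _ NKp; exists d => //; exists p0 => // z /= zd Kz.
  by have := H _ Kz; rewrite leNgt zd.
by have := H _ (Kr _ Kz0) Kz0; rewrite ltxx.
Qed.

End Compactness.

(** * Goursat's theorem and the maximum principle *)

Section MaximumPrinciple.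
Variable R : realType.
Notation C := R[i].

(** The mean value theorem for G minus the primitive c0 s + c1 (s - p)^2 / 2 of
    the affine approximation. *)
Lemma edge_bound (G u : R -> R) (x a c0 c1 p e : R) : 0 <= a ->
  (forall s, x <= s <= x + a -> rderiv G s (u s)) ->
  (forall s, x <= s <= x + a -> `|u s - (c0 + c1 * (s - p))| <= e) ->
  `|G (x + a) - G x - (c0 * a + c1 * ((x + a - p) ^+ 2 - (x - p) ^+ 2) / 2)|
    <= e * a.
Proof.
move=> a0 dG hu.
have [||c cxa] := @rderiv_MVT R (fun s => G s - (c0 * s + c1 / 2 * ((s - p) * (s - p))))
   (fun s => u s - (c0 + c1 * (s - p))) x (x + a).
- by rewrite lerDl.
- move=> s /dG dGs; apply: rderiv_eq.
    apply: rderivB; first exact: dGs.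
    apply: rderivD; apply: rderivM.
    - exact: rderiv_cst.
    - exact: rderiv_id.
    - exact: rderiv_cst.
    - by apply: rderivM; apply: rderivB; [exact: rderiv_id|exact: rderiv_cst
        |exact: rderiv_id|exact: rderiv_cst].
  by rewrite /=; field.
rewrite (_ : _ - _ - _ = G (x + a) - G x -
  (c0 * a + c1 * ((x + a - p) ^+ 2 - (x - p) ^+ 2) / 2)); last by field.
move=> ->; rewrite (_ : x + a - x = a); last by ring.
by rewrite normrM (ger0_norm a0) ler_wpM2r // hu.
Qed.

(** Goursat's theorem for the real part of the integral of f around a
    rectangle: [G t] is a primitive of Re f on the line of height t and [H s] a
    primitive of Im f on the line of abscissa s.  The integral is additive under
    division into quarters, so if it were not zero there would be arbitrarily
    small rectangles, around a fixed point, on which it is not small compared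
    with the square of the size; at that point f is not differentiable. *)
Lemma goursat (f : C -> C) (G H : R -> R -> R) (x y a b : R) :
  0 <= a -> 0 <= b ->
  (forall s t, x <= s <= x + a -> y <= t <= y + b ->
     [/\ exists d, cderiv f (s +i* t) d,
         rderiv (G t) s (complex.Re (f (s +i* t))) &
         rderiv (H s) t (complex.Im (f (s +i* t)))]) ->
  (G y (x + a) - G y x) - (G (y + b) (x + a) - G (y + b) x)
  + (H x (y + b) - H x y) - (H (x + a) (y + b) - H (x + a) y) = 0.
Proof.
move=> a0 b0 hyp.
pose J x y a b := (G y (x + a) - G y x) - (G (y + b) (x + a) - G (y + b) x)
  + (H x (y + b) - H x y) - (H (x + a) (y + b) - H (x + a) y).
rewrite -/(J x y a b); apply/eqP; apply: contrapT => /negP J0.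
have quarter : forall (e x y a b : R), e * (a + b) ^+ 2 < `|J x y a b| ->
    exists x' y', [/\ x' = x \/ x' = x + a / 2, y' = y \/ y' = y + b / 2 &
      e * (a / 2 + b / 2) ^+ 2 < `|J x' y' (a / 2) (b / 2)|].
  move=> {x y a b hyp J0 a0 b0} e x y a b lt.
  have E : J x y a b = J x y (a / 2) (b / 2) + J (x + a / 2) y (a / 2) (b / 2)
    + J x (y + b / 2) (a / 2) (b / 2) + J (x + a / 2) (y + b / 2) (a / 2) (b / 2).
    have Ea : x + a / 2 + a / 2 = x + a by field.
    have Eb : y + b / 2 + b / 2 = y + b by field.
    by rewrite /J !Ea !Eb; ring.
  apply: contrapT => N.
  have Q x' y' : x' = x \/ x' = x + a / 2 -> y' = y \/ y' = y + b / 2 ->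
      `|J x' y' (a / 2) (b / 2)| <= e * (a + b) ^+ 2 / 4.
    move=> hx hy; rewrite leNgt; apply/negP => lt'; apply: N; exists x', y'.
    split => //.
    by rewrite (_ : e * _ = e * (a + b) ^+ 2 / 4) //; field.
  have Q1 := Q x y (or_introl erefl) (or_introl erefl).
  have Q2 := Q _ y (or_intror erefl) (or_introl erefl).
  have Q3 := Q x _ (or_introl erefl) (or_intror erefl).
  have Q4 := Q _ _ (or_intror erefl) (or_intror erefl).
  move: lt; rewrite E ltNge => /negP; apply.
  have L (u v w : R) : u <= v -> u + w <= v + w by rewrite lerD2r.
  apply: (le_trans (y := `|J x y (a / 2) (b / 2)| + `|J (x + a / 2) y (a / 2) (b / 2)|
    + `|J x (y + b / 2) (a / 2) (b / 2)| + `|J (x + a / 2) (y + b / 2) (a / 2) (b / 2)|)).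
    apply: le_trans (ler_normD _ _) (L _ _ _ _).
    by apply: le_trans (ler_normD _ _) (L _ _ _ _); apply: ler_normD.
  lra.
pose e := `|J x y a b| / (2 * (a + b + 1) ^+ 2).
have ab1 : 0 < a + b + 1 by lra.
have e0 : 0 < e by rewrite divr_gt0 ?normr_gt0 // mulr_gt0 // exprn_gt0.
have [||p [q Hpq]] := @bisection R
  (fun x y a b => e * (a + b) ^+ 2 < `|J x y a b|) x y a b a0 b0.
- exact: quarter.
- rewrite -(mulr1 `|_|) /e mulrAC -mulrA ltr_pM2l ?normr_gt0 //.
  rewrite ltr_pdivrMr ?mul1r; last by rewrite mulr_gt0 // exprn_gt0.
  nra.
have pin : x <= p <= x + a.
  by have [x' [y' [_ /andP[? ?] _ [? ?] _]]] := Hpq 0%N; apply/andP; split; lra.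
have qin : y <= q <= y + b.
  by have [x' [y' [_ _ /andP[? ?] _ [? ?]]]] := Hpq 0%N; apply/andP; split; lra.
have [[d df] _ _] := hyp _ _ pin qin.
have e2 : 0 < e / 4 by rewrite divr_gt0.
have [r r0 {}df] := df _ e2.
have [n hn] := exists_halving (a + b) r0.
have [x' [y' [lt hp hq [hx1 hx2] [hy1 hy2]]]] := Hpq n.
have an0 : 0 <= a / 2 ^+ n by rewrite divr_ge0 // exprn_ge0.
have bn0 : 0 <= b / 2 ^+ n by rewrite divr_ge0 // exprn_ge0.
move: hn; rewrite mulrDl => hn.
move: an0 bn0 lt hp hq hx1 hx2 hy1 hy2 hn.
set a' := a / 2 ^+ n; set b' := b / 2 ^+ n => an0 bn0 lt hp hq hx1 hx2 hy1 hy2 hn.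
pose U s t := complex.Re (f (s +i* t)); pose V s t := complex.Im (f (s +i* t)).
set al := complex.Re d in df; set be := complex.Im d in df.
have near s t : x' <= s <= x' + a' -> y' <= t <= y' + b' ->
    `|U s t - (U p q + al * (s - p) - be * (t - q))| <= e / 4 * (a' + b') /\
    `|V s t - (V p q + al * (t - q) + be * (s - p))| <= e / 4 * (a' + b').
  move=> /andP[s1 s2] /andP[t1 t2].
  have hn' : normc ((s +i* t) - (p +i* q)) <= a' + b'.
    apply: le_trans (normc_le_ReIm _) _; rewrite cReD cImD cReN cImN /=.
    move: hp hq => /andP[? ?] /andP[? ?].
    by apply: lerD; rewrite ler_norml; apply/andP; split; lra.
  have {}df := df _ (le_lt_trans hn' hn).
  have le : e / 4 * normc ((s +i* t) - (p +i* q)) <= e / 4 * (a' + b').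
    by rewrite ler_pM2l.
  split.
    apply: le_trans le; apply: le_trans df; apply: le_trans (le_Re_normc _).
    rewrite !(cReD, cReN, cReM) cImD cImN /= -/al -/be -/(U _ _) -/(U _ _).
    by rewrite le_eqVlt; apply/orP; left; apply/eqP; congr `|_|; ring.
  apply: le_trans le; apply: le_trans df; apply: le_trans (le_Im_normc _).
  rewrite !(cImD, cImN, cImM) cReD cReN /= -/al -/be -/(V _ _) -/(V _ _).
  by rewrite le_eqVlt; apply/orP; left; apply/eqP; congr `|_|; ring.
have sub s t : x' <= s <= x' + a' -> y' <= t <= y' + b' ->
    x <= s <= x + a /\ y <= t <= y + b.
  by move=> /andP[? ?] /andP[? ?]; split; apply/andP; split; lra.
have iny1 : y' <= y' <= y' + b' by rewrite lexx lerDl.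
have iny2 : y' <= y' + b' <= y' + b' by rewrite lexx lerDl bn0.
have inx1 : x' <= x' <= x' + a' by rewrite lexx lerDl.
have inx2 : x' <= x' + a' <= x' + a' by rewrite lexx lerDl an0.
have bottom := @edge_bound (G y') (U^~ y') x' a' (U p q - be * (y' - q)) al p
  (e / 4 * (a' + b')) an0.
have top := @edge_bound (G (y' + b')) (U^~ (y' + b')) x' a'
  (U p q - be * (y' + b' - q)) al p (e / 4 * (a' + b')) an0.
have left := @edge_bound (H x') (V x') y' b'
  (V p q + be * (x' - p)) al q (e / 4 * (a' + b')) bn0.
have right := @edge_bound (H (x' + a')) (V (x' + a')) y' b'
  (V p q + be * (x' + a' - p)) al q (e / 4 * (a' + b')) bn0.
have {}bottom := bottom
   (fun s hs => let: conj A B := sub s y' hs iny1 in let: And3 _ X _ := hyp s y' A B in X).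
have {}top := top
   (fun s hs => let: conj A B := sub s _ hs iny2 in let: And3 _ X _ := hyp s _ A B in X).
have {}left := left
   (fun s hs => let: conj A B := sub _ s inx1 hs in let: And3 _ _ X := hyp _ s A B in X).
have {}right := right
   (fun s hs => let: conj A B := sub _ s inx2 hs in let: And3 _ _ X := hyp _ s A B in X).
move: lt; rewrite ltNge => /negP; apply.
have {}bottom : `|G y' (x' + a') - G y' x' - ((U p q - be * (y' - q)) * a' + al *
   ((x' + a' - p) ^+ 2 - (x' - p) ^+ 2) / 2)| <= e / 4 * (a' + b') * a'.
  apply: bottom => s hs; have [+ _] := near _ _ hs iny1.
  by congr (`|_| <= _); ring.
have {}top : `|G (y' + b') (x' + a') - G (y' + b') x' - ((U p q - be * (y' + b' - q)) * a' + al *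
   ((x' + a' - p) ^+ 2 - (x' - p) ^+ 2) / 2)| <= e / 4 * (a' + b') * a'.
  apply: top => s hs; have [+ _] := near _ _ hs iny2.
  by congr (`|_| <= _); ring.
have {}left : `|H x' (y' + b') - H x' y' - ((V p q + be * (x' - p)) * b' + al *
   ((y' + b' - q) ^+ 2 - (y' - q) ^+ 2) / 2)| <= e / 4 * (a' + b') * b'.
  apply: left => s hs; have [_] := near _ _ inx1 hs.
  by congr (`|_| <= _); ring.
have {}right : `|H (x' + a') (y' + b') - H (x' + a') y' - ((V p q + be * (x' + a' - p)) * b' + al *
   ((y' + b' - q) ^+ 2 - (y' - q) ^+ 2) / 2)| <= e / 4 * (a' + b') * b'.
  apply: right => s hs; have [_] := near _ _ inx2 hs.
  by congr (`|_| <= _); ring.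
move: bottom top left right; rewrite /J !ler_norml.
set g1 := G y' (x' + a') - _; set g2 := G (y' + b') _ - _.
set h1 := H x' _ - _; set h2 := H (x' + a') _ - _.
set qx := al * _ / 2; set qy := al * _ / 2.
(* The contributions of the affine parts of the four sides cancel. *)
have K : (U p q - be * (y' - q)) * a' - (U p q - be * (y' + b' - q)) * a'
  + (V p q + be * (x' - p)) * b' - (V p q + be * (x' + a' - p)) * b' = 0 by ring.
have E1 : e * (a' + b') ^+ 2 = 4 * (e / 4 * (a' + b') * a')
   + 4 * (e / 4 * (a' + b') * b') by field.
have kp : 0 <= e / 4 * (a' + b') by rewrite mulr_ge0 // ?addr_ge0 // ltW.
have k1p : 0 <= e / 4 * (a' + b') * a' by rewrite mulr_ge0.
have k2p : 0 <= e / 4 * (a' + b') * b' by rewrite mulr_ge0.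
move: K E1 k1p k2p; set k1 := e / 4 * _ * a'; set k2 := e / 4 * _ * b'.
set c1 := (U p q - _) * a'; set c2 := (U p q - _) * a'.
set c3 := (V p q + _) * b'; set c4 := (V p q + _) * b'.
clearbody k1 k2 c1 c2 c3 c4 qx qy g1 g2 h1 h2 => K -> k1p k2p.
move=> /andP[u1 u2] /andP[u3 u4] /andP[u5 u6] /andP[u7 u8].
clear -K k1p k2p u1 u2 u3 u4 u5 u6 u7 u8.
by apply/andP; split; lra.
Qed.

(** The second derivative is only required to exist at the maximum, as the
    derivative of a function [psi] that is itself not assumed continuous. *)
Lemma second_derivative_test (phi psi : R -> R) (p r c : R) : 0 < r ->
  (forall s, `|s - p| < r -> rderiv phi s (psi s)) -> rderiv psi p c ->
  (forall s, `|s - p| < r -> phi s <= phi p) -> c <= 0.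
Proof.
move=> r0 dphi dpsi pmax; rewrite leNgt; apply/negP => c0.
have pp : `|p - p| < r by rewrite subrr normr0.
have psi0 : psi p = 0.
  apply/eqP; apply: contrapT => /negP N.
  have e0 : 0 < `|psi p| / 2 by rewrite divr_gt0 // normr_gt0.
  have [d d0 H] := dphi _ pp _ e0.
  pose t := Num.min r d / 2 * Num.sg (psi p).
  have m0 : 0 < Num.min r d by rewrite lt_min r0.
  have nt : `|t| = Num.min r d / 2.
    by rewrite normrM normr_sg N mulr1 ger0_norm // divr_ge0 // ltW.
  have tr : `|t| < Num.min r d by rewrite nt; lra.
  move: (tr); rewrite lt_min => /andP[tr1 tr2].
  have := H (p + t); rewrite addrAC subrr add0r => /(_ tr2).
  have := pmax (p + t); rewrite addrAC subrr add0r => /(_ tr1).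
  have -> : psi p * t = `|psi p| * `|t|.
    by rewrite nt /t [`|psi p|]normrEsg; ring.
  have t0 : 0 < `|t| by rewrite nt divr_gt0.
  have := mulr_gt0 e0 t0; rewrite ler_norml.
  by move=> h1 h2 /andP[h3 h4]; move: h1 h2 h3; clear; lra.
have e0 : 0 < c / 2 by rewrite divr_gt0.
have [d d0 H] := dpsi _ e0.
have m0 : 0 < Num.min r d by rewrite lt_min r0.
pose t := Num.min r d / 2.
have t0 : 0 < t by rewrite divr_gt0.
have tm : t < Num.min r d by rewrite /t; lra.
move: tm; rewrite lt_min => /andP[tr td].
have near s : p <= s <= p + t -> `|s - p| < r /\ c / 2 * (s - p) <= psi s.
  move=> /andP[s1 s2]; have sp : `|s - p| = s - p by rewrite ger0_norm // subr_ge0.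
  split; first by rewrite sp; lra.
  have := H s; rewrite sp psi0 subr0 ler_norml => H'.
  have /H' /andP[? _] : s - p < d by lra.
  lra.
have [||x1 hx1 e1] := @rderiv_MVT R phi psi p (p + t / 2).
- lra.
- by move=> s /andP[? ?]; apply: dphi; have [] := near s _; first by apply/andP; split; lra.
have [||x2 hx2 e2] := @rderiv_MVT R phi psi (p + t / 2) (p + t).
- lra.
- by move=> s /andP[? ?]; apply: dphi; have [] := near s _; first by apply/andP; split; lra.
move: hx1 hx2 => /andP[? ?] /andP[? ?].
have [_ n1] : `|x1 - p| < r /\ c / 2 * (x1 - p) <= psi x1.
  by apply: near; apply/andP; split; lra.
have [_ n2] : `|x2 - p| < r /\ c / 2 * (x2 - p) <= psi x2.
  by apply: near; apply/andP; split; lra.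
have hp1 : 0 <= psi x1 by apply: le_trans n1; apply: mulr_ge0; lra.
have hp2 : 0 < psi x2 by apply: lt_le_trans n2; apply: mulr_gt0; lra.
have := pmax (p + t); rewrite addrAC subrr add0r ger0_norm ?(ltW t0) // => /(_ tr).
have hh1 : 0 <= psi x1 * (p + t / 2 - p) by apply: mulr_ge0; lra.
have hh2 : 0 < psi x2 * (p + t - (p + t / 2)) by apply: mulr_gt0; lra.
move: e1 e2 hh1 hh2; clear; lra.
Qed.

Lemma cderiv_Re_x (f : C -> C) (x y : R) d : cderiv f (x +i* y) d ->
  rderiv (fun s => complex.Re (f (s +i* y))) x (complex.Re d).
Proof.
move=> H e /H[r r0 {}H]; exists r => // s sr.
have E : (s +i* y) - (x +i* y) = (s - x)%:C by congr (_ +i* _); rewrite subrr.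
have := H (s +i* y); rewrite E normc_real => /(_ sr); apply: le_trans.
by apply: le_trans (le_Re_normc _); rewrite !(cReD, cReN, cReM) /= mulr0 subr0.
Qed.

Lemma normc_imag (t : R) : normc (0 +i* t) = `|t|.
Proof. by rewrite /= expr0n /= add0r sqrtr_sqr. Qed.

Lemma cderiv_Im_y (f : C -> C) (x y : R) d : cderiv f (x +i* y) d ->
  rderiv (fun s => complex.Im (f (x +i* s))) y (complex.Re d).
Proof.
move=> H e /H[r r0 {}H]; exists r => // s sr.
have E : (x +i* s) - (x +i* y) = 0 +i* (s - y) by congr (_ +i* _); rewrite subrr.
have := H (x +i* s); rewrite E normc_imag => /(_ sr); apply: le_trans.
by apply: le_trans (le_Im_normc _); rewrite !(cImD, cImN, cImM) /= mulr0 addr0.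
Qed.

(** Heine--Cantor; the increment may leave the ball, as the averaging segments in
    [no_local_max] do. *)
Lemma uniform_increment (f : C -> C) (z0 : C) (rho e : R) : 0 < e ->
  (forall z, normc (z - z0) <= rho -> ccont f z) ->
  exists2 h : R, 0 < h & forall z t, normc (z - z0) <= rho -> normc t <= h ->
    normc (f (z + t) - f z) < e.
Proof.
move=> e0 cf.
have [|||h h0 H] := @compact_induction R (fun A => exists2 h : R, 0 < h &
    forall z t, A (z - z0) -> normc (z - z0) <= rho -> normc t <= h ->
    normc (f (z + t) - f z) < e) _ _ _ rho.
- move=> A B [h1 h10 H1] [h2 h20 H2]; exists (Num.min h1 h2); first by rewrite lt_min h10.
  move=> z t [Az|Bz] zr; rewrite le_min => /andP[s1 s2].
    exact: H1.
  exact: H2.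
- by move=> A B AB [h h0 H]; exists h => // z t /AB; apply: H.
- move=> p.
  have [pr|pr] := leP (normc p) rho; last first.
    exists (normc p - rho); first by rewrite subr_gt0.
    exists 1 => // z t /= zp zr _.
    have := normc_tri (z - z0) p 0; rewrite !subr0 normcB; lra.
  have e2 : 0 < e / 2 by rewrite divr_gt0.
  have [|r r0 H] := cf (p + z0) _ _ e2; first by rewrite addrK.
  exists (r / 2); first by rewrite divr_gt0.
  exists (r / 4); first by rewrite divr_gt0.
  move=> z t /= zp zr s1.
  have E : z - z0 - p = z - (p + z0) by rewrite opprD addrA addrAC.
  rewrite E in zp.
  have z1 : normc (z - (p + z0)) < r by lra.
  have z2 : normc (z + t - (p + z0)) < r.
    have E1 : z + t - z = t by ring.
    have := normc_tri z (z + t) (p + z0); rewrite E1; lra.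
  have := normc_tri (f (p + z0)) (f (z + t)) (f z).
  have := H _ z2; have := H _ z1; rewrite (normcB (f z)); lra.
by exists h => // z t zr; apply: H.
Qed.

(** Adding delta |z|^2 makes the Laplacian of Re f positive, which excludes a
    local maximum; but f is not known to have second derivatives.  So Re f is
    replaced by its mean A over a short horizontal segment of length h.  Its
    partial derivatives are difference quotients of Re f and of - Im f, the
    second one by Goursat's theorem; hence they are differentiable again and the
    Laplacian of A vanishes.  Replacing delta |z|^2 by a polynomial with half the
    Laplacian makes the maximum strict, and this survives the passage from Re f
    to A. *)
Lemma no_local_max (f : C -> C) (x1 y1 rho delta : R) : 0 < rho -> 0 < delta ->
  (forall z, normc (z - (x1 +i* y1)) < rho -> exists d, cderiv f z d) ->
  ~ (forall x y, normc ((x +i* y) - (x1 +i* y1)) < rho ->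
     complex.Re (f (x +i* y)) + delta * (x ^+ 2 + y ^+ 2) <=
     complex.Re (f (x1 +i* y1)) + delta * (x1 ^+ 2 + y1 ^+ 2)).
Proof.
move=> rho0 delta0 hol loc.
pose sg := rho / 8.
have sg0 : 0 < sg by rewrite divr_gt0.
have inball x y : `|x - x1| <= 4 * sg -> `|y - y1| <= 2 * sg ->
    normc ((x +i* y) - (x1 +i* y1)) < rho.
  move=> hx hy; apply: le_lt_trans (normc_le_ReIm _) _.
  by rewrite cReD cImD cReN cImN /=; rewrite /sg in hx hy sg0; lra.
pose U x y := complex.Re (f (x +i* y)); pose V x y := complex.Im (f (x +i* y)).
have /choice[df Hdf] (z : C) : exists d,
    normc (z - (x1 +i* y1)) < rho -> cderiv f z d.
  have [/hol[d]|] := pselect (normc (z - (x1 +i* y1)) < rho); first by exists d.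
  by exists 0.
have /choice[G HG] (y : R) : exists G, `|y - y1| <= 2 * sg ->
    forall x, `|x - x1| < 4 * sg -> rderiv G x (U x y).
  have [hy|] := pselect (`|y - y1| <= 2 * sg); last by exists id.
  have [|G HG] := @primitive R (U^~ y) (x1 - 4 * sg) (x1 + 4 * sg).
    move=> x xin; apply: rderiv_cont; apply: cderiv_Re_x; apply: Hdf.
    by apply: inball => //; rewrite ler_distl.
  by exists G => _ x xin; apply: HG; rewrite -ltr_distl.
have /choice[H HH] (x : R) : exists H, `|x - x1| <= 4 * sg ->
    forall y, `|y - y1| < 2 * sg -> rderiv H y (V x y).
  have [hx|] := pselect (`|x - x1| <= 4 * sg); last by exists id.
  have [|H HH] := @primitive R (V x) (y1 - 2 * sg) (y1 + 2 * sg).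
    move=> y yin; apply: rderiv_cont; apply: cderiv_Im_y; apply: Hdf.
    by apply: inball => //; rewrite ler_distl.
  by exists H => _ y yin; apply: HH; rewrite -ltr_distl.
have cf z : normc (z - (x1 +i* y1)) <= 6 * sg -> ccont f z.
  move=> hz; have [|d] := hol z; last exact: cderiv_cont.
  by rewrite /sg in hz sg0; lra.
(* 2 eta is less than the drop delta sg^2 / 2 of the strict maximum on the
   boundary of the square *)
pose eta := delta * sg ^+ 2 / 8.
have eta0 : 0 < eta by rewrite divr_gt0 // mulr_gt0 // exprn_gt0.
have [h0 h00 Hh0] := uniform_increment eta0 cf.
pose h := Num.min h0 sg.
have hpos : 0 < h by rewrite lt_min h00.
have hn0 : h != 0 by rewrite gt_eqF.
have hh0 : h <= h0 by rewrite ge_min lexx.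
have hsg : h <= sg by rewrite ge_min lexx orbT.
pose A x y := (G y (x + h) - G y x) / h.
pose B x y := (H (x + h) y - H x y) / h.
have inb6 x y : `|x - x1| <= 3 * sg -> `|y - y1| <= sg ->
    normc ((x +i* y) - (x1 +i* y1)) <= 6 * sg.
  move=> hx hy; apply: le_trans (normc_le_ReIm _) _.
  by rewrite cReD cImD cReN cImN /=; lra.
have lt24 : 2 * sg < 4 * sg by clear -sg0; lra.
have y2 y : `|y - y1| <= sg -> `|y - y1| <= 2 * sg.
  by clear -sg0 => hy; lra.
have seg x s : `|x - x1| <= sg -> x <= s <= x + h -> `|s - x1| <= 2 * sg.
  clear -hsg hpos; rewrite !ler_norml => /andP[? ?] /andP[? ?].
  by apply/andP; split; lra.
have seg3 x s : `|x - x1| <= sg -> x <= s <= x + h -> `|s - x1| <= 3 * sg.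
  by move=> hx hs; apply: le_trans (seg _ _ hx hs) _; clear -sg0; lra.
(* A is a mean of U over a segment on which U varies by less than eta *)
have AU x y : `|x - x1| <= sg -> `|y - y1| <= sg -> `|A x y - U x y| < eta.
  move=> hx hy.
  have [||c cx e] := @rderiv_MVT R (G y) (U^~ y) x (x + h).
  - by rewrite lerDl ltW.
  - move=> s hs; apply: HG; first exact: y2.
    exact: le_lt_trans (seg _ _ hx hs) lt24.
  have -> : A x y = U c y.
    by rewrite /A e addrAC subrr add0r mulfK.
  move: cx => /andP[c1 c2].
  have := Hh0 (x +i* y) (c - x)%:C (inb6 x y _ hy).
  rewrite normc_real (_ : (x +i* y) + (c - x)%:C = c +i* y); last first.
    by congr (_ +i* _); [rewrite addrC subrK | rewrite addr0].
  move=> Hc; apply: (le_lt_trans (le_trans _ (le_Re_normc _)) (Hc _ _)).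
  - by rewrite cReD cReN.
  - by clear -hx sg0; lra.
  - by rewrite ger0_norm ?subr_ge0 //; clear -c2 hh0; lra.
have Acont x y e : `|x - x1| <= sg -> `|y - y1| <= sg -> 0 < e ->
   exists2 r : R, 0 < r & forall x' y', `|x' - x1| <= sg -> `|y' - y1| <= sg ->
   normc ((x' +i* y') - (x +i* y)) < r -> `|A x' y' - A x y| <= e.
  move=> hx hy e0; have [r r0 Hr] := uniform_increment e0 cf.
  exists r => // x' y' hx' hy' close.
  have [||c cx E] := @rderiv_MVT R (fun s => G y' (s + (x' - x)) - G y s)
     (fun s => U (s + (x' - x)) y' - U s y) x (x + h).
  - by rewrite lerDl ltW.
  - move=> s hs; apply: rderivB.
      apply: (@rderiv_shift R (G y')); apply: HG; first exact: y2.
      apply: le_lt_trans (seg x' _ hx' _) lt24.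
      by case/andP: hs; clear => *; apply/andP; split; lra.
    apply: HG; first exact: y2.
    exact: le_lt_trans (seg _ _ hx hs) lt24.
  have -> : A x' y' - A x y = U (c + (x' - x)) y' - U c y.
    rewrite /A -mulrBl; apply: (mulIf hn0); rewrite divfK //.
    have -> : (U (c + (x' - x)) y' - U c y) * h = (U (c + (x' - x)) y' - U c y) * (x + h - x).
      by congr (_ * _); ring.
    rewrite -E (_ : x + h + (x' - x) = x' + h); last ring.
    rewrite (_ : x + (x' - x) = x'); last ring.
    ring.
  have := Hr (c +i* y) ((x' +i* y') - (x +i* y)) (inb6 c y _ hy) (ltW close).
  rewrite (_ : (c +i* y) + _ = (c + (x' - x)) +i* y'); last first.
    by congr (_ +i* _); rewrite [y' - y]addrC addrA subrr add0r.
  move=> Hc; apply/ltW/(le_lt_trans (le_trans _ (le_Re_normc _)) (Hc _)).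
    by rewrite cReD cReN.
  exact: seg3 hx cx.
(* Goursat's theorem exchanges the vertical increments of A and B *)
have AB x y y' : `|x - x1| <= sg -> `|y - y1| <= sg -> `|y' - y1| <= sg ->
    y <= y' -> A x y' + B x y' = A x y + B x y.
  move=> hx hy hy' yy'.
  have := @goursat f G H x y h (y' - y) (ltW hpos).
  rewrite subr_ge0 yy' (_ : y + (y' - y) = y'); last ring.
  move=> /(_ isT) gou.
  have /gou E : forall s t : R, x <= s <= x + h -> y <= t <= y' ->
    [/\ exists d, cderiv f (s +i* t) d,
      rderiv (G t) s (complex.Re (f (s +i* t)))
      & rderiv (H s) t (complex.Im (f (s +i* t)))].
    move=> s t /andP[s1 s2] /andP[t1 t2].
    have hs : `|s - x1| < 4 * sg.
      by apply: le_lt_trans (seg x _ hx _) lt24; rewrite s1.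
    have ht : `|t - y1| < 2 * sg.
      move: hy hy'; rewrite !ler_norml ltr_norml => /andP[? ?] /andP[? ?].
      by apply/andP; split; lra.
    split; [exists (df (s +i* t)); apply: Hdf; apply: inball; exact: ltW
           |apply: HG => //; exact: ltW | apply: HH => //; exact: ltW].
  rewrite /A /B -!mulrDl; congr (_ / h); apply/eqP; rewrite -subr_eq0 -oppr_eq0.
  by apply/eqP; rewrite -[RHS]E; ring.
have ABe x y y' : `|x - x1| <= sg -> `|y - y1| <= sg -> `|y' - y1| <= sg ->
    A x y' + B x y' = A x y + B x y.
  by move=> hx hy hy'; have [/AB->//|/ltW/AB->//] := leP y y'.
(* delta |z|^2 - delta/2 |z - z1|^2 is qq x1 x + qq y1 y *)
pose qq t0 t := delta * (t * t) - delta / 2 * ((t - t0) * (t - t0)).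
have dqq t0 t : rderiv (qq t0) t (delta * 2 * t - delta * (t - t0)).
  apply: rderiv_eq.
    apply: rderivB; apply: rderivM; [exact: rderiv_cst| | exact: rderiv_cst|].
      by apply: rderivM; exact: rderiv_id.
    by apply: rderivM; apply: rderivB; [exact: rderiv_id|exact: rderiv_cst
      |exact: rderiv_id|exact: rderiv_cst].
  by rewrite /=; field.
have ddqq t0 t : rderiv (fun t => delta * 2 * t - delta * (t - t0)) t delta.
  apply: rderiv_eq.
    apply: rderivB; apply: rderivM; [exact: rderiv_cst|exact: rderiv_id
     |exact: rderiv_cst|].
    by apply: rderivB; [exact: rderiv_id|exact: rderiv_cst].
  by rewrite /=; ring.
pose K := [set z : C | `|complex.Re z - x1| <= sg /\ `|complex.Im z - y1| <= sg].
pose Phi (z : C) := A (complex.Re z) (complex.Im z) + qq x1 (complex.Re z)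
   + qq y1 (complex.Im z).
have Kz1 : K (x1 +i* y1) by split; rewrite /= subrr normr0 ltW.
have [|||[p q] [/= hp hq] pqmax] := @attains_max R K Phi
    (`|x1| + `|y1| + 2 * sg) _ Kz1.
- move=> [x y] [hx hy]; apply: le_trans (normc_le_ReIm (x +i* y)) _.
  move: hx hy => /= hx hy; have := ler_distD x1 x 0; have := ler_distD y1 y 0; rewrite !subr0; lra.
- move=> [x y] NK; have [hx|hx] := leP `|x - x1| sg; last first.
    exists (`|x - x1| - sg); first by rewrite subr_gt0.
    move=> [x' y'] [hx' _]; apply: le_trans (le_Re_normc _).
    by move: hx'; rewrite cReD cReN /= => hx'; have := ler_distD x' x x1; rewrite (distrC x x'); lra.
  have [hy|hy] := leP `|y - y1| sg; first by case: NK.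
  exists (`|y - y1| - sg); first by rewrite subr_gt0.
  move=> [x' y'] [_ hy']; apply: le_trans (le_Im_normc _).
  by move: hy'; rewrite cImD cImN /= => hy'; have := ler_distD y' y y1; rewrite (distrC y y'); lra.
- move=> [x y] [/= hx hy] e e0; have e4 : 0 < e / 4 by rewrite divr_gt0.
  have [r1 r10 H1] := Acont _ _ _ hx hy e4.
  have [r2 r20 H2] := rderiv_cont (dqq x1 x) e4.
  have [r3 r30 H3] := rderiv_cont (dqq y1 y) e4.
  exists (Num.min r1 (Num.min r2 r3)); first by rewrite !lt_min r10 r20.
  move=> [x' y'] [hx' hy']; rewrite !lt_min => /and3P[/(H1 _ _ hx' hy') c1].
  move=> /(le_lt_trans (le_Re_normc _)); rewrite cReD cReN => /H2 c2.
  move=> /(le_lt_trans (le_Im_normc _)); rewrite cImD cImN => /H3 c3.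
  rewrite /Phi /=; move: c1 c2 c3; rewrite ler_norml !ltr_norml.
  by move=> /andP[? ?] /andP[? ?] /andP[? ?]; lra.
(* hence the maximum is attained in the interior of the square *)
have hpq : (p - x1) ^+ 2 + (q - y1) ^+ 2 <= sg ^+ 2 / 2.
  have := pqmax _ Kz1; rewrite /Phi /=.
  have x1s : `|x1 - x1| <= sg by rewrite subrr normr0 ltW.
  have y1s : `|y1 - y1| <= sg by rewrite subrr normr0 ltW.
  have := AU _ _ x1s y1s; have := AU _ _ hp hq; rewrite !ltr_norml.
  have := loc p q; rewrite -/(U p q) -/(U x1 y1) => L.
  have pq_in : normc ((p +i* q) - (x1 +i* y1)) < rho.
    by apply: inball; [clear -hp sg0; lra | exact: y2].
  move=> /andP[a1 a2] /andP[a3 a4] a5.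
  have {}L := L pq_in.
  have : delta * ((p - x1) ^+ 2 + (q - y1) ^+ 2) <= delta * (sg ^+ 2 / 2).
    move: a1 a2 a3 a4 a5 L; rewrite /qq /eta.
    set a := A p q; set b := A x1 y1; set u := U p q; set v := U x1 y1.
    by clearbody a b u v sg; clear; nra.
  by rewrite ler_pM2l.
have sq_lt (a : R) : a ^+ 2 <= sg ^+ 2 / 2 -> `|a| < sg.
  move=> ha; rewrite -(ltr_pXn2r (n := 2)) ?nnegrE ?(ltW sg0) //.
  rewrite real_normK ?num_real //; apply: le_lt_trans ha _.
  by rewrite ltr_pdivrMr // ltr_pMr ?ltr1n // exprn_gt0.
have hp' : `|p - x1| < sg by apply: sq_lt; have := sqr_ge0 (q - y1); lra.
have hq' : `|q - y1| < sg by apply: sq_lt; have := sqr_ge0 (p - x1); lra.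
have dfin s t : `|s - x1| <= 4 * sg -> `|t - y1| <= 2 * sg ->
  cderiv f (s +i* t) (df (s +i* t)) by move=> ? ?; apply: Hdf; apply: inball.
have hph : `|p + h - x1| <= 4 * sg.
  by apply: le_trans (seg p _ hp _) (ltW lt24); rewrite lexx lerDl ltW.
have hp4 : `|p - x1| <= 4 * sg by clear -hp sg0; lra.
have hq2 : `|q - y1| <= 2 * sg by apply: y2.
set d2 := df ((p + h) +i* q); set d1 := df (p +i* q).
(* the two second partial derivatives of A at the maximum are opposite *)
have tx : (complex.Re d2 - complex.Re d1) / h + delta <= 0.
  apply: (@second_derivative_test (fun s => Phi (s +i* q))
    (fun s => (U (s + h) q - U s q) * h^-1 + (delta * 2 * s - delta * (s - x1)))
    p (sg - `|p - x1|)).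
  - by rewrite subr_gt0.
  - move=> s hs.
    have hsx : `|s - x1| <= sg.
      by have := ler_distD p s x1; clear -hs; lra.
    apply: (rderiv_ext (f := fun s => (G q (s + h) - G q s) * h^-1 + qq x1 s + qq y1 q)) => //.
    apply: rderiv_eq.
      apply: rderivD; last exact: rderiv_cst.
      apply: rderivD; last exact: dqq.
      apply: rderivM; last exact: rderiv_cst.
      apply: rderivB; first (apply: rderiv_shift; apply: HG => //).
        by apply: le_lt_trans (seg s _ hsx _) lt24; rewrite lexx lerDl ltW.
      by apply: HG => //; apply: le_lt_trans hsx _; clear -sg0; lra.
    by rewrite /=; ring.
  - apply: rderiv_eq.
      apply: rderivD; last exact: ddqq.
      apply: rderivM; last exact: rderiv_cst.
      apply: rderivB; first apply: (@rderiv_shift R (U^~ q)).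
        by apply: cderiv_Re_x; apply: dfin.
      by apply: cderiv_Re_x; apply: dfin.
    by rewrite /=; ring.
  - move=> s hs; apply: pqmax; split => //=.
    by have := ler_distD p s x1; clear -hs; lra.
have ty : - ((complex.Re d2 - complex.Re d1) / h) + delta <= 0.
  have r0 : 0 < sg - `|q - y1| by rewrite subr_gt0.
  have htin t : `|t - q| < sg - `|q - y1| -> `|t - y1| <= sg.
    by move=> ht; have := ler_distD q t y1; clear -ht; lra.
  apply: (@second_derivative_test (fun t => Phi (p +i* t))
    (fun t => - ((V (p + h) t - V p t) * h^-1) + (delta * 2 * t - delta * (t - y1)))
    q _ _ r0).
  - move=> t ht; have htq := htin _ ht.
    pose r := sg - `|q - y1| - `|t - q|.
    have r'0 : 0 < r by rewrite subr_gt0.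
    apply: (rderiv_local (f := fun t => A p q + B p q - B p t + qq x1 p + qq y1 t) r'0).
      move=> t' ht'; rewrite /Phi /= (_ : A p t' = A p q + B p q - B p t') //.
      apply/eqP; rewrite eq_sym subr_eq; apply/eqP/esym/ABe => //.
      by apply: htin; have := ler_distD t t' q; rewrite /r in ht'; clear -ht'; lra.
    apply: rderiv_eq.
      apply: rderivD; last exact: dqq.
      apply: rderivD; last exact: rderiv_cst.
      apply: rderivB; first exact: rderiv_cst.
      apply: rderivM; last exact: rderiv_cst.
      have ht2 : `|t - y1| < 2 * sg by apply: le_lt_trans htq _; clear -sg0; lra.
      by apply: rderivB; apply: HH.
    by rewrite /=; ring.
  - apply: rderiv_eq.
      apply: rderivD; last exact: ddqq.
      apply: rderivN; apply: rderivM; last exact: rderiv_cst.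
      by apply: rderivB; apply: cderiv_Im_y; apply: dfin.
    by rewrite /=; ring.
  - by move=> t ht; apply: pqmax; split => //=; apply: htin.
move: tx ty; set c := (_ - _) / h; clear -delta0; lra.
Qed.

(** The maximum principle on an arbitrary open set, with boundary values and
    values at infinity in the sense of an upper limit.  If Re f were positive
    somewhere, the set where it is at least half of this value would be compact,
    and Re f + delta |z|^2 with a small delta would have a maximum there, which
    would be a local maximum. *)
Lemma max_principle (U : set C) (f : C -> C) :
  (forall z, U z -> exists2 r : R, 0 < r & forall w, normc (w - z) < r -> U w) ->
  (forall z, U z -> exists d, cderiv f z d) ->
  (forall p e, ~ U p -> 0 < e -> exists2 r : R, 0 < r &
     forall z, U z -> normc (z - p) < r -> complex.Re (f z) < e) ->
  (forall e, 0 < e -> exists r : R, forall z, U z -> r < normc z ->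
     complex.Re (f z) < e) ->
  forall z, U z -> complex.Re (f z) <= 0.
Proof.
move=> Uo hol bdry infty z0 Uz0; rewrite leNgt; apply/negP => m0.
set m := complex.Re (f z0) in m0.
have e0 : 0 < m / 2 by rewrite divr_gt0.
pose K := [set z | U z /\ m / 2 <= complex.Re (f z)].
have Kz0 : K z0 by split => //; rewrite -/m; lra.
have [B HB] := infty _ e0.
have KB z : K z -> normc z <= B.
  move=> [Uz mz]; rewrite leNgt; apply/negP => /(HB _ Uz); lra.
have B0 : 0 <= B by apply: le_trans (normc_ge0 _) (KB _ Kz0).
pose delta := m / (8 * (B ^+ 2 + 1)).
have B1 : 0 < B ^+ 2 + 1 by rewrite ltr_wpDl // sqr_ge0.
have delta0 : 0 < delta by rewrite divr_gt0 // mulr_gt0.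
have dB : 8 * (delta * (B ^+ 2 + 1)) = m by rewrite /delta; field; rewrite gt_eqF.
pose phi (z : C) := complex.Re (f z) + delta * (complex.Re z ^+ 2 + complex.Im z ^+ 2).
have [p|p [Up mp] e e1|[x1 y1] [U1 m1] Hmax] := @attains_max R K phi B z0 Kz0 KB.
- have [Up NK|NU _] := pselect (U p).
    have lt : 0 < m / 2 - complex.Re (f p).
      by rewrite subr_gt0 ltNge; apply/negP => H; apply: NK.
    have [d /cderiv_cont/(_ _ lt)[r r0 Hr]] := hol _ Up.
    exists r => // z [Uz mz]; rewrite leNgt; apply/negP => /Hr.
    move=> /(le_lt_trans (le_Re_normc _)); rewrite cReD cReN ltr_norml => /andP[_]; lra.
  have [r r0 Hr] := bdry _ _ NU e0; exists r => // z [Uz mz].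
  by rewrite leNgt; apply/negP => /(Hr _ Uz); lra.
- have [d dfp] := hol _ Up; have e2 : 0 < e / 4 by rewrite divr_gt0.
  have [r1 r10 H1] := cderiv_cont dfp e2.
  have dsq (t : R) : rderiv (fun t => delta * (t * t)) t (delta * (2 * t)).
    apply: rderiv_eq.
      by apply: rderivM; [exact: rderiv_cst|apply: rderivM; exact: rderiv_id].
    by rewrite /=; ring.
  have [r2 r20 H2] := rderiv_cont (dsq (complex.Re p)) e2.
  have [r3 r30 H3] := rderiv_cont (dsq (complex.Im p)) e2.
  exists (Num.min r1 (Num.min r2 r3)); first by rewrite !lt_min r10 r20.
  move=> z _; rewrite !lt_min => /and3P[/H1 /(le_lt_trans (le_Re_normc _)) +].
  move=> + /(le_lt_trans (le_Re_normc _)) + /(le_lt_trans (le_Im_normc _)).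
  rewrite !cReD !cReN cImD cImN => + /H2 + /H3; rewrite !ltr_norml /phi !expr2 !mulrDr.
  by move=> /andP[? ?] /andP[? ?] /andP[? ?]; lra.
have := Hmax _ Kz0; rewrite /phi -/m /= => h1.
have sq0 := addr_ge0 (sqr_ge0 (complex.Re z0)) (sqr_ge0 (complex.Im z0)).
have h2 := mulr_ge0 (ltW delta0) sq0.
have hx : x1 ^+ 2 <= B ^+ 2.
  rewrite -(real_normK (num_real x1)) ler_pXn2r ?nnegrE //.
  by apply: le_trans (KB (x1 +i* y1) _); [exact: (le_Re_normc (x1 +i* y1))|].
have hy : y1 ^+ 2 <= B ^+ 2.
  rewrite -(real_normK (num_real y1)) ler_pXn2r ?nnegrE //.
  by apply: le_trans (KB (x1 +i* y1) _); [exact: (le_Im_normc (x1 +i* y1))|].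
have h3 : delta * (x1 ^+ 2 + y1 ^+ 2) <= delta * (2 * (B ^+ 2 + 1)).
  by rewrite ler_pM2l //; lra.
have big : 0 < complex.Re (f (x1 +i* y1)) - m / 2 by lra.
have [d /cderiv_cont/(_ _ big)[r1 r10 H1]] := hol _ U1.
have [r2 r20 H2] := Uo _ U1.
have r0 : 0 < Num.min r1 r2 by rewrite lt_min r10.
apply: (no_local_max (f := f) (x1 := x1) (y1 := y1) r0 delta0).
  by move=> z; rewrite lt_min => /andP[_ /H2 /hol].
move=> x y; rewrite lt_min => /andP[/H1 h /H2 Uxy].
apply: (Hmax (x +i* y)); split => //.
move: h => /(le_lt_trans (le_Re_normc _)); rewrite cReD cReN ltr_norml => /andP[? ?]; lra.
Qed.

End MaximumPrinciple.

(** * The open mapping theorem *)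

Section OpenMapping.
Variable R : realType.
Notation C := R[i].

(** If w is close to f(z0) but not a value of f on the ball, then
    (f(z0) - w) / (f - w) is holomorphic, equals 1 at z0, and is bounded by a
    constant smaller than 1 on the circle. *)
Lemma open_mapping (f : C -> C) (z0 : C) (rho : R) : 0 < rho ->
  (forall z, normc (z - z0) <= rho -> exists d, cderiv f z d) ->
  (forall z, normc (z - z0) = rho -> f z <> f z0) ->
  exists2 eta : R, 0 < eta &
    forall w, normc (w - f z0) < eta -> exists2 z, normc (z - z0) < rho & f z = w.
Proof.
move=> rho0 hol circ.
pose K := [set z : C | normc (z - z0) = rho].
have Kp0 : K (z0 + rho%:C).
  by rewrite /K /= addrAC subrr add0r normc_real ger0_norm // ltW.
have KB z : K z -> normc z <= rho + normc z0.
  by move=> <-; have := normc_tri z0 z 0; rewrite !subr0.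
have [p NK|p Kp e e0|p Kp pmax] :=
    @attains_max R K (fun z => - normc (f z - f z0)) _ _ Kp0 KB.
- exists `|normc (p - z0) - rho|; first by rewrite normr_gt0 subr_eq0; apply/eqP.
  move=> z Kz; rewrite -Kz ler_norml.
  have := normc_tri z p z0; have := normc_tri p z z0; rewrite (normcB p z).
  by move=> ? ?; apply/andP; split; lra.
- have [|d /cderiv_cont/(_ _ e0)[r r0 H]] := hol p; first by rewrite Kp.
  exists r => // z Kz /H; have := normc_tri (f z) (f p) (f z0); rewrite (normcB (f p) (f z)); lra.
set m := normc (f p - f z0).
have m0 : 0 < m by rewrite normc_gt0 subr_eq0; apply/eqP/circ.
have circm z : normc (z - z0) = rho -> m <= normc (f z - f z0).
  by move=> /pmax; rewrite lerN2.
exists (m / 2); first by rewrite divr_gt0.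
move=> w wm; apply: contrapT => N.
have Nw z : normc (z - z0) < rho -> f z - w != 0.
  by move=> hz; rewrite subr_eq0; apply/eqP => E; apply: N; exists z.
pose c := f z0 - w.
have cm : normc c < m / 2 by rewrite normcB.
have circw z : normc (z - z0) = rho -> m - normc c <= normc (f z - w).
  move=> /circm; have := normc_tri w (f z) (f z0); rewrite (normcB w (f z0)) -/c; lra.
have Nw' z : normc (z - z0) <= rho -> f z - w != 0.
  rewrite le_eqVlt => /orP[/eqP/circw|/Nw //].
  by rewrite -normc_gt0; lra.
pose b := normc c / (m - normc c).
have b1 : b < 1 by rewrite ltr_pdivrMr; lra.
pose g z := c / (f z - w) - b%:C.
have ghol z : normc (z - z0) <= rho -> exists d, cderiv g z d.
  move=> hz; have [d dz] := hol _ hz.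
  eexists; apply: cderivB; last exact: cderiv_cst.
  apply: cderivM; first exact: cderiv_cst.
  by apply: cderivV; [exact: Nw'|apply: cderivB; [exact: dz|exact: cderiv_cst]].
have := @max_principle R [set z | normc (z - z0) < rho] g.
have zz0 : normc (z0 - z0) < rho by rewrite subrr Normc.normc0.
have H4 : complex.Re (g z0) = 1 - b.
  rewrite /g -/c mulfV; last by rewrite /c Nw.
  by rewrite cReD cReN.
move=> /(_ _ _ _ _ _ zz0); rewrite H4 => H; suff : 1 - b <= 0 by lra.
apply: H.
- move=> z /= hz; exists (rho - normc (z - z0)); first by rewrite subr_gt0.
  by move=> v hv; have := normc_tri z v z0; lra.
- by move=> z /= /ltW; apply: ghol.
- move=> p' e /= /negP; rewrite -leNgt le_eqVlt => /orP[/eqP Ep|lt] e0; last first.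
    exists (normc (p' - z0) - rho); first by rewrite subr_gt0.
    by move=> z /= h1 h2; have := normc_tri z p' z0; rewrite (normcB p' z); lra.
  have [|d /cderiv_cont/(_ _ e0)[r r0 Hr]] := ghol p'; first by rewrite Ep.
  exists r => // z _ /Hr /(le_lt_trans (le_Re_normc _)); rewrite cReD cReN.
  have : complex.Re (g p') <= 0.
    rewrite /g cReD cReN /= subr_le0.
    apply: le_trans (ler_norm _) (le_trans (le_Re_normc _) _).
    rewrite Normc.normcM Normc.normcV /b ler_wpM2l ?normc_ge0 // lef_pV2 ?posrE.
    + exact: circw.
    + by rewrite normc_gt0 Nw' // Ep.
    + lra.
  by rewrite ltr_norml => ? /andP[? ?]; lra.
- move=> e e0; exists (rho + normc z0) => z /= h1.
  by have := normc_tri z0 z 0; rewrite !subr0; lra.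
Qed.

Definition rcontC (phi : C -> R) (z : C) :=
  forall e : R, 0 < e -> exists2 r : R, 0 < r & forall w, normc (w - z) < r ->
    `|phi w - phi z| < e.

Lemma rcontC_Im (f : C -> C) z : ccont f z -> rcontC (fun w => complex.Im (f w)) z.
Proof.
move=> H e /H[r r0 {}H]; exists r => // w /H; apply: le_lt_trans.
by rewrite -cImN -cImD le_Im_normc.
Qed.

(** The intermediate value theorem on a segment; this replaces all connectedness
    arguments in the complex plane. *)
Lemma segment_sign (phi : C -> R) (p q : C) :
  (forall t : R, 0 <= t <= 1 -> rcontC phi (p + t%:C * (q - p)) /\
     phi (p + t%:C * (q - p)) != 0) ->
  0 < phi q -> 0 < phi p.
Proof.
move=> H q0; rewrite ltNge; apply/negP => p0.
pose g t := phi (p + t%:C * (q - p)).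
have E0 : g 0 = phi p by rewrite /g mul0r addr0.
have E1 : g 1 = phi q by rewrite /g mul1r addrCA subrr addr0.
have [|||c] := @IVT R g 0 1 0.
- by [].
- apply: rcont_within => t /H[+ _] e e0 => /(_ _ e0)[r r0 Hr].
  have n0 : 0 < normc (q - p) + 1 by rewrite ltr_wpDl // normc_ge0.
  exists (r / (normc (q - p) + 1)); first by rewrite divr_gt0.
  move=> s; rewrite ltr_pdivlMr // => hs; apply: Hr.
  rewrite opprD addrACA subrr add0r -mulrBl -rmorphB Normc.normcM normc_real.
  by apply: le_lt_trans hs; rewrite ler_wpM2l // lerDl.
- by rewrite E0 E1 ge_min p0 le_max (ltW q0) orbT.
by rewrite in_itv /= => /H[_ /eqP N] /N.
Qed.

End OpenMapping.

(** * The plane with the gaps removed *)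

Section GapDomain.
Variable R : realType.
Notation C := R[i].
Variables zm zp : int -> R.

Lemma not_closureP (A : set R) (x : R) :
  ~ closure A x -> exists2 r : R, 0 < r & forall y, `|y - x| < r -> ~ A y.
Proof.
move=> N; apply: contrapT => N'; apply: N => B /nbhs_normP[r /= r0 rB].
apply: contrapT => NAB; apply: N'; exists r => // y yr Ay; apply: NAB.
by exists y; split => //; apply: rB; rewrite /= distrC.
Qed.

Lemma not_closureI (A : set R) (x r : R) : 0 < r ->
  (forall y, `|y - x| < r -> ~ A y) -> ~ closure A x.
Proof.
move=> r0 H; have nb : nbhs x [set y | `|y - x| < r].
  by apply/nbhs_normP; exists r => //= y /=; rewrite distrC.
by move=> /(_ _ nb)[y [Ay yr]]; exact: H Ay.
Qed.

Lemma gap_domain_nonreal (z : C) : complex.Im z != 0 -> gap_domain zm zp z.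
Proof. by move=> z0 [x _ E]; rewrite -E /= eqxx in z0. Qed.

Lemma gap_domain_real (x : R) : gap_domain zm zp x%:C <-> ~ closure (gaps zm zp) x.
Proof.
split=> [H cx|N [y cy [E]]]; first by apply: H; exists x.
by apply: N; rewrite -E.
Qed.

Lemma gap_domain_open (z : C) : gap_domain zm zp z ->
  exists2 r : R, 0 < r & forall w, normc (w - z) < r -> gap_domain zm zp w.
Proof.
case: z => x y; have [->|y0] := eqVneq y 0.
  move=> /gap_domain_real/not_closureP[r r0 H]; exists r => // -[x' y'] hw.
  have [y'0|y'0] := eqVneq y' 0; last exact: gap_domain_nonreal.
  rewrite y'0; apply/gap_domain_real.
  have hx : `|x' - x| < r.
    by apply: le_lt_trans hw; apply: le_trans (le_Re_normc _); rewrite cReD cReN.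
  apply: (@not_closureI _ _ (r - `|x' - x|)); first by rewrite subr_gt0.
  by move=> t ht; apply: H; have := ler_distD x' t x; lra.
move=> _; exists `|y|; first by rewrite normr_gt0.
move=> w hw; apply: gap_domain_nonreal; apply/eqP => w0.
have := le_Im_normc (w - (x +i* y)); rewrite cImD cImN w0 /= sub0r normrN; lra.
Qed.

Lemma gap_not_domain (n : int) (x : R) : zm n < x < zp n -> ~ gap_domain zm zp x%:C.
Proof.
move=> xn /gap_domain_real; apply; apply: subset_closure.
by exists n; rewrite //= in_itv.
Qed.

Lemma away_from_multiples (c p : R) : 0 < p ->
  (forall n : int, c <> p * n%:~R) ->
  exists2 d : R, 0 < d & forall c' (n : int), `|c' - c| < d -> c' <> p * n%:~R.
Proof.
move=> p0 Nc; pose n0 := Num.floor (c / p).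
have l1 : p * n0%:~R < c.
  rewrite lt_def; apply/andP; split; first by apply/eqP.
  by rewrite mulrC -ler_pdivlMr // floor_le.
have l2 : c < p * (n0 + 1)%:~R.
  by rewrite mulrC -ltr_pdivrMr // floorD1_gt.
exists (Num.min (c - p * n0%:~R) (p * (n0 + 1)%:~R - c)).
  by rewrite lt_min !subr_gt0 l1.
move=> c' n; rewrite lt_min => /andP[+ +] E.
rewrite !ltr_norml E => /andP[a1 _] /andP[_ a2].
have : p * n0%:~R < p * n%:~R by lra.
have : p * n%:~R < p * (n0 + 1)%:~R by lra.
rewrite !ltr_pM2l // !ltr_int => b1 b2.
by move: b1; rewrite ltzD1 leNgt b2.
Qed.

End GapDomain.

(** * The conformal map onto the plane with vertical slits *)

Section Quasimomentum.
Variable R : realType.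
Notation C := R[i].
Variables (zm zp h : int -> R) (k : C -> C).
Notation D := (gap_domain zm zp).
Notation E := (~` slits zm zp h).
Hypothesis h_ge0 : forall n, 0 <= h n.
Hypothesis k_bij : set_bij D E k.
Hypothesis k_hol : forall z, D z -> exists d, cderiv k z d.
Hypothesis k_infty : asymptotic_to_id D k.
Hypothesis k_left : forall n, zm n < zp n -> forall e : R, 0 < e ->
  exists2 r : R, 0 < r & forall z, D z -> normc (z - (zm n)%:C) < r ->
    normc (k z - (pi * n%:~R)%:C) < e.
Hypothesis k_right : forall n, zm n < zp n -> forall e : R, 0 < e ->
  exists2 r : R, 0 < r & forall z, D z -> normc (z - (zp n)%:C) < r ->
    normc (k z - (pi * n%:~R)%:C) < e.

Lemma slit_free (w : C) : (forall n : int, complex.Re w <> pi * n%:~R) -> E w.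
Proof. by move=> H [n _ [/H]]. Qed.

(** The open mapping theorem on a small ball around z: the inverse of k is
    continuous, and its domain is open. *)
Lemma inverse_continuous (z : C) (e : R) : D z -> 0 < e ->
  exists2 r : R, 0 < r & forall w, normc (w - k z) < r ->
    exists z', [/\ D z', normc (z' - z) < e & k z' = w].
Proof.
move=> Dz e0; have [r r0 Hr] := gap_domain_open Dz.
have m0 : 0 < Num.min r e / 2 by rewrite divr_gt0 // lt_min r0.
have lt : Num.min r e / 2 < Num.min r e by lra.
have [||eta eta0 H] := open_mapping (f := k) (z0 := z) m0.
- move=> w hw; apply: k_hol; apply: Hr; apply: (le_lt_trans hw).
  by move: lt; rewrite lt_min => /andP[].
- move=> w hw Ekw; have Dw : D w.
    by apply: Hr; rewrite hw; move: lt; rewrite lt_min => /andP[].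
  have [_ kinj _] := k_bij.
  have Ezw : w = z by apply: kinj => //; rewrite inE.
  by move: hw m0; rewrite Ezw subrr Normc.normc0 => <-; rewrite ltxx.
exists eta => // w /H[z' hz' Ez']; exists z'; split => //.
  by apply: Hr; apply: (lt_trans hz'); move: lt; rewrite lt_min => /andP[].
by apply: (lt_trans hz'); move: lt; rewrite lt_min => /andP[].
Qed.

Lemma inverse_exists : exists kappa : C -> C, forall w, E w ->
  [/\ D (kappa w), k (kappa w) = w & forall e : R, 0 < e ->
    exists2 r : R, 0 < r & forall w', normc (w' - w) < r ->
      E w' /\ normc (kappa w' - kappa w) < e].
Proof.
have [kfun kinj ksurj] := k_bij.
have /choice[kappa H] (w : C) : exists z, E w -> D z /\ k z = w.
  have [Ew|NE] := pselect (E w); last by exists 0.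
  by have [z Dz Ez] := ksurj _ Ew; exists z.
exists kappa => w Ew; have [Dk Ek] := H _ Ew; split => // e e0.
have [r r0 Hr] := inverse_continuous Dk e0.
exists r => // w'; rewrite -{1}Ek => /Hr[z' [Dz' hz' Ez']].
have Ew' : E w' by rewrite -Ez'; apply: kfun.
split => //; suff -> : kappa w' = z' by [].
have [Dk' Ek'] := H _ Ew'.
by apply: kinj; rewrite ?inE // Ek' Ez'.
Qed.

(** Outside of a large disc k(z) - z is bounded, so the inverse kappa of k does
    not take values on a suitable circle |z| = r' at points w with |w| > r' + 1.
    Along a vertical line far from the origin and between two slits |kappa| - r'
    then keeps its sign, which is positive high up, where k(z) is close to z. *)
Lemma Re_k_bounded (r : R) : exists rho : R, forall z, D z -> normc z <= r ->
  `|complex.Re (k z)| <= rho.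
Proof.
have [kfun kinj ksurj] := k_bij.
have [kappa Hk] := inverse_exists.
have [r1 Hr1] := k_infty ltr01.
pose r' := Num.max (Num.max r r1) 0 + 1.
have r'r : r < r' by rewrite ltr_pwDr // !le_max lexx.
have r'r1 : r1 < r' by rewrite ltr_pwDr // !le_max lexx orbT.
have r'0 : 0 < r' by rewrite ltr_pwDr // le_max lexx orbT.
exists (r' + 1) => z Dz zr; rewrite leNgt; apply/negP => big.
pose psi w := normc (kappa w) - r'.
have psi_cont w : E w -> rcontC psi w.
  move=> Ew e e0; have [_ _ /(_ _ e0)[s s0 Hs]] := Hk _ Ew.
  exists s => // w' /Hs[_]; apply: le_lt_trans.
  rewrite /psi; have := normc_tri (kappa w) (kappa w') 0.
  have := normc_tri (kappa w') (kappa w) 0; rewrite !subr0 (normcB (kappa w)).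
  by move=> ? ?; rewrite ler_norml; apply/andP; split; lra.
have psi_neq0 w : E w -> r' + 1 < `|complex.Re w| -> psi w != 0.
  move=> Ew hw; apply/eqP => p0; have [Dk Ek _] := Hk _ Ew.
  have nk : normc (kappa w) = r' by move: p0; rewrite /psi; lra.
  have := Hr1 _ Dk; rewrite nk => /(_ r'r1); rewrite Ek.
  have := normc_tri (kappa w) w 0; rewrite !subr0 nk.
  have := le_Re_normc w; lra.
have line w w' : (forall t : R, 0 <= t <= 1 -> E (w + t%:C * (w' - w)) /\
    r' + 1 < `|complex.Re (w + t%:C * (w' - w))|) -> 0 < psi w' -> 0 < psi w.
  move=> H; apply: segment_sign => t /H[Et ht]; split; first exact: psi_cont.
  exact: psi_neq0.
(* a detour from the vertical line to the image of a high point of it *)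
have vert w : (forall n : int, complex.Re w <> pi * n%:~R) ->
    r' + 1 < `|complex.Re w| -> 0 < psi w.
  move=> Nw hw; have [d d0 Hd] := away_from_multiples (pi_gt0 R) Nw.
  pose e := Num.min d (`|complex.Re w| - (r' + 1)).
  have e0 : 0 < e by rewrite lt_min d0 subr_gt0.
  have good (c : C) : `|complex.Re c - complex.Re w| < e ->
      E c /\ r' + 1 < `|complex.Re c|.
    rewrite lt_min => /andP[h1 h2]; split.
      by apply: slit_free => n; apply: Hd.
    have := ler_distD (complex.Re c) (complex.Re w) 0; rewrite !subr0 (distrC (complex.Re w)); lra.
  have [r2 Hr2] := k_infty e0.
  pose Y := `|r2| + r' + 1.
  have Y0 : 0 < Y by rewrite /Y; have := normr_ge0 r2; lra.
  pose q := complex.Re w +i* Y.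
  have Dq : D q by apply: gap_domain_nonreal; rewrite /= gt_eqF.
  have qY : Y <= normc q.
    by apply: le_trans (le_Im_normc _); rewrite /= ger0_norm // ltW.
  have kq : normc (k q - q) < e.
    by apply: Hr2 => //; have := ler_norm r2; rewrite /Y in qY; lra.
  apply: (line w q).
    move=> t _; apply: good; rewrite cReD cReM cReD cReN cImD cImN /= subrr mulr0 mul0r.
    by rewrite subrr addr0 subrr normr0.
  apply: (line q (k q)).
    move=> t /andP[t0 t1]; apply: good; rewrite cReD cReM /= mul0r subr0.
    rewrite addrAC subrr add0r normrM (ger0_norm t0).
    apply: le_lt_trans kq; apply: le_trans (ler_piMl _ t1) (le_Re_normc _).
    exact: normr_ge0.
  have Ekq : E (k q) by apply: kfun.
  have [Dk Ek _] := Hk _ Ekq.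
  rewrite /psi (_ : kappa (k q) = q); last by apply: kinj; rewrite ?inE.
  by rewrite subr_gt0; have := normr_ge0 r2; rewrite /Y in qY; lra.
have Ekz : E (k z) by apply: kfun.
have : psi (k z) < 0.
  have [Dk Ek _] := Hk _ Ekz.
  rewrite /psi (_ : kappa (k z) = z); last by apply: kinj; rewrite ?inE.
  by lra.
suff : 0 < psi (k z) by move=> /lt_trans hlt /hlt; rewrite ltxx.
have [Nz|] := pselect (forall n : int, complex.Re (k z) <> pi * n%:~R).
  exact: vert.
move=> /existsNP[n /contrapT En].
(* above or below a slit, first move sideways by a small amount *)
have [_ _ /(_ _ ltr01)[s s0 Hs]] := Hk _ Ekz.
pose t := Num.min (Num.min s (`|complex.Re (k z)| - (r' + 1))) pi / 2.
have pi0 := pi_gt0 R.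
have tt0 : 0 < Num.min (Num.min s (`|complex.Re (k z)| - (r' + 1))) pi.
  by rewrite !lt_min s0 pi0 subr_gt0 big.
have t0 : 0 < t by rewrite divr_gt0.
have tt : t < Num.min (Num.min s (`|complex.Re (k z)| - (r' + 1))) pi by rewrite /t; lra.
move: tt; rewrite !lt_min => /andP[/andP[ts tbig] tpi].
have rebig u : 0 <= u <= t -> r' + 1 < `|complex.Re (k z) + u|.
  move=> /andP[u0 ut]; have := ler_distD (complex.Re (k z) + u) (complex.Re (k z)) 0.
  by rewrite !subr0 opprD addrA subrr add0r normrN (ger0_norm u0); lra.
apply: (line (k z) (k z + t%:C)).
  move=> u /andP[u0 u1]; rewrite [k z + t%:C - _]addrAC subrr add0r -rmorphM /=.
  have ut : 0 <= u * t <= t by rewrite mulr_ge0 ?(ltW t0) //= ler_piMl // ltW.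
  split; last by rewrite cReD; apply: rebig.
  have [] // := Hs (k z + (u * t)%:C).
  rewrite addrAC subrr add0r normc_real ger0_norm; last by case/andP: ut.
  by case/andP: ut => _; lra.
apply: vert; last by rewrite cReD; apply: rebig; rewrite (ltW t0) lexx.
move=> m; rewrite cReD /= En => Em.
have : pi * (m - n)%:~R = t by rewrite rmorphB /=; lra.
move=> Et; have m1 : 0 < pi * (m - n)%:~R :> R by rewrite Et.
have m2 : pi * (m - n)%:~R < pi * 1%:~R :> R by rewrite Et mulr1.
move: m1 m2; rewrite pmulr_rgt0 // ltr_pM2l // ltr0z ltr_int => m1.
by rewrite ltNge -gtz0_ge1 m1.
Qed.

Lemma finitely_many_gaps_avoided (t : R) (N : nat) :
  (forall m, zm m < zp m -> ~ (zm m <= t <= zp m)) ->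
  exists2 d : R, 0 < d & forall m : int, (absz m <= N)%N -> zm m < zp m ->
    forall x, `|x - t| < d -> ~ (zm m < x < zp m).
Proof.
move=> Nt.
have one (m : int) : exists2 d : R, 0 < d & zm m < zp m ->
    forall x, `|x - t| < d -> ~ (zm m < x < zp m).
  have [lt|le] := ltP (zm m) (zp m); last by exists 1.
  have [tl|tl] := ltP t (zm m).
    exists (zm m - t); first by rewrite subr_gt0.
    by move=> _ x; rewrite ltr_norml => /andP[_ ?] /andP[? _]; lra.
  have [tr|tr] := leP t (zp m); first by case: (Nt _ lt); rewrite tl.
  exists (t - zp m); first by rewrite subr_gt0.
  by move=> _ x; rewrite ltr_norml => /andP[? _] /andP[_ ?]; lra.
elim: N => [|N [d d0 Hd]].
  have [d d0 Hd] := one 0; exists d => // m; rewrite leqn0 absz_eq0 => /eqP ->.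
  exact: Hd.
have [d1 d10 Hd1] := one N.+1%:Z; have [d2 d20 Hd2] := one (- N.+1%:Z).
exists (Num.min d (Num.min d1 d2)); first by rewrite !lt_min d0 d10.
move=> m; rewrite leq_eqVlt => /orP[/eqP mN|mN] lt x; rewrite !lt_min => /and3P[h0 h1 h2].
  have [mE|mE] : m = N.+1%:Z \/ m = - N.+1%:Z.
    case: m mN lt => n /= nN _; [left|right]; first by rewrite nN.
    by rewrite NegzE nN.
    by rewrite mE in lt *; apply: Hd1.
  by rewrite mE in lt *; apply: Hd2.
exact: Hd.
Qed.

(** The gaps do not accumulate at a finite point: near the endpoints of the
    m-th gap k is close to pi m, which is excluded by [Re_k_bounded] if m is
    large and the gap meets a bounded set. *)
Lemma real_not_domain (t : R) : ~ D t%:C ->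
  exists2 m, zm m < zp m & zm m <= t <= zp m.
Proof.
move=> ND; apply: contrapT => N.
have Nt m : zm m < zp m -> ~ (zm m <= t <= zp m).
  by move=> lt tm; apply: N; exists m.
have [rho Hrho] := Re_k_bounded (`|t| + 1).
have pi0 := pi_gt0 R.
pose N0 := Num.truncn ((`|rho| + 1) / pi).
have HN0 : (`|rho| + 1) / pi < N0.+1%:R by exact: truncnS_gt.
have [d d0 Hd] := finitely_many_gaps_avoided N0 Nt.
apply: ND; apply/gap_domain_real.
have r0 : 0 < Num.min d 1 by rewrite lt_min d0 ltr01.
apply: (not_closureI r0) => x; rewrite lt_min => /andP[xd x1] [m _].
rewrite /= in_itv /= => xm.
have lt : zm m < zp m by move: xm => /andP[/lt_trans]; apply.
have [mN|mN] := leqP (absz m) N0; first by exact: (Hd m mN lt x xd xm).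
have mbig : `|rho| + 1 < `|pi * m%:~R|.
  rewrite normrM (ger0_norm (ltW pi0)) -ltr_pdivrMl // mulrC.
  apply: (lt_le_trans HN0); rewrite -intr_norm -abszE -pmulrn ler_nat.
  exact: mN.
(* near an endpoint c of the m-th gap Re k is close to pi m, which is too
   large if c is close to t *)
have contra c : `|c - t| < 1 -> (forall e : R, 0 < e ->
    exists2 r : R, 0 < r & forall z, D z -> normc (z - c%:C) < r ->
    normc (k z - (pi * m%:~R)%:C) < e) -> False.
  move=> ct Hc; have [r rpos Hr] := Hc _ ltr01.
  pose y := Num.min r (1 - `|c - t|) / 2.
  have ymin : 0 < Num.min r (1 - `|c - t|) by rewrite lt_min rpos subr_gt0.
  have y0 : 0 < y by rewrite divr_gt0.
  have : y < Num.min r (1 - `|c - t|) by rewrite /y; lra.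
  rewrite lt_min => /andP[yr yt].
  have Dz : D (c +i* y) by apply: gap_domain_nonreal; rewrite /= gt_eqF.
  have Ez : (c +i* y) - c%:C = 0 +i* y by congr (_ +i* _); [rewrite subrr|rewrite subr0].
  have := Hr _ Dz; rewrite Ez normc_imag ger0_norm ?(ltW y0) // => /(_ yr).
  move=> /(le_lt_trans (le_Re_normc _)); rewrite cReD cReN /=.
  have := Hrho _ Dz.
  have cn : normc (c +i* y) <= `|t| + 1.
    apply: le_trans (normc_le_ReIm _) _; rewrite /= (ger0_norm (ltW y0)).
    by have := ler_distD t c 0; rewrite !subr0; lra.
  move=> /(_ cn).
  have := ler_distD (complex.Re (k (c +i* y))) (pi * m%:~R) 0; rewrite !subr0 distrC.
  have := ler_norm rho; lra.
move: xm x1 => /andP[xl xr]; rewrite ltr_norml => /andP[x1 x2].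
have [tl|tl] := ltP t (zm m).
  by apply: contra (k_left lt); rewrite ltr_norml; apply/andP; split; lra.
have [tr|tr] := leP t (zp m); first by case: (Nt _ lt); rewrite tl.
by apply: contra (k_right lt); rewrite ltr_norml; apply/andP; split; lra.
Qed.

Lemma max_dist (a b c d e : R) : `|a - c| < e -> `|b - d| < e ->
  `|Num.max a b - Num.max c d| < e.
Proof.
rewrite !ltr_norml => /andP[? ?] /andP[? ?].
by case: (leP a b) => ?; case: (leP c d) => ?; apply/andP; split; lra.
Qed.

(** The values of k cannot cross the boundary of a rectangle around the slit:
    this boundary is a compact subset of the image of k, so its preimage keeps a
    positive distance from the gap.  Near the left endpoint the values are inside
    of the rectangle, and every point near the gap is joined to a point near the
    left endpoint by a horizontal segment. *)
Lemma k_near_gap (n : int) (e : R) : zm n < zp n -> 0 < e ->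
  exists2 d : R, 0 < d & forall x y, zm n < x < zp n -> 0 < `|y| -> `|y| < d ->
    `|complex.Re (k (x +i* y)) - pi * n%:~R| < e /\
    `|complex.Im (k (x +i* y))| < h n + e.
Proof.
move=> gap e0.
have pi0 := pi_gt0 R.
pose e' := Num.min e (pi / 2).
have e'0 : 0 < e' by rewrite lt_min e0 divr_gt0.
have e'e : e' <= e by rewrite ge_min lexx.
have e'pi : e' < pi.
  have le2 : e' <= pi / 2 by rewrite ge_min lexx orbT.
  lra.
have he : 0 < h n + e' by have := h_ge0 n; lra.
pose mu (w : C) := Num.max (`|complex.Re w - pi * n%:~R| - e') (`|complex.Im w| - (h n + e')).
have muc w : rcontC mu w.
  move=> t t0; exists t => // w' hw'; apply: max_dist.
    have := le_lt_trans (le_Re_normc _) hw'; rewrite cReD cReN.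
    have := lerB_dist (complex.Re w' - pi * n%:~R) (complex.Re w - pi * n%:~R).
    have := lerB_dist (complex.Re w - pi * n%:~R) (complex.Re w' - pi * n%:~R).
    rewrite (distrC (complex.Re w - _)).
    rewrite (_ : complex.Re w' - _ - _ = complex.Re w' - complex.Re w); last ring.
    by move=> ? ? ?; rewrite ltr_norml; apply/andP; split; lra.
  have := le_lt_trans (le_Im_normc _) hw'; rewrite cImD cImN.
  have := lerB_dist (complex.Im w') (complex.Im w).
  have := lerB_dist (complex.Im w) (complex.Im w'); rewrite (distrC (complex.Im w)).
  by move=> ? ? ?; rewrite ltr_norml; apply/andP; split; lra.
have muE w : mu w = 0 -> E w.
  move=> mw; have [Re0|Re0] := eqVneq (complex.Re w) (pi * n%:~R).
    move=> [m gm [Rem Imm]]; have : m = n.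
      have := Rem; rewrite Re0 => /(mulfI (lt0r_neq0 pi0)) /eqP.
      by rewrite eqr_int => /eqP.
    move=> Emn; rewrite Emn in Imm; move: mw; rewrite /mu Re0 subrr normr0 sub0r.
    by case: leP => ? ?; lra.
  move=> [m gm [Rem Imm]].
  have mn : m != n by apply: contraNneq Re0 => <-; rewrite Rem.
  have : pi <= `|complex.Re w - pi * n%:~R|.
    rewrite Rem -mulrBr -rmorphB normrM (ger0_norm (ltW pi0)).
    rewrite ler_peMr ?(ltW pi0) // -intr_norm -[leLHS]/(1%:~R) ler_int.
    by rewrite -gtz0_ge1 normr_gt0 subr_eq0.
  by move=> big; move: mw; rewrite /mu; case: leP => ? ?; lra.
have [kappa Hk] := inverse_exists.
have [kfun kinj ksurj] := k_bij.
pose B := `|pi * n%:~R| + e' + (h n + e') : R.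
have [|||dK dK0 HK] := @compact_induction R (fun A => exists2 d : R, 0 < d &
   forall w x y, A w -> mu w = 0 -> kappa w = x +i* y -> zm n < x < zp n ->
     0 < `|y| -> `|y| < d -> False) _ _ _ B.
- move=> S T [d1 d10 H1] [d2 d20 H2]; exists (Num.min d1 d2); first by rewrite lt_min d10.
  move=> w x y [Sw|Tw] mw Ew hx hy; rewrite lt_min => /andP[h1 h2].
    exact: (H1 w x y).
  exact: (H2 w x y).
- by move=> S T ST [d d0 H]; exists d => // w x y /ST; apply: H.
- move=> p; have [mp|mp] := eqVneq (mu p) 0; last first.
    have mp0 : 0 < `|mu p| by rewrite normr_gt0.
    have [r r0 Hr] := muc p _ mp0; exists r => //; exists 1 => // w x y /= /Hr + mw.
    by rewrite mw sub0r normrN ltxx.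
  have [Dp Ep Hp] := Hk _ (muE _ mp).
  have [d d0 Hd] := gap_domain_open Dp.
  have d2 : 0 < d / 2 by rewrite divr_gt0.
  have [r r0 Hr] := Hp _ d2; exists r => //; exists (d / 2) => // w x y /= /Hr[_ hw] _ Ew.
  move=> hx _ hy; apply: (gap_not_domain hx); apply: Hd.
  have := normc_tri (kappa w) x%:C (kappa p).
  have -> : x%:C - kappa w = 0 +i* (- y).
    by rewrite Ew; congr (_ +i* _); [rewrite subrr|rewrite sub0r].
  by rewrite normc_imag normrN; lra.
have {}HK w x y : mu w = 0 -> kappa w = x +i* y -> zm n < x < zp n ->
     0 < `|y| -> `|y| < dK -> False.
  move=> mw; apply: (HK w x y) => //=.
  apply: le_trans (normc_le_ReIm _) _.
  have := ler_distD (pi * n%:~R) (complex.Re w) 0; rewrite !subr0 /B => tri.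
  have : mu w <= 0 by rewrite mw.
  by rewrite /mu ge_max => /andP[? ?]; lra.
have [dl dl0 Hl] := k_left gap e'0.
exists (Num.min dK (dl / 2)); first by rewrite lt_min dK0 divr_gt0.
move=> x y xn y0; rewrite lt_min => /andP[ydK ydl].
have yn0 : y != 0 by rewrite -normr_gt0.
pose x0 := zm n + Num.min (dl / 2) (x - zm n).
have mpos : 0 < Num.min (dl / 2) (x - zm n).
  by rewrite lt_min divr_gt0 // subr_gt0; case/andP: xn.
have m1 : Num.min (dl / 2) (x - zm n) <= dl / 2 by rewrite ge_min lexx.
have m2 : Num.min (dl / 2) (x - zm n) <= x - zm n by rewrite ge_min lexx orbT.
have Dxy s : D (s +i* y) by apply: gap_domain_nonreal.
suff : 0 < - mu (k (x +i* y)).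
  rewrite oppr_gt0 /mu gt_max => /andP[h1 h2]; split; lra.
apply: (segment_sign (phi := fun z => - mu (k z)) (q := x0 +i* y)); last first.
  have hz : normc ((x0 +i* y) - (zm n)%:C) < dl.
    apply: le_lt_trans (normc_le_ReIm _) _; rewrite cReD cImD cReN cImN /=.
    by rewrite oppr0 addr0 /x0 addrAC subrr add0r ger0_norm ?(ltW mpos) //; lra.
  have hk := Hl _ (Dxy x0) hz; rewrite oppr_gt0 /mu gt_max.
  have := le_lt_trans (le_Re_normc _) hk; have := le_lt_trans (le_Im_normc _) hk.
  rewrite cReD cReN cImD cImN /= oppr0 addr0 => ? ?.
  by have := h_ge0 n => ?; apply/andP; split; lra.
move=> t /andP[t0 t1].
have -> : (x +i* y) + t%:C * ((x0 +i* y) - (x +i* y)) = (x + t * (x0 - x)) +i* y.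
  by congr (_ +i* _); [rewrite mul0r subr0| rewrite subrr mulr0 mul0r !addr0].
set s := x + _; have sn : zm n < s < zp n.
  move: xn => /andP[xl xr]; rewrite /s /x0.
  have := mpos; have := m2; set mm := Num.min _ _ => mm1 mm2.
  apply/andP; split; last first.
    apply: le_lt_trans xr; rewrite gerDl mulr_ge0_le0 //; lra.
  have : t * (zm n + mm - x) >= 1 * (zm n + mm - x).
    by rewrite ler_wnM2r //; lra.
  lra.
split.
  move=> eps eps0; have [r r0 Hr] := muc (k (s +i* y)) _ eps0.
  have [d /cderiv_cont/(_ _ r0)[r' r'0 Hr']] := k_hol (Dxy s).
  by exists r' => // w /Hr' /Hr; rewrite -opprB opprK normrN distrC -normrN opprD opprK.
rewrite oppr_eq0; apply/eqP => m0.
apply: (HK _ s y m0) => //.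
have [Dk Ek _] := Hk _ (muE _ m0).
by apply: kinj; rewrite ?inE.
Qed.

Lemma Re_k_gap_limit (n : int) (t e : R) : zm n < zp n -> zm n <= t <= zp n ->
  0 < e -> exists2 r : R, 0 < r & forall z, complex.Im z != 0 ->
    normc (z - t%:C) < r -> `|complex.Re (k z) - pi * n%:~R| < e.
Proof.
move=> gap /andP[tl tr] e0.
move: tl; rewrite le_eqVlt => /orP[/eqP <-|tl].
  have [r r0 Hr] := k_left gap e0; exists r => // z Imz /Hr.
  move=> /(_ (gap_domain_nonreal Imz)) /(le_lt_trans (le_Re_normc _)).
  by rewrite cReD cReN.
move: tr; rewrite le_eqVlt => /orP[/eqP ->|tr].
  have [r r0 Hr] := k_right gap e0; exists r => // z Imz /Hr.
  move=> /(_ (gap_domain_nonreal Imz)) /(le_lt_trans (le_Re_normc _)).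
  by rewrite cReD cReN.
have [d d0 Hd] := k_near_gap gap e0.
exists (Num.min d (Num.min (t - zm n) (zp n - t))).
  by rewrite !lt_min d0 !subr_gt0 tl.
move=> [x y] y0; rewrite !lt_min => /and3P[h1 h2 h3].
have hx : forall a, normc ((x +i* y) - t%:C) < a -> `|x - t| < a.
  move=> a; apply: le_lt_trans; apply: le_trans (le_Re_normc _).
  by rewrite cReD cReN.
have [|||//] := Hd x y.
- by move: (hx _ h2) (hx _ h3); rewrite !ltr_norml => /andP[? ?] /andP[? ?]; apply/andP; split; lra.
- by rewrite normr_gt0.
- apply: le_lt_trans h1; apply: le_trans (le_Im_normc _).
  by rewrite cImD cImN /= subr0.
Qed.

(** Either k is continuous at the point, or the point lies in a closed gap and
    [Re_k_gap_limit] applies; the limit is the same from both sides. *)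
Lemma Re_k_limit (t : R) : exists c : R, forall e : R, 0 < e ->
  exists2 r : R, 0 < r & forall z, complex.Im z != 0 ->
    normc (z - t%:C) < r -> `|complex.Re (k z) - c| < e.
Proof.
have [Dt|/real_not_domain[m gap tm]] := pselect (D t%:C).
  exists (complex.Re (k t%:C)) => e e0.
  have [d /cderiv_cont/(_ _ e0)[r r0 Hr]] := k_hol Dt.
  exists r => // z _ /Hr /(le_lt_trans (le_Re_normc _)).
  by rewrite cReD cReN.
by exists (pi * m%:~R) => e e0; apply: Re_k_gap_limit.
Qed.

(** Both signs together say that the real part of k(z) - conj k(conj z)
    vanishes. *)
Lemma Re_k_conj_le (sgn : R) : sgn = 1 \/ sgn = -1 -> forall z, 0 < complex.Im z ->
  complex.Re (sgn%:C * (k z - conjc (k (conjc z)))) <= 0.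
Proof.
move=> sgnE.
have sgn1 a : `|sgn * a| = `|a|.
  by rewrite normrM; case: sgnE => ->; rewrite ?normrN normr1 mul1r.
have ImJ (z : C) : complex.Im (conjc z) = - complex.Im z by case: z.
have ReJ (z : C) : complex.Re (conjc z) = complex.Re z by case: z.
have Dup z : 0 < complex.Im z -> D z by move=> z0; apply: gap_domain_nonreal; rewrite gt_eqF.
have Ddown z : 0 < complex.Im z -> D (conjc z).
  by move=> z0; apply: gap_domain_nonreal; rewrite ImJ oppr_eq0 gt_eqF.
have ReE z : complex.Re (sgn%:C * (k z - conjc (k (conjc z)))) =
    sgn * (complex.Re (k z) - complex.Re (k (conjc z))).
  by rewrite cReM cReD cReN ReJ /= mul0r subr0.
apply: (@max_principle R [set z | 0 < complex.Im z]
  (fun z => sgn%:C * (k z - conjc (k (conjc z))))).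
- move=> z /= z0; exists (complex.Im z) => // w /(le_lt_trans (le_Im_normc _)).
  by rewrite cImD cImN ltr_norml => /andP[? _]; lra.
- move=> z /= z0; have [d1 D1] := k_hol (Dup _ z0); have [d2 D2] := k_hol (Ddown _ z0).
  eexists; apply: cderivM; first exact: cderiv_cst.
  by apply: cderivB; [exact: D1 | apply: cderiv_conj; exact: D2].
- move=> [t y] e /= /negP; rewrite -leNgt le_eqVlt => /orP[/eqP y0|y0] e0; last first.
    exists (- y); first by rewrite oppr_gt0.
    move=> z z0 /(le_lt_trans (le_Im_normc _)).
    by rewrite cImD cImN ltr_norml /= => /andP[_ ?]; lra.
  have e2 : 0 < e / 2 by rewrite divr_gt0.
  have [c /(_ _ e2)[r r0 Hr]] := Re_k_limit t.
  exists r => // z z0 hz; rewrite ReE.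
  have Ety : t +i* y = t%:C by rewrite y0.
  rewrite Ety in hz; apply: le_lt_trans (ler_norm _) _; rewrite sgn1.
  have H1 := Hr _ (lt0r_neq0 z0) hz.
  have H2 : `|complex.Re (k (conjc z)) - c| < e / 2.
    apply: Hr; first by rewrite ImJ oppr_eq0 gt_eqF.
    by rewrite -(conjc_real t) -conjcB normc_conj.
  have := ler_distD c (complex.Re (k z)) (complex.Re (k (conjc z))).
  by rewrite (distrC c); lra.
- move=> e e0; have e2 : 0 < e / 2 by rewrite divr_gt0.
  have [r Hr] := k_infty e2; exists r => z /= z0 hz; rewrite ReE.
  apply: le_lt_trans (ler_norm _) _; rewrite sgn1.
  have := le_lt_trans (le_Re_normc _) (Hr _ (Dup _ z0) hz).
  have := Hr _ (Ddown _ z0); rewrite normc_conj => /(_ hz) /(le_lt_trans (le_Re_normc _)).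
  rewrite !cReD !cReN ReJ.
  have := ler_distD (complex.Re z) (complex.Re (k z)) (complex.Re (k (conjc z))).
  by rewrite (distrC (complex.Re z)); lra.
Qed.

(** The real part of s(z) = k(z) - conj k(conj z) vanishes identically, so the
    imaginary part has derivative zero along vertical lines, and it tends to 0 at
    infinity. *)
Lemma k_conj (z : C) : 0 < complex.Im z -> k (conjc z) = conjc (k z).
Proof.
pose s z := k z - conjc (k (conjc z)).
have Re0 w : 0 < complex.Im w -> complex.Re (s w) = 0.
  move=> w0.
  have := Re_k_conj_le (or_introl erefl) w0.
  have := Re_k_conj_le (or_intror erefl) w0.
  by rewrite !cReM /= !mul0r !subr0 -/(s w) => ? ?; lra.
have ImJ (w : C) : complex.Im (conjc w) = - complex.Im w by case: w.
have Dup w : 0 < complex.Im w -> D w by move=> w0; apply: gap_domain_nonreal; rewrite gt_eqF.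
have Ddown w : 0 < complex.Im w -> D (conjc w).
  by move=> w0; apply: gap_domain_nonreal; rewrite ImJ oppr_eq0 gt_eqF.
have shol x y : 0 < y -> rderiv (fun t => complex.Im (s (x +i* t))) y 0.
  move=> y0; have y0' : 0 < complex.Im (x +i* y) by [].
  have [d1 D1] := k_hol (Dup _ y0'); have [d2 D2] := k_hol (Ddown _ y0').
  have ds : cderiv s (x +i* y) (d1 - conjc d2).
    by apply: cderivB => //; apply: cderiv_conj.
  have <- : complex.Re (d1 - conjc d2) = 0.
    apply: rderiv_unique (cderiv_Re_x ds) _.
    by apply: (rderiv_ext (f := fun=> 0)); [move=> t; rewrite Re0|exact: rderiv_cst].
  exact: cderiv_Im_y.
case: z => x y /= y0.
have Im0 : complex.Im (s (x +i* y)) = 0.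
  apply/eqP; rewrite -normr_le0; apply/ler_addgt0Pr => e e0; rewrite add0r.
  have e2 : 0 < e / 2 by rewrite divr_gt0.
  have [r Hr] := k_infty e2.
  pose Y := Num.max y (`|r| + 1).
  have yY : y <= Y by rewrite le_max lexx.
  have rY : `|r| + 1 <= Y by rewrite le_max lexx orbT.
  have Y0 : 0 < Y by lra.
  have [|c _ EY] := @rderiv_MVT R (fun t => complex.Im (s (x +i* t))) (fun=> 0) y Y yY.
    by move=> t /andP[ty _]; apply: shol; lra.
  have -> : complex.Im (s (x +i* y)) = complex.Im (s (x +i* Y)).
    by move: EY; rewrite mul0r => /eqP; rewrite subr_eq0 => /eqP.
  have YI : 0 < complex.Im (x +i* Y) by [].
  have nY : r < normc (x +i* Y).
    apply: lt_le_trans (le_Im_normc _) => /=; rewrite (ger0_norm (ltW Y0)).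
    by have := ler_norm r; lra.
  have := le_lt_trans (le_Im_normc _) (Hr _ (Dup _ YI) nY).
  have := Hr _ (Ddown _ YI); rewrite normc_conj => /(_ nY) /(le_lt_trans (le_Im_normc _)).
  rewrite /s !cImD !cImN !ImJ; set a := complex.Im (k _); set b := complex.Im (k _).
  by rewrite !ltr_norml ler_norml => /andP[? ?] /andP[? ?]; apply/andP; split; lra.
have : s (x +i* y) = 0.
  by apply/eqP; rewrite eq_complex Re0 // Im0 eqxx.
by rewrite /s => /eqP; rewrite subr_eq0 => /eqP ->; rewrite conjcK.
Qed.

(** A real value at z would be taken at conj z as well; so Im k has no zero in
    the upper half-plane, and it is positive high up. *)
Lemma Im_k_pos (z : C) : 0 < complex.Im z -> 0 < complex.Im (k z).
Proof.
move=> z0; have [kfun kinj ksurj] := k_bij.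
have Dup w : 0 < complex.Im w -> D w by move=> w0; apply: gap_domain_nonreal; rewrite gt_eqF.
have Im_neq0 w : 0 < complex.Im w -> complex.Im (k w) != 0.
  move=> w0; apply/eqP => Ik0.
  have Er : conjc (k w) = k w.
    by case: (k w) Ik0 => a b /= ->; rewrite oppr0.
  have Ew : conjc w = w.
    apply: kinj; rewrite ?inE.
    - by apply: gap_domain_nonreal; case: (w) w0 => a b /= b0; rewrite oppr_eq0 gt_eqF.
    - exact: Dup.
    - by rewrite k_conj.
  by case: w w0 Ew {Ik0 Er} => a b /= b0 [Eb]; lra.
have [r Hr] := k_infty ltr01.
pose Y := `|r| + 2.
have rY := ler_norm r; have r0 := normr_ge0 r.
apply: (segment_sign (phi := fun w => complex.Im (k w)) (q := 0 +i* Y)); last first.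
  have Y0 : 0 < Y by rewrite /Y; lra.
  have := Hr (0 +i* Y) (Dup (0 +i* Y) Y0); rewrite normc_imag (ger0_norm (ltW Y0)).
  have rY' : r < Y by rewrite /Y; lra.
  move=> /(_ rY') /(le_lt_trans (le_Im_normc _)); rewrite cImD cImN /= ltr_norml.
  by move=> /andP[h1 _]; rewrite /Y in Y0 h1 *; lra.
move=> t /andP[t0 t1].
have It : 0 < complex.Im (z + t%:C * (0 +i* Y - z)).
  rewrite cImD cImM cImD cImN /= mul0r addr0.
  have h1 : 0 <= t * Y by rewrite mulr_ge0 // /Y; lra.
  have h2 : 0 <= (1 - t) * complex.Im z by rewrite mulr_ge0 ?subr_ge0 // ltW.
  have [t1'|t1'] := eqVneq t 1; first by rewrite t1' !mul1r /Y; lra.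
  have h3 : 0 < (1 - t) * complex.Im z.
    by rewrite mulr_gt0 // subr_gt0 lt_neqAle t1' t1.
  lra.
split; last exact: Im_neq0.
by apply: rcontC_Im; have [d /cderiv_cont] := k_hol (Dup _ It).
Qed.

End Quasimomentum.

(** * Boundary values and the complex square root *)

Section SquareRoot.
Variable R : realType.
Notation C := R[i].

Lemma cvg_withinP (A : set C) (f : C -> C) (z l : C) :
  f w @[w --> within A (nbhs (z : C^o))] --> (l : C^o) <->
  forall e : R, 0 < e -> exists2 r : R, 0 < r & forall w, A w ->
    normc (w - z) < r -> normc (f w - l) < e.
Proof.
split=> [Hc e e0|H].
  have H := (@cvgrPdist_lt C C^o C (within A (nbhs (z : C^o))) _ f l).1 Hc.
  have e0' : 0 < e%:C by rewrite ltcR.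
  have := H (within_filter A (nbhs_filter (z : C^o))) _ e0'; rewrite near_withinE => Hn.
  have [_ /= /pos_complex[r r0 ->] Hr] := (@nbhs_normP C C^o z _).1 Hn.
  exists r => // w Aw wr; have := Hr w; rewrite /= !complex_normE !ltcR (normcB z) (normcB l).
  exact.
apply/(@cvgrPdist_lt C C^o C (within A (nbhs (z : C^o))) _ f l) => _ /pos_complex[e e0 ->].
have [r r0 Hr] := H _ e0; rewrite near_withinE.
apply/(@nbhs_normP C C^o z); exists r%:C; first by rewrite /= ltcR.
move=> w /=; rewrite !complex_normE !ltcR (normcB z) (normcB l) => wr Aw; exact: Hr.
Qed.

Definition upper : set C := [set z | 0 < complex.Im z].

Definition uplim (f : C -> C) (z l : C) :=
  forall e : R, 0 < e -> exists2 r : R, 0 < r & forall w, upper w ->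
    normc (w - z) < r -> normc (f w - l) < e.

Lemma uplimM f g z a b : uplim f z a -> uplim g z b -> uplim (fun w => f w * g w) z (a * b).
Proof.
move=> /cvg_withinP Hf /cvg_withinP Hg; apply/cvg_withinP.
exact: (@cvgM C C _ (within_filter upper (nbhs_filter (z : C^o))) f g a b Hf Hg).
Qed.

Lemma uplimD f g z a b : uplim f z a -> uplim g z b -> uplim (fun w => f w + g w) z (a + b).
Proof.
move=> /cvg_withinP Hf /cvg_withinP Hg; apply/cvg_withinP.
exact: (@cvgD C C^o C _ (within_filter upper (nbhs_filter (z : C^o))) f g a b Hf Hg).
Qed.

Lemma uplimV f z a : a != 0 -> uplim f z a -> uplim (fun w => (f w)^-1) z a^-1.
Proof.
move=> a0 /cvg_withinP Hf; apply/cvg_withinP.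
exact: (@cvgV C C _ (within_filter upper (nbhs_filter (z : C^o))) f a a0 Hf).
Qed.

Lemma uplim_id z : uplim id z z.
Proof. by move=> e e0; exists e. Qed.

Lemma uplim_cst c z : uplim (fun=> c) z c.
Proof. by move=> e e0; exists 1 => // w _ _; rewrite subrr Normc.normc0. Qed.

Lemma Re_sqrtc_ge0 (z : C) : 0 <= complex.Re (sqrtc z).
Proof. by case: z => a b /=; rewrite sqrtr_ge0. Qed.

Lemma Im_sqrtc_ge0 (z : C) : 0 <= complex.Im z -> 0 <= complex.Im (sqrtc z).
Proof.
case: z => a b /= b0; rewrite mulr_ge0 ?sqrtr_ge0 //.
by case: eqP => // _; rewrite sgr_ge0.
Qed.

Lemma normc_sqr (z : C) : normc z ^+ 2 = complex.Re z ^+ 2 + complex.Im z ^+ 2.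
Proof. by case: z => a b /=; rewrite sqr_sqrtr // addr_ge0 ?sqr_ge0. Qed.

(** The square roots used below lie in the closed first quadrant, where adding
    does not decrease the norm; this bounds sqrt w + sqrt z from below. *)
Lemma normc_first_quadrant (z w : C) : 0 <= complex.Re z -> 0 <= complex.Im z ->
  0 <= complex.Re w -> 0 <= complex.Im w -> normc z <= normc (w + z).
Proof.
move=> z1 z2 w1 w2; rewrite -(ler_pXn2r (n := 2)) ?nnegrE ?normc_ge0 //.
rewrite !normc_sqr cReD cImD; nra.
Qed.

(** From w - z = (sqrt w - sqrt z) (sqrt w + sqrt z): the square root is
    continuous on the closed upper half-plane up to the boundary. *)
Lemma sqrtc_increment (z w : C) : 0 <= complex.Im z -> 0 <= complex.Im w ->
  normc (sqrtc w - sqrtc z) * normc (sqrtc z) <= normc (w - z).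
Proof.
move=> z0 w0.
have -> : w - z = (sqrtc w - sqrtc z) * (sqrtc w + sqrtc z).
  by rewrite -[in LHS](sqr_sqrtc w) -[in LHS](sqr_sqrtc z); ring.
rewrite Normc.normcM ler_wpM2l ?normc_ge0 //.
by apply: normc_first_quadrant; rewrite ?Re_sqrtc_ge0 ?Im_sqrtc_ge0.
Qed.

Lemma sqrtc_neq0 (z : C) : z != 0 -> sqrtc z != 0.
Proof. by rewrite sqrtc_eq0. Qed.

Lemma sqrtc_cont (z : C) (e : R) : z != 0 -> 0 <= complex.Im z -> 0 < e ->
  exists2 r : R, 0 < r & forall w, 0 <= complex.Im w -> normc (w - z) < r ->
    normc (sqrtc w - sqrtc z) < e.
Proof.
move=> z0 Iz e0; have n0 : 0 < normc (sqrtc z) by rewrite normc_gt0 sqrtc_neq0.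
exists (e * normc (sqrtc z)); first by rewrite mulr_gt0.
move=> w Iw hw; rewrite -(ltr_pM2r n0); apply: le_lt_trans hw.
exact: sqrtc_increment.
Qed.

Lemma uplim_sqrtc (z : C) (a : R) : z != a%:C -> 0 <= complex.Im z ->
  uplim (fun w => sqrtc (w - a%:C)) z (sqrtc (z - a%:C)).
Proof.
move=> za Iz e e0.
have [||r r0 Hr] := @sqrtc_cont (z - a%:C) e _ _ e0.
- by rewrite subr_eq0.
- by rewrite cImD cImN /= subr0.
exists r => // w Uw hw; apply: Hr; first by rewrite cImD cImN /= subr0 ltW.
by rewrite opprB addrA subrK.
Qed.

Lemma cderiv_sqrtc (z : C) : 0 < complex.Im z -> cderiv (@sqrtc R) z (2 * sqrtc z)^-1.
Proof.
move=> z0 e e0.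
have zn0 : z != 0 by apply: contraTneq z0 => ->; rewrite ltxx.
have s0 := sqrtc_neq0 zn0; have n0 : 0 < normc (sqrtc z) by rewrite normc_gt0.
have e2 : 0 < e * normc (sqrtc z) ^+ 2 by rewrite mulr_gt0 // exprn_gt0.
have [r r0 Hr] := sqrtc_cont zn0 (ltW z0) e2.
exists (Num.min r (complex.Im z)); first by rewrite lt_min r0.
move=> w; rewrite lt_min => /andP[/Hr H h2].
have Iw : 0 <= complex.Im w.
  have := le_lt_trans (le_Im_normc _) h2; rewrite cImD cImN ltr_norml => /andP[? _]; lra.
have {}H := H Iw.
have sum0 : normc (sqrtc z) <= normc (sqrtc w + sqrtc z).
  by apply: normc_first_quadrant; rewrite ?Re_sqrtc_ge0 ?Im_sqrtc_ge0 // ltW.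
have t0 : sqrtc w + sqrtc z != 0 by rewrite -normc_gt0; lra.
have -> : sqrtc w - sqrtc z - (2 * sqrtc z)^-1 * (w - z) =
   - ((sqrtc w - sqrtc z) * (w - z)) / (2 * sqrtc z * (sqrtc w + sqrtc z)).
  have -> : w - z = (sqrtc w - sqrtc z) * (sqrtc w + sqrtc z).
    by rewrite -[in LHS](sqr_sqrtc w) -[in LHS](sqr_sqrtc z); ring.
  by field; rewrite s0 t0.
rewrite Normc.normcM Normc.normcV -[- _]mulN1r !Normc.normcM.
have -> : normc (-1 : C) = 1 by rewrite /= oppr0 expr0n addr0 sqrrN expr1n sqrtr1.
have -> : normc (2 : C) = 2.
  by rewrite -[2 in LHS]/(2%:R : C) -(rmorph_nat (real_complex R)) normc_real ger0_norm.
rewrite mul1r ler_pdivrMr; last by rewrite !mulr_gt0 //; lra.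
have P : normc (sqrtc z) ^+ 2 <= normc (sqrtc z) * normc (sqrtc w + sqrtc z).
  by rewrite expr2 ler_pM2l.
have n1 := normc_ge0 (w - z).
apply: (le_trans (y := e * normc (sqrtc z) ^+ 2 * normc (w - z))).
  by rewrite ler_wpM2r // ltW.
have e1 : e * normc (sqrtc z) ^+ 2 <= e * (normc (sqrtc z) * normc (sqrtc w + sqrtc z)).
  by rewrite ler_pM2l.
have e3 : 0 <= e * (normc (sqrtc z) * normc (sqrtc w + sqrtc z)).
  by apply: le_trans e1; apply: ltW.
have e4 := ler_wpM2r n1 e1; have e5 := mulr_ge0 e3 n1.
apply: (le_trans e4); rewrite [leRHS](_ : _ = 2 *
  (e * (normc (sqrtc z) * normc (sqrtc w + sqrtc z)) * normc (w - z))); last ring.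
by rewrite ler_peMl // ler1n.
Qed.

End SquareRoot.

(** * Comparison of the conformal map with the square root of one gap *)

Section GapBound.
Variable R : realType.
Notation C := R[i].
Variables (a b pn : R) (k : C -> C).
Hypothesis ab : a < b.
Hypothesis k_hol : forall z, upper z -> exists d, cderiv k z d.
Hypothesis k_pos : forall z, upper z -> 0 < complex.Im (k z).
Hypothesis k_infty : forall e : R, 0 < e -> exists r : R, forall z, upper z ->
  r < normc z -> normc (k z - z) < e.
Hypothesis Re_k_limit : forall t : R, exists c : R, forall e : R, 0 < e ->
  exists2 r : R, 0 < r & forall z, upper z -> normc (z - t%:C) < r ->
  `|complex.Re (k z) - c| < e.
Hypothesis Re_k_gap : forall t e : R, a < t < b -> 0 < e ->
  exists2 r : R, 0 < r & forall z, upper z -> normc (z - t%:C) < r ->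
  `|complex.Re (k z) - pn| < e.
Hypothesis Im_k_gap : forall t : R, a < t < b -> exists B : R,
  exists2 r : R, 0 < r & forall z, upper z -> normc (z - t%:C) < r ->
  complex.Im (k z) <= B.
Let sq_ratio (z : C) := (k z - pn%:C) ^+ 2 / ((z - a%:C) * (z - b%:C)).
Hypothesis k_left : exists2 r : R, 0 <= r & uplim sq_ratio a%:C r%:C.
Hypothesis k_right : exists2 r : R, 0 <= r & uplim sq_ratio b%:C r%:C.

(** The product of two square roots in the first quadrant is the branch of the
    square root of (z - a) (z - b) that is asymptotic to z at infinity; it is
    positive to the right of the gap, negative to the left, and a positive
    multiple of i on the gap. *)
Definition root_ab (z : C) : C := sqrtc (z - a%:C) * sqrtc (z - b%:C).

Lemma sqr_root_ab z : root_ab z ^+ 2 = (z - a%:C) * (z - b%:C).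
Proof. by rewrite /root_ab exprMn !sqr_sqrtc. Qed.

Lemma upper_sub (z : C) (t : R) : upper z -> upper (z - t%:C).
Proof. by rewrite /upper /= cImD cImN /= subr0. Qed.

Lemma upper_neq0 (z : C) : upper z -> z != 0.
Proof. by move=> Uz; apply: contraTneq (Uz) => ->; rewrite /= ltxx. Qed.

Lemma root_ab_neq0 z : upper z -> root_ab z != 0.
Proof. by move=> Uz; apply: mulf_neq0; apply: sqrtc_neq0; apply: upper_neq0; apply: upper_sub. Qed.

Lemma root_ab_hol z : upper z -> exists d, cderiv root_ab z d.
Proof.
have one (t : R) : upper z -> exists d, cderiv (fun w => sqrtc (w - t%:C)) z d.
  move=> Uz; exists (2 * sqrtc (z - t%:C))^-1 => e e0.
  have [r r0 Hr] := cderiv_sqrtc (upper_sub t Uz) e0; exists r => // w hw.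
  by have := Hr (w - t%:C); rewrite opprB addrA subrK; apply.
move=> Uz; have [d1 D1] := one a Uz; have [d2 D2] := one b Uz.
by eexists; apply: cderivM; [exact: D1|exact: D2].
Qed.

Lemma sqrtc_pos (s : R) : 0 <= s -> sqrtc s%:C = (Num.sqrt s)%:C.
Proof. by move=> s0; rewrite sqrtc_sqrtr // ler0c. Qed.

Lemma sqrtc_neg (s : R) : s < 0 -> sqrtc s%:C = 0 +i* Num.sqrt (- s).
Proof.
move=> s0; rewrite /sqrtc /= eqxx mul1r expr0n addr0 sqrtr_sqr ltr0_norm //.
by rewrite addNr mul0r sqrtr0 (_ : (- s - s) / 2 = - s) //; field.
Qed.

Lemma uplim_root_ab (t : R) : t != a -> t != b -> uplim root_ab t%:C (root_ab t%:C).
Proof.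
have c (s : R) : t != s -> t%:C != s%:C by apply: contra_neq => -[].
by move=> ta tb; apply: uplimM; apply: uplim_sqrtc => //; exact: c.
Qed.

(** At the endpoints of the gap only the square of (k - pi n) / f is known to
    have a limit; as this limit is nonnegative, the imaginary part still tends
    to 0. *)
Lemma sq_near_real (F : C) (r0 eta : R) : normc (F ^+ 2 - r0%:C) < eta ->
  0 <= r0 -> complex.Im F ^+ 2 <= eta /\ complex.Re F ^+ 2 <= r0 + eta.
Proof.
move=> H r00.
have E : normc (F ^+ 2) = complex.Re F ^+ 2 + complex.Im F ^+ 2.
  by rewrite expr2 Normc.normcM -expr2 normc_sqr.
have := normc_tri r0%:C (F ^+ 2) 0; rewrite !subr0 E normc_real (ger0_norm r00).
have := le_lt_trans (le_Re_normc _) H.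
rewrite cReD cReN expr2 cReM /= -!expr2 ltr_norml => /andP[h1 h2] h3.
have := sqr_ge0 (complex.Im F); lra.
Qed.

Section Comparison.
Variable x : R.
Hypothesis xab : a < x < b.

Definition quot (z : C) : C := (z - x%:C) / root_ab z.
(** This is (z - x) ((k(z) - pi n) / f(z) - 1), written so that the sign of its
    imaginary part on the real axis is visible. *)
Definition comparison (z : C) : C := quot z * (k z - pn%:C) - (z - x%:C).

Lemma Im_comparison z : complex.Im (comparison z) =
  complex.Re (quot z) * complex.Im (k z) +
  complex.Im (quot z) * (complex.Re (k z) - pn) - complex.Im z.
Proof. by rewrite /comparison cImD cImM cImD cReD !cImN cImD cReN cImN /= !subr0. Qed.

Lemma uplim_quot (t : R) : t != a -> t != b ->
  uplim quot t%:C ((t - x)%:C / root_ab t%:C).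
Proof.
move=> ta tb; apply: uplimM; last first.
  apply: uplimV; last exact: uplim_root_ab.
  have c (s : R) : t != s -> t%:C - s%:C != 0.
    by move=> ts; rewrite subr_eq0; apply: contra_neq ts => -[].
  by rewrite mulf_neq0 // sqrtc_neq0 // c.
rewrite rmorphB; apply: uplimD; first exact: uplim_id.
exact: uplim_cst.
Qed.

(** Both t - x and the root are positive to the right of the gap and negative to
    the left of it. *)
Lemma quot_outside (t : R) : t < a \/ b < t ->
  exists2 c : R, 0 < c & (t - x)%:C / root_ab t%:C = c%:C.
Proof.
move: xab => /andP[ax xb] ht; rewrite /root_ab -!rmorphB.
case: ht => [ta|tb].
  have tb : t < b by lra.
  rewrite !sqrtc_neg ?subr_lt0 // !opprB.
  have -> : (0 +i* Num.sqrt (a - t)) * (0 +i* Num.sqrt (b - t)) =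
     (- (Num.sqrt (a - t) * Num.sqrt (b - t)))%:C.
    by congr (_ +i* _); ring.
  rewrite -fmorphV -rmorphM; eexists; last by [].
  rewrite invrN mulrN -mulNr opprB divr_gt0 //; first lra.
  by rewrite mulr_gt0 // sqrtr_gt0 subr_gt0.
have ta : a < t by lra.
rewrite !sqrtc_pos ?subr_ge0 ?(ltW ta) ?(ltW tb) // -rmorphM -fmorphV -rmorphM.
eexists; last by [].
by rewrite divr_gt0 //; [lra|rewrite mulr_gt0 // sqrtr_gt0 subr_gt0].
Qed.

Lemma root_ab_inside (t : R) : a < t < b ->
  root_ab t%:C = 0 +i* (Num.sqrt (t - a) * Num.sqrt (b - t)).
Proof.
move=> /andP[ta tb]; rewrite /root_ab -!rmorphB.
rewrite sqrtc_pos ?subr_ge0 ?(ltW ta) // sqrtc_neg ?subr_lt0 // opprB.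
by congr (_ +i* _); ring.
Qed.

Lemma quot_inside (t : R) : a < t < b ->
  exists c : R, (t - x)%:C / root_ab t%:C = 0 +i* c.
Proof.
move=> tab; rewrite root_ab_inside //; move: tab => /andP[ta tb].
set s := Num.sqrt _ * Num.sqrt _.
have s0 : 0 < s by rewrite mulr_gt0 // sqrtr_gt0 subr_gt0.
exists (- ((t - x) / s)).
have i0 : 0 +i* s != 0 :> C by rewrite eq_complex /= eqxx gt_eqF.
apply: (mulIf i0); rewrite divfK //; congr (_ +i* _).
  by rewrite mul0r sub0r mulNr opprK divfK // gt_eqF.
by rewrite mul0r mulr0 add0r.
Qed.

(** Outside of the gap the quotient is close to a positive number and Im k is
    positive.  On the gap the quotient is close to an imaginary number, k - pi n
    is close to an imaginary number and both are bounded.  At the endpoints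
    (k - pi n) / f is bounded with small imaginary part. *)
Lemma comparison_boundary (t e : R) : 0 < e ->
  exists2 r : R, 0 < r & forall z, upper z -> normc (z - t%:C) < r ->
    - e < complex.Im (comparison z).
Proof.
move=> e0.
have Imz (z : C) : complex.Im z <= normc (z - t%:C).
  apply: le_trans (ler_norm _) (le_trans _ (le_Im_normc _)).
  by rewrite cImD cImN /= subr0.
have e2 : 0 < e / 2 by rewrite divr_gt0.
have e4 : 0 < e / 4 by rewrite divr_gt0.
(* here (k - pi n) / f = F with F^2 close to a nonnegative number *)
have endpoint : (exists2 r : R, 0 <= r & uplim sq_ratio t%:C r%:C) ->
    exists2 r : R, 0 < r & forall z, upper z -> normc (z - t%:C) < r ->
    - e < complex.Im (comparison z).
  move=> [r0 r00 lim].
  pose L := `|t - x| + 1; have L0 : 0 < L by rewrite ltr_pwDr.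
  pose eta := Num.min 1 ((e / 4 / L) ^+ 2).
  have eta0 : 0 < eta by rewrite lt_min ltr01 exprn_gt0 // divr_gt0.
  have [r rpos Hr] := lim _ eta0.
  have s0 : 0 < r0 + 3 by lra.
  exists (Num.min r (Num.min 1 (e / 4 / (r0 + 3)))).
    by rewrite !lt_min rpos ltr01 divr_gt0.
  move=> z Uz; rewrite !lt_min => /and3P[h1 h2 h3].
  pose F := (k z - pn%:C) / root_ab z.
  have EF : F ^+ 2 = sq_ratio z.
    by rewrite /F expr_div_n sqr_root_ab.
  have := Hr _ Uz h1; rewrite -EF => /sq_near_real/(_ r00)[v2 u2].
  have EP : comparison z = (z - x%:C) * F - (z - x%:C).
    by rewrite /comparison /quot /F; ring.
  have hv : `|complex.Im F| <= e / 4 / L.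
    rewrite -(ler_pXn2r (n := 2)) ?nnegrE //; last by rewrite divr_ge0 // ltW.
    by rewrite real_normK ?num_real // (le_trans v2) // ge_min lexx orbT.
  have hu : `|complex.Re F| <= r0 + 2.
    rewrite -(ler_pXn2r (n := 2)) ?nnegrE //; last lra.
    rewrite real_normK ?num_real // (le_trans u2) //.
    have : eta <= 1 by rewrite ge_min lexx.
    nra.
  have hx : `|complex.Re z - x| <= L.
    have := ler_distD t (complex.Re z) x.
    have := le_lt_trans (le_Re_normc _) h2; rewrite cReD cReN /= /L; lra.
  rewrite EP cImD cImN cImM cImD cReD cReN cImN /= subr0.
  have z3 : complex.Im z < e / 4 / (r0 + 3) by apply: le_lt_trans (Imz z) h3.
  have z0 : 0 < complex.Im z by [].
  have k1 : `|(complex.Re z - x) * complex.Im F| <= e / 4.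
    have := ler_pM (normr_ge0 _) (normr_ge0 _) hx hv.
    by rewrite -normrM [L * _]mulrC divfK // gt_eqF.
  have k2 : complex.Im z * `|complex.Re F - 1| <= e / 4.
    have w : `|complex.Re F - 1| <= r0 + 3.
      by have := ler_normB (complex.Re F) 1; rewrite normr1; lra.
    have := ler_pM (ltW z0) (normr_ge0 _) (ltW z3) w.
    by rewrite divfK // gt_eqF.
  have k3 : - (complex.Im z * `|complex.Re F - 1|) <= complex.Im z * (complex.Re F - 1).
    by rewrite -mulrN ler_pM2l // lerNl -normrN ler_norm.
  move: k1; rewrite ler_norml => /andP[k1 _].
  move: k1 k2 k3; set p1 := (_ - x) * _; set p2 := complex.Im z * `|_|.
  rewrite mulrBr mulr1 => k1 k2 k3; lra.
have [ta|ta] := eqVneq t a; first by apply: endpoint; rewrite ta.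
have [tb|tb] := eqVneq t b; first by apply: endpoint; rewrite tb.
have qlim := uplim_quot ta tb.
have [c Hc] := Re_k_limit t.
have [/quot_outside[l l0 El]|] := pselect (t < a \/ b < t).
  pose B := `|c - pn| + 1; have B0 : 0 < B by rewrite ltr_pwDr.
  pose eta := Num.min l (e / 2 / B).
  have eta0 : 0 < eta by rewrite lt_min l0 divr_gt0.
  rewrite El in qlim; have [r1 r10 H1] := qlim _ eta0.
  have [r2 r20 H2] := Hc _ ltr01.
  exists (Num.min r1 (Num.min r2 (e / 2))); first by rewrite !lt_min r10 r20.
  move=> z Uz; rewrite !lt_min => /and3P[/(H1 _ Uz) h1 /(H2 _ Uz) h2 h3].
  rewrite Im_comparison.
  have z3 := le_lt_trans (Imz z) h3.
  have := le_lt_trans (le_Re_normc _) h1; have := le_lt_trans (le_Im_normc _) h1.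
  rewrite cReD cImD cReN cImN /= subr0.
  move=> i1; rewrite ltr_norml => /andP[q1 _].
  have q2 : 0 <= complex.Re (quot z).
    have : eta <= l by rewrite ge_min lexx.
    lra.
  have q3 := mulr_ge0 q2 (ltW (k_pos Uz)).
  have q4 : `|complex.Re (k z) - pn| <= B.
    by have := ler_distD c (complex.Re (k z)) pn; rewrite /B; lra.
  have : `|complex.Im (quot z) * (complex.Re (k z) - pn)| <= e / 2.
    have i2 : `|complex.Im (quot z)| <= e / 2 / B.
      by apply: (le_trans (ltW i1)); rewrite ge_min lexx orbT.
    have := ler_pM (normr_ge0 _) (normr_ge0 _) i2 q4.
    by rewrite -normrM divfK // gt_eqF.
  rewrite ler_norml => /andP[q5 _]; lra.
move=> /not_orP[/negP + /negP]; rewrite -!leNgt => ta' tb'.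
have tab : a < t < b by rewrite !lt_neqAle ta' tb' eq_sym ta tb.
have [l El] := quot_inside tab; rewrite El in qlim.
have [B [r3 r30 H3]] := Im_k_gap tab.
pose S := `|B| + `|l| + 2; have S0 : 0 < S.
  by rewrite /S; have := normr_ge0 B; have := normr_ge0 l; lra.
pose eta := Num.min 1 (e / 4 / S).
have eta0 : 0 < eta by rewrite lt_min ltr01 divr_gt0.
have eta1 : eta <= 1 by rewrite ge_min lexx.
have etaS : eta <= e / 4 / S by rewrite ge_min lexx orbT.
have [r1 r10 H1] := qlim _ eta0.
have [r2 r20 H2] := Re_k_gap tab eta0.
exists (Num.min (Num.min r1 r2) (Num.min r3 (e / 4))); first by rewrite !lt_min r10 r20 r30.
move=> z Uz; rewrite !lt_min => /andP[/andP[/(H1 _ Uz) h1 /(H2 _ Uz) h2] /andP[/(H3 _ Uz) h3 h4]].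
rewrite Im_comparison.
have z3 := le_lt_trans (Imz z) h4.
have := le_lt_trans (le_Re_normc _) h1; have := le_lt_trans (le_Im_normc _) h1.
rewrite cReD cImD cReN cImN /= subr0 => i1 i2.
have B1 : `|complex.Im (k z)| <= S.
  rewrite ger0_norm ?(ltW (k_pos Uz)) // /S.
  by have := ler_norm B; have := normr_ge0 l; lra.
have l1 : `|complex.Im (quot z)| <= S.
  by have := ler_distD l (complex.Im (quot z)) 0; rewrite !subr0 /S; have := normr_ge0 B; lra.
have j1 : `|complex.Re (quot z) * complex.Im (k z)| <= e / 4.
  have := ler_pM (normr_ge0 _) (normr_ge0 _) (le_trans (ltW i2) etaS) B1.
  by rewrite -normrM divfK // gt_eqF.
have j2 : `|complex.Im (quot z) * (complex.Re (k z) - pn)| <= e / 4.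
  have := ler_pM (normr_ge0 _) (normr_ge0 _) (le_trans (ltW h2) etaS) l1.
  by rewrite -normrM mulrC divfK ?gt_eqF // [_ * complex.Im _]mulrC.
move: j1 j2; rewrite !ler_norml => /andP[j1 _] /andP[j2 _]; lra.
Qed.

(** The comparison function tends to the real number z0 - pi n, where z0 is the
    midpoint of the gap.  With A = z - a and B = z - b the root differs from
    z - z0 by half the square of sqrt A - sqrt B, and sqrt A - sqrt B is at most
    (b - a) / |sqrt B|. *)
Lemma comparison_infty (e : R) : 0 < e -> exists r : R, forall z, upper z ->
  r < normc z -> - e < complex.Im (comparison z).
Proof.
move=> e0; pose g := b - a; have g0 : 0 < g by rewrite subr_gt0.
pose z0 := (a + b) / 2; pose c0 := z0 - pn.
pose M1 := g ^+ 2 + `|z0 - x|; pose M2 := 1 + `|c0| + g ^+ 2.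
have g2 := sqr_ge0 g.
have M10 : 0 <= M1 by rewrite addr_ge0.
have M20 : 0 <= M2 by rewrite !addr_ge0.
(* if |A| and |B| are at least L, then each error term is at most e / 4 *)
pose L := 1 + 4 * (M1 * M2 + g ^+ 2) / e.
have L1 : 1 <= L.
  by rewrite /L lerDl divr_ge0 ?(ltW e0) // mulr_ge0 // addr_ge0 // mulr_ge0.
have L0 : 0 < L by lra.
have Le : 4 * (M1 * M2 + g ^+ 2) <= e * L.
  have -> : e * L = e + 4 * (M1 * M2 + g ^+ 2) by rewrite /L; field; rewrite gt_eqF.
  by rewrite lerDr ltW.
have e4 : 0 < Num.min 1 (e / 4) by rewrite lt_min ltr01 divr_gt0.
have [r1 H1] := k_infty e4.
exists (Num.max r1 (L + `|a| + `|b|)) => z Uz; rewrite gt_max => /andP[h1 h2].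
have := H1 _ Uz h1; rewrite lt_min => /andP[kz1 kz2].
have nA : L <= normc (z - a%:C).
  have := normc_tri a%:C z 0; rewrite !subr0 normc_real; have := normr_ge0 b; lra.
have nB : L <= normc (z - b%:C).
  have := normc_tri b%:C z 0; rewrite !subr0 normc_real; have := normr_ge0 a; lra.
set sA := sqrtc (z - a%:C); set sB := sqrtc (z - b%:C).
have sAA : sA * sA = z - a%:C by rewrite -expr2 sqr_sqrtc.
have sBB : sB * sB = z - b%:C by rewrite -expr2 sqr_sqrtc.
have nsA : normc sA ^+ 2 = normc (z - a%:C) by rewrite -sAA expr2 Normc.normcM.
have nsB : normc sB ^+ 2 = normc (z - b%:C) by rewrite -sBB expr2 Normc.normcM.
have upA : 0 <= complex.Im (z - a%:C) by apply: ltW; exact: upper_sub.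
have upB : 0 <= complex.Im (z - b%:C) by apply: ltW; exact: upper_sub.
have inc : normc (sA - sB) ^+ 2 * L <= g ^+ 2.
  have E : normc ((z - a%:C) - (z - b%:C)) = g.
    rewrite (_ : _ - _ = g%:C); first by rewrite normc_real ger0_norm // ltW.
    by rewrite /g rmorphB; ring.
  have := sqrtc_increment upB upA; rewrite E -/sA -/sB => H.
  have := ler_pM (mulr_ge0 (normc_ge0 _) (normc_ge0 _)) (mulr_ge0 (normc_ge0 _) (normc_ge0 _)) H H.
  rewrite -!expr2 exprMn nsB; apply: le_trans.
  by rewrite ler_wpM2l // sqr_ge0.
pose f := root_ab z; have Ef : f = sA * sB by [].
have f0 : f != 0 by apply: root_ab_neq0.
have nf : L <= normc f.
  rewrite -(ler_pXn2r (n := 2)) ?nnegrE ?normc_ge0 ?(ltW L0) //.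
  by rewrite Ef Normc.normcM exprMn nsA nsB expr2 ler_pM // ltW.
pose d := (sA - sB) * (sA - sB) / 2.
have n2 : normc (2 : C) = 2.
  by rewrite -[2 in LHS]/(2%:R : C) -(rmorph_nat (real_complex R)) normc_real ger0_norm.
have nd : normc d * L <= g ^+ 2.
  rewrite /d !Normc.normcM Normc.normcV n2 -expr2.
  by have := mulr_ge0 (sqr_ge0 (normc (sA - sB))) (ltW L0); lra.
have nd1 : normc d <= g ^+ 2.
  by apply: le_trans nd; rewrite ler_peMr // normc_ge0.
have Ed : d = z - z0%:C - f.
  rewrite /d Ef mulrBl !mulrBr sAA sBB /z0 rmorphM rmorphD fmorphV /=.
  rewrite (_ : (2%:C) = 2 :> C); last by rewrite -(rmorph_nat (real_complex R)).
  by field.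
have EP : comparison z - c0%:C =
    (d + (z0 - x)%:C) * (k z - z + c0%:C + d) / f + (k z - z + d).
  have -> : k z - z + c0%:C + d = k z - pn%:C - f.
    by rewrite Ed /c0 rmorphB /=; ring.
  have -> : d + (z0 - x)%:C = z - x%:C - f.
    by rewrite Ed rmorphB /=; ring.
  have -> : k z - z + d = k z - pn%:C - f - c0%:C.
    by rewrite Ed /c0 rmorphB /=; ring.
  by rewrite /comparison /quot -/f; field.
have Im0 : complex.Im (comparison z) = complex.Im (comparison z - c0%:C).
  by rewrite cImD cImN /= subr0.
suff H : normc (comparison z - c0%:C) < e.
  have := le_lt_trans (le_Im_normc _) H; rewrite -Im0 ltr_norml; by case/andP.
have b1 : normc (d + (z0 - x)%:C) <= M1.
  have E1 : d + (z0 - x)%:C - d = (z0 - x)%:C by ring.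
  by have := normc_tri d (d + (z0 - x)%:C) 0; rewrite E1 !subr0 normc_real /M1; lra.
have b2 : normc (k z - z + c0%:C + d) <= M2.
  have E1 : k z - z + c0%:C + d - (k z - z + c0%:C) = d by ring.
  have E2 : k z - z + c0%:C - (k z - z) = c0%:C by ring.
  have := normc_tri (k z - z + c0%:C) (k z - z + c0%:C + d) 0.
  have := normc_tri (k z - z) (k z - z + c0%:C) 0.
  rewrite E1 E2 !subr0 normc_real /M2; lra.
have b3 : normc (k z - z + d) < e / 4 + g ^+ 2 / L.
  have E1 : k z - z + d - (k z - z) = d by ring.
  have := normc_tri (k z - z) (k z - z + d) 0; rewrite E1 !subr0.
  have : normc d <= g ^+ 2 / L by rewrite ler_pdivlMr.
  lra.
have b4 : normc ((d + (z0 - x)%:C) * (k z - z + c0%:C + d) / f) <= M1 * M2 / L.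
  rewrite !Normc.normcM Normc.normcV.
  apply: ler_pM; rewrite ?mulr_ge0 ?invr_ge0 ?normc_ge0 //.
    by apply: ler_pM; rewrite ?normc_ge0.
  by rewrite lef_pV2 ?posrE // (lt_le_trans L0).
have b5 : M1 * M2 / L + g ^+ 2 / L <= e / 4.
  by rewrite -mulrDl ler_pdivrMr //; lra.
rewrite EP; set p1 := _ / f; set p2 := k z - z + d.
have := normc_tri p2 (p1 + p2) 0; rewrite (_ : p1 + p2 - p2 = p1); last ring.
rewrite !subr0 -/p1 in b4 *; rewrite -/p2 in b3; lra.
Qed.

Lemma comparison_ge0 z : upper z -> 0 <= complex.Im (comparison z).
Proof.
move=> Uz; have Re_i (w : C) : complex.Re ((0 +i* 1) * w) = - complex.Im w.
  by rewrite cReM /= mul0r mul1r sub0r.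
rewrite -oppr_le0 -Re_i.
apply: (@max_principle R (@upper R) (fun z => (0 +i* 1) * comparison z)) => //.
- move=> {Uz}z Uz; exists (complex.Im z) => // w /(le_lt_trans (le_Im_normc _)).
  by rewrite cImD cImN ltr_norml /upper /= => /andP[? _]; lra.
- move=> {Uz}z Uz; have [d1 D1] := k_hol Uz; have [d2 D2] := root_ab_hol Uz.
  eexists; apply: cderivM; first exact: cderiv_cst.
  apply: cderivB; last by apply: cderivB; [exact: cderiv_id|exact: cderiv_cst].
  apply: cderivM; last by apply: cderivB; [exact: D1|exact: cderiv_cst].
  apply: cderivM; first by apply: cderivB; [exact: cderiv_id|exact: cderiv_cst].
  by apply: cderivV; [exact: root_ab_neq0 | exact: D2].
- move=> [t y] e /= /negP; rewrite -leNgt le_eqVlt => /orP[/eqP y0|y0] e0; last first.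
    rewrite /= in y0; exists (- y); first by rewrite oppr_gt0.
    move=> w w0 /(le_lt_trans (le_Im_normc _)).
    by rewrite cImD cImN ltr_norml /= => /andP[_ ?]; rewrite /upper /= in w0; lra.
  have [r r0 Hr] := comparison_boundary t e0; exists r => // w Uw hw.
  rewrite Re_i ltrNl; apply: Hr => //.
  by have <- : t +i* y = t%:C by congr (_ +i* _); exact: y0.
- move=> e e0; have [r Hr] := comparison_infty e0; exists r => w Uw hw.
  by rewrite Re_i ltrNl; apply: Hr.
Qed.

End Comparison.

Lemma rightP (phi : R -> R) (l : R) :
  (forall e : R, 0 < e -> exists2 r : R, 0 < r & forall y, 0 < y -> y < r ->
    `|phi y - l| < e) <-> phi y @[y --> 0^'+] --> l.
Proof.
split=> [H|/cvgrPdist_lt H e e0].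
  apply/cvgrPdist_lt => e e0; have [r r0 Hr] := H _ e0.
  near=> y; rewrite distrC; apply: Hr; first by near: y; exact: nbhs_right_gt.
  by near: y; exact: nbhs_right_lt.
have := H _ e0; rewrite near_withinE => /nbhs_normP[r /= r0 Hr].
exists r => // y y0 yr; rewrite distrC; apply: Hr => //=.
by rewrite sub0r normrN gtr0_norm.
Unshelve. all: by end_near.
Qed.

Lemma uplim_vertical (f : C -> C) (x : R) (l : C) : uplim f x%:C l ->
  forall e : R, 0 < e -> exists2 r : R, 0 < r & forall y, 0 < y -> y < r ->
    normc (f (x +i* y) - l) < e.
Proof.
move=> H e /H[r r0 Hr]; exists r => // y y0 yr; apply: Hr; first exact: y0.
rewrite (_ : _ - _ = 0 +i* y); first by rewrite normc_imag gtr0_norm.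
by congr (_ +i* _); [rewrite subrr|rewrite subr0].
Qed.

Lemma uplim_Re_vertical (f : C -> C) (x : R) (l : C) : uplim f x%:C l ->
  complex.Re (f (x +i* y)) @[y --> 0^'+] --> complex.Re l.
Proof.
move=> /uplim_vertical H; apply/rightP => e /H[r r0 Hr]; exists r => // y y0 yr.
by apply: le_lt_trans (Hr _ y0 yr); rewrite -cReN -cReD le_Re_normc.
Qed.

Lemma uplim_Im_vertical (f : C -> C) (x : R) (l : C) : uplim f x%:C l ->
  complex.Im (f (x +i* y)) @[y --> 0^'+] --> complex.Im l.
Proof.
move=> /uplim_vertical H; apply/rightP => e /H[r r0 Hr]; exists r => // y y0 yr.
by apply: le_lt_trans (Hr _ y0 yr); rewrite -cImN -cImD le_Im_normc.
Qed.

(** At z = x + iy the comparison function is i y ((k - pi n) / f - 1), so the real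
    part of (k - pi n) / f is at least 1 there; let y tend to 0. *)
Lemma gap_lower_bound (x v : R) : a < x < b ->
  complex.Im (k (x +i* y)) @[y --> 0^'+] --> v ->
  Num.sqrt (x - a) * Num.sqrt (b - x) <= v.
Proof.
move=> xab lv; have /andP[ax xb] := xab.
set s := Num.sqrt _ * Num.sqrt _.
have s0 : 0 < s by rewrite mulr_gt0 // sqrtr_gt0 subr_gt0.
pose F (z : C) := (k z - pn%:C) / root_ab z.
have F1 y : 0 < y -> 1 <= complex.Re (F (x +i* y)).
  move=> y0; have Uy : upper (x +i* y) by exact: y0.
  have := comparison_ge0 xab Uy.
  have -> : comparison x (x +i* y) = (0 +i* y) * (F (x +i* y) - 1).
    have -> : 0 +i* y = (x +i* y) - x%:C.
      by congr (_ +i* _); [rewrite subrr|rewrite subr0].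
    by rewrite /comparison /quot /F; ring.
  by rewrite cImM cReD cReN /= mul0r add0r pmulr_rge0 // subr_ge0.
have fl : uplim root_ab x%:C (0 +i* s).
  rewrite -root_ab_inside //; apply: uplim_root_ab; first by rewrite gt_eqF.
  by rewrite lt_eqF.
have i0 : 0 +i* s != 0 :> C by rewrite eq_complex /= eqxx gt_eqF.
have lim := uplimV i0 fl.
have := uplim_Im_vertical lim; have := uplim_Re_vertical lim.
have -> : (0 +i* s)^-1 = 0 +i* (- s^-1).
  apply: (mulIf i0); rewrite mulVf //; congr (_ +i* _).
    by rewrite mul0r sub0r mulNr opprK mulVf // gt_eqF.
  by rewrite mul0r mulr0 add0r.
move=> la lb.
have {}la : complex.Re (root_ab (x +i* y))^-1 @[y --> 0^'+] --> (0 : R) := la.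
have {}lb : complex.Im (root_ab (x +i* y))^-1 @[y --> 0^'+] --> - s^-1 := lb.
have lu : complex.Re (k (x +i* y)) - pn @[y --> 0^'+] --> (0 : R).
  apply/rightP => e /(Re_k_gap xab)[r r0 Hr]; exists r => // y y0 yr.
  rewrite subr0; apply: Hr; first exact: y0.
  rewrite (_ : _ - _ = 0 +i* y); first by rewrite normc_imag gtr0_norm.
  by congr (_ +i* _); [rewrite subrr|rewrite subr0].
have lF : (complex.Re (k (x +i* y)) - pn) * complex.Re (root_ab (x +i* y))^-1
    - complex.Im (k (x +i* y)) * complex.Im (root_ab (x +i* y))^-1 @[y --> 0^'+]
    --> 0 * 0 - v * - s^-1.
  by apply: cvgB; [exact: cvgM lu la | exact: cvgM lv lb].
rewrite -(ler_pM2r (x := s^-1)) ?invr_gt0 // divff ?gt_eqF //.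
rewrite (_ : v * s^-1 = 0 * 0 - v * - s^-1); last by ring.
apply: (cvgr_to_ge lF); near=> y; have y0 : 0 < y by near: y; exact: nbhs_right_gt.
by have := F1 _ y0; rewrite /F cReM cReD cReN cImD cImN subr0.
Unshelve. all: by end_near.
Qed.

End GapBound.

(** * Analytic functions, hyperbolic and complex cosine *)

Section RealLemmas.
Variable R : realType.
Notation C := R[i].

(** Comparison with a geometric series: if |c_j rho^j| <= B for all j, then the
    terms of index at least 2 add up to at most 2 B (t / rho)^2 for
    |t| <= rho / 2. *)
Lemma real_analytic_rderiv (f : R -> R) (x0 : R) : real_analytic_at f x0 ->
  exists d, rderiv f x0 d.
Proof.
move=> [c [r [r0 Hf]]].
have [rho rho0 rhor] : exists2 rho : R, 0 < rho & rho < r.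
  by exists (r / 2); rewrite ?divr_gt0 //; lra.
have rn0 : rho != 0 by rewrite gt_eqF.
have [B B0 HB] : exists2 B : R, 0 <= B & forall j, `|c j * rho ^+ j| <= B.
  have Hrho : `|x0 + rho - x0| < r.
    by by rewrite addrAC subrr add0r gtr0_norm.
  have := Hf _ Hrho; rewrite addrAC subrr add0r => Hc.
  have c0 : cvgn (fun j => c j * rho ^+ j).
    by apply/cvg_ex; exists 0; apply: cvg_series_cvg_0; apply/cvg_ex; exists (f (x0 + rho)).
  have /pinfty_ex_gt0[B B0 HB] := cvg_seq_bounded c0.
  by exists B; [exact: ltW | move=> j; apply: HB].
pose S t n := series (fun j => c j * t ^+ j) n.
have HS t n : `|t| <= rho / 2 ->
    `|S t n.+2 - c 0%N - c 1%N * t| <= B * (`|t| / rho) ^+ 2 * (2 - 2 / 2 ^+ n).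
  move=> ht; have q0 : 0 <= `|t| / rho by rewrite divr_ge0 // ltW.
  have q2 : `|t| / rho <= 1 / 2 by rewrite ler_pdivrMr //; lra.
  elim: n => [|n IH].
    rewrite /S /series /= !big_nat_recr //= big_geq // add0r expr0 mulr1 expr1.
    rewrite (_ : c 0%N + c 1%N * t - c 0%N - c 1%N * t = 0); last ring.
    by rewrite normr0 expr0 divr1 subrr mulr0.
  have -> : S t n.+3 = S t n.+2 + c n.+2 * t ^+ n.+2.
    by rewrite /S /series /= big_nat_recr.
  have step : `|c n.+2 * t ^+ n.+2| <= B * (`|t| / rho) ^+ 2 / 2 ^+ n.
    have -> : `|c n.+2 * t ^+ n.+2| = `|c n.+2 * rho ^+ n.+2| * (`|t| / rho) ^+ n.+2.
      rewrite (normrM _ (t ^+ _)) (normrM _ (rho ^+ _)) !normrX (gtr0_norm rho0).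
      rewrite expr_div_n -mulrA; congr (_ * _).
      by rewrite [RHS]mulrC divfK // expf_neq0.
    rewrite -mulrA; apply: ler_pM => //; first by rewrite exprn_ge0.
    rewrite -addn2 addnC exprD ler_wpM2l ?exprn_ge0 //.
    have E2 : (2 ^+ n)^-1 = (1 / 2) ^+ n :> R by rewrite expr_div_n expr1n div1r.
    by rewrite E2 lerXn2r ?unfold_in //= divr_ge0.
  have E : 2 / 2 ^+ n.+1 = 1 / 2 ^+ n :> R.
    by rewrite exprS; field; rewrite expf_neq0.
  have -> : S t n.+2 + c n.+2 * t ^+ n.+2 - c 0%N - c 1%N * t =
     (S t n.+2 - c 0%N - c 1%N * t) + c n.+2 * t ^+ n.+2 by ring.
  apply: le_trans (ler_normD _ _) _; apply: le_trans (lerD IH step) _.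
  by rewrite E le_eqVlt; apply/orP; left; apply/eqP; ring.
have Hlim x : `|x - x0| <= rho / 2 ->
    `|f x - c 0%N - c 1%N * (x - x0)| <= 2 * B * (`|x - x0| / rho) ^+ 2.
  move=> hx; have hxr : `|x - x0| < r by apply: le_lt_trans hx _; lra.
  have lim : (fun n => `|S (x - x0) n - c 0%N - c 1%N * (x - x0)|) @ \oo -->
      `|f x - c 0%N - c 1%N * (x - x0)|.
    apply: cvg_norm; apply: cvgB; last exact: cvg_cst.
    by apply: cvgB; [exact: Hf | exact: cvg_cst].
  apply: (cvgr_to_le lim); exists 2%N => // n /= n2.
  have -> : n = (n - 2)%N.+2 by rewrite -addn2 subnK.
  apply: le_trans (HS _ _ hx) _.
  rewrite [leRHS](_ : _ = B * (`|x - x0| / rho) ^+ 2 * 2); last by ring.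
  have i0 : 0 <= rho^-1 by rewrite invr_ge0 ltW.
  apply: ler_wpM2l; first by rewrite mulr_ge0 // exprn_ge0 // mulr_ge0.
  by rewrite gerBl divr_ge0 // exprn_ge0.
have f0 : f x0 = c 0%N.
  have h0 : `|x0 - x0| <= rho / 2 by rewrite subrr normr0; lra.
  have := Hlim _ h0.
  rewrite subrr normr0 mul0r expr0n mulr0 mulr0 subr0 normr_le0 subr_eq0.
  by move/eqP.
exists (c 1%N) => e e0.
have K0 : 0 < (2 * B + 1) / rho ^+ 2.
  by apply: divr_gt0; [lra | rewrite exprn_gt0].
exists (Num.min (rho / 2) (e / ((2 * B + 1) / rho ^+ 2))).
  by rewrite lt_min; apply/andP; split; apply: divr_gt0.
move=> y; rewrite lt_min => /andP[/ltW/Hlim h1 h2]; rewrite f0.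
apply: (le_trans h1); rewrite ltr_pdivlMr // in h2.
apply: (le_trans (y := `|y - x0| * ((2 * B + 1) / rho ^+ 2) * `|y - x0|)); last first.
  by rewrite ler_wpM2r // ltW.
rewrite expr_div_n [leRHS](_ : _ = (2 * B + 1) * (`|y - x0| ^+ 2 / rho ^+ 2)).
  by apply: ler_wpM2r; [rewrite divr_ge0 // exprn_ge0 // ltW | lra].
by rewrite expr2; field.
Qed.

Lemma derive1_rderiv (f : R -> R) (x d : R) : rderiv f x d -> derive1 f x = d.
Proof. by move=> /rderivP[_ <-]; rewrite derive1E. Qed.

Lemma expR_rderiv (x : R) : rderiv (@expR R) x (expR x).
Proof. by apply/rderivP; exact: is_derive_expR. Qed.

Lemma rderiv_comp_opp (f : R -> R) (x d : R) : rderiv f (- x) d ->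
  rderiv (fun t => f (- t)) x (- d).
Proof.
move=> H e /H[r r0 Hr]; exists r => // y yr; have E : - y - - x = - (y - x) by ring.
by have := Hr (- y); rewrite E normrN mulrN mulNr opprK; apply.
Qed.

Lemma cosh_rderiv (x : R) : rderiv (@cosh R) x ((expR x - expR (- x)) / 2).
Proof.
apply: rderiv_eq; first apply: rderivM; last 2 first.
- exact: rderiv_cst.
- by rewrite mulr0 add0r mulrC.
apply: rderivD; first exact: expR_rderiv.
by apply: rderiv_comp_opp; exact: expR_rderiv.
Qed.

Lemma cosh_ge1 (x : R) : 1 <= cosh x.
Proof.
rewrite /cosh ler_pdivlMr // mul1r expRN.
have e0 := expR_gt0 x; have i0 : 0 < (expR x)^-1 by rewrite invr_gt0.
have E : expR x * (expR x)^-1 = 1 by rewrite mulfV // gt_eqF.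
have := mulr_ge0 (ltW i0) (sqr_ge0 (expR x - 1)).
rewrite (_ : _ * _ = expR x * (expR x * (expR x)^-1) - 2 * (expR x * (expR x)^-1)
  + (expR x)^-1); last by ring.
by rewrite E; lra.
Qed.

Lemma sinh_ge (x : R) : 0 <= x -> x <= (expR x - expR (- x)) / 2.
Proof.
move=> x0.
have [|c _] := @rderiv_MVT R (fun t => (expR t - expR (- t)) / 2 - t)
   (fun t => cosh t - 1) 0 x x0.
  move=> t _; apply: rderivB; last exact: rderiv_id.
  apply: rderiv_eq.
    apply: rderivM; last exact: rderiv_cst.
    apply: rderivB; first exact: expR_rderiv.
    by apply: rderiv_comp_opp; exact: expR_rderiv.
  by rewrite /cosh mulr0 add0r opprK mulrC.
move=> E; have : 0 <= (cosh c - 1) * x by rewrite mulr_ge0 // subr_ge0 cosh_ge1.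
by move: E; rewrite oppr0 !addr0 => <-; lra.
Qed.

(** The derivative of 2 cosh t - t^2 is 2 (sinh t - t) >= 0.  This inequality
    turns information on cosh v into information on v^2, which, unlike v, is
    differentiable up to the endpoints of the gap. *)
Lemma cosh_sqr (s t : R) : 0 <= s -> s <= t ->
  t ^+ 2 - s ^+ 2 <= 2 * (cosh t - cosh s).
Proof.
move=> s0 st.
have [|c /andP[sc _]] := @rderiv_MVT R (fun t => 2 * cosh t - t * t)
   (fun t => 2 * ((expR t - expR (- t)) / 2) - 2 * t) s t st.
  move=> u _; apply: rderivB; apply: rderiv_eq.
  - by apply: rderivM; [exact: rderiv_cst|exact: cosh_rderiv].
  - by ring.
  - by apply: rderivM; exact: rderiv_id.
  - by rewrite /=; ring.
move=> E.
have c0 := le_trans s0 sc; have sh := sinh_ge c0.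
have : 0 <= (2 * ((expR c - expR (- c)) / 2) - 2 * c) * (t - s).
  by rewrite mulr_ge0 ?subr_ge0 // ler_wpM2l.
rewrite -E; lra.
Qed.

Lemma cosh_sqr_dist (s t : R) : 0 <= s -> 0 <= t ->
  `|t ^+ 2 - s ^+ 2| <= 2 * `|cosh t - cosh s|.
Proof.
wlog st : s t / s <= t.
  move=> H s0 t0; have [/H|/ltW/H] := leP s t; first exact.
  by rewrite distrC [in X in _ -> _ <= X]distrC; apply.
move=> s0 t0; have sq : s ^+ 2 <= t ^+ 2 by apply: lerXn2r; rewrite ?unfold_in.
rewrite ger0_norm ?subr_ge0 //; apply: le_trans (cosh_sqr s0 st) _.
by rewrite ler_wpM2l // ler_norm.
Qed.

Lemma cos_pi_int (n : int) : cos (pi * n%:~R) = (-1) ^ n :> R.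
Proof.
have nat m : cos (pi * m%:R) = (-1) ^+ m :> R.
  elim: m => [|m IH]; first by rewrite mulr0 cos0 expr0.
  by rewrite -natr1 mulrDr mulr1 cosDpi IH exprS mulN1r.
case: n => m; first exact: nat.
rewrite NegzE rmorphN mulrN cosN -exprnN /= -[m.+1%:~R]/(m.+1%:R) nat.
by rewrite -exprVn invrN invr1.
Qed.

Lemma signz_complex (n : int) : (-1) ^ n = ((-1) ^ n : R)%:C :> C.
Proof.
case: n => m; first by rewrite -!exprnP rmorphXn /= rmorphN rmorph1.
by rewrite NegzE -!exprnN -!exprVn !invrN !invr1 rmorphXn /= rmorphN rmorph1.
Qed.

Lemma signz_sqr (n : int) : ((-1) ^ n : R) * (-1) ^ n = 1.
Proof.
case: n => m; first by rewrite -!exprnP -exprMn mulrNN mulr1 expr1n.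
by rewrite NegzE -!exprnN -!exprVn invrN invr1 -exprMn mulrNN mulr1 expr1n.
Qed.

Lemma Re_ccos (w : C) : complex.Re (ccos w) =
  cos (complex.Re w) * cosh (complex.Im w).
Proof.
case: w => u v; rewrite /ccos.
have -> : (0 +i* 1) * (u +i* v) = (- v) +i* u.
  by congr (_ +i* _); ring.
have -> : - ((- v) +i* u) = v +i* (- u) by congr (_ +i* _); ring.
have E2 : (2 : C)^-1 = (2^-1 : R)%:C.
  by rewrite fmorphV -(rmorph_nat (real_complex R)).
have Re_cexp (a b : R) : complex.Re (cexp (a +i* b)) = expR a * cos b.
  by rewrite /cexp cReM /= mul0r subr0.
have Re_half (w : C) : complex.Re (w * (2^-1 : R)%:C) = complex.Re w / 2.
  by rewrite cReM /= mulr0 subr0.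
by rewrite E2 Re_half cReD !Re_cexp cosN /cosh /=; ring.
Qed.

End RealLemmas.

(** * The algebra of the estimates *)

Section Estimates.
Variable R : realType.
Notation C := R[i].

(** The algebra.  Here A, B, Z are the values of 1 + V at a, b, z, and d is the
    derivative of V at z.  The stationarity relation bounds D = |z - z0|, and
    g^2 - 4 vn^2 = 4 D^2 turns this into a bound for g - 2 vn, hence for
    2 h - g Z; since g |m| is a square, h^- = g A / 2 and h^+ = g B / 2. *)
Lemma gap_estimates (a b z A B Z d vn h M M' mm mp : R) :
  a < b -> a <= z <= b -> 0 <= vn -> vn ^+ 2 = (z - a) * (b - z) ->
  1 <= A <= 1 + M -> 1 <= B <= 1 + M -> 1 <= Z <= 1 + M -> `|d| <= M' ->
  (a + b - 2 * z) * Z + 2 * (vn ^+ 2 * d) = 0 -> h = vn * Z ->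
  `|Z - A| <= M' * (b - a) -> `|Z - B| <= M' * (b - a) ->
  `|B - A| <= M' * (b - a) ->
  mm = - ((b - a) * A ^+ 2 / 2) -> mp = (b - a) * B ^+ 2 / 2 ->
  let g := b - a in
  let z0 := (a + b) / 2 in
  let hm := Num.sqrt (g * `|mm| / 2) in
  let hp := Num.sqrt (g * `|mp| / 2) in
  let m := 2 * h ^+ 2 / g in
  `|z - z0| <= g ^+ 2 / 4 * M' /\
  `|2 * h - g * Z| <= g ^+ 3 / 8 * M' ^+ 2 /\
  `|h - hm| <= g ^+ 2 / 2 * M' * (1 + M' / 8 * Num.sqrt (2 * g * `|mm|)) /\
  `|h - hp| <= g ^+ 2 / 2 * M' * (1 + M' / 8 * Num.sqrt (2 * g * `|mp|)) /\
  `|mp + mm| <= g ^+ 2 * (1 + M) * M' /\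
  `|mp - m| <= g ^+ 2 * (1 + M) * M' * (1 + M' / 8 * Num.sqrt (2 * g * `|mp|)) /\
  `|mm + m| <= g ^+ 2 * (1 + M) * M' * (1 + M' / 8 * Num.sqrt (2 * g * `|mm|)).
Proof.
move=> ab /andP[az zb] vn0 vn2 /andP[A1 AM] /andP[B1 BM] /andP[Z1 ZM] dM' stat hE
  ZA ZB BA mmE mpE g z0 hm hp m.
have g0 : 0 < g by rewrite subr_gt0.
have M'0 : 0 <= M' by apply: le_trans dM'.
have gn0 : g != 0 by rewrite gt_eqF.
have mass_sqrt (X : R) : 1 <= X ->
    Num.sqrt (g * (g * X ^+ 2 / 2) / 2) = g * X / 2 /\
    Num.sqrt (2 * g * (g * X ^+ 2 / 2)) = g * X.
  move=> X1; have X0 : 0 <= g * X by rewrite mulr_ge0 ?(ltW g0) //; lra.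
  split.
    rewrite (_ : _ / 2 = (g * X / 2) ^+ 2); last by field.
    by rewrite sqrtr_sqr ger0_norm // divr_ge0.
  rewrite (_ : _ * _ = (g * X) ^+ 2); last by field.
  by rewrite sqrtr_sqr ger0_norm.
have amm : `|mm| = g * A ^+ 2 / 2.
  by rewrite mmE normrN ger0_norm // divr_ge0 // mulr_ge0 ?(ltW g0) // exprn_ge0 //; lra.
have amp : `|mp| = g * B ^+ 2 / 2.
  by rewrite mpE ger0_norm // divr_ge0 // mulr_ge0 ?(ltW g0) // exprn_ge0 //; lra.
have [hmE smE] := mass_sqrt A A1; have [hpE spE] := mass_sqrt B B1.
rewrite /hm /hp amm amp hmE smE hpE spE.
pose D := `|z - z0|.
have D0 : 0 <= D by exact: normr_ge0.
have D2 : 4 * D ^+ 2 = g ^+ 2 - 4 * vn ^+ 2.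
  by rewrite /D real_normK ?num_real // vn2 /z0 /g; field.
have vng : 2 * vn <= g.
  rewrite -(ler_pXn2r (n := 2)) ?nnegrE ?mulr_ge0 ?(ltW g0) // exprMn.
  by have := sqr_ge0 D; lra.
have DZ : D * Z <= vn ^+ 2 * M'.
  have E : (z - z0) * Z = vn ^+ 2 * d by rewrite /z0; lra.
  rewrite -[Z]ger0_norm; last lra.
  by rewrite -normrM E normrM ger0_norm ?sqr_ge0 // ler_wpM2l // sqr_ge0.
have I1 : D <= g ^+ 2 / 4 * M'.
  apply: (le_trans (y := D * Z)); first by rewrite ler_peMr.
  apply: (le_trans DZ); rewrite ler_wpM2r //.
  by have := sqr_ge0 D; lra.
have I2 : `|2 * h - g * Z| <= g ^+ 3 / 8 * M' ^+ 2.
  have -> : 2 * h - g * Z = - (Z * (g - 2 * vn)) by rewrite hE; ring.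
  have Zg0 : 0 <= Z * (g - 2 * vn) by rewrite mulr_ge0 //; lra.
  rewrite normrN ger0_norm //.
  have gv : 0 < g + 2 * vn by lra.
  rewrite -(ler_pM2r gv).
  have -> : Z * (g - 2 * vn) * (g + 2 * vn) = 4 * (D ^+ 2) * Z by rewrite D2; ring.
  apply: (le_trans (y := 4 * (D * Z) ^+ 2)).
    rewrite exprMn -mulrA ler_pM2l // ler_wpM2l ?sqr_ge0 // expr2.
    by rewrite ler_peMr //; lra.
  have sq : (D * Z) ^+ 2 <= (vn ^+ 2 * M') ^+ 2.
    by apply: lerXn2r => //; rewrite ?unfold_in /= ?mulr_ge0 ?sqr_ge0 //; lra.
  apply: (le_trans (y := 4 * (vn ^+ 2 * M') ^+ 2)); first by rewrite ler_pM2l.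
  have w4 : (2 * vn) ^+ 4 <= g ^+ 4.
    by apply: lerXn2r => //; rewrite ?unfold_in /= ?mulr_ge0 // ltW.
  have w3 : (2 * vn) ^+ 3 <= g ^+ 3.
    by apply: lerXn2r => //; rewrite ?unfold_in /= ?mulr_ge0 // ltW.
  have w5 : (2 * vn) ^+ 3 * (2 * vn) <= g ^+ 3 * (2 * vn).
    by rewrite ler_wpM2r // mulr_ge0.
  have -> : 4 * (vn ^+ 2 * M') ^+ 2 = (2 * vn) ^+ 4 / 4 * M' ^+ 2 by field.
  have -> : g ^+ 3 / 8 * M' ^+ 2 * (g + 2 * vn) =
     (g ^+ 4 + g ^+ 3 * (2 * vn)) / 8 * M' ^+ 2 by field.
  rewrite ler_wpM2r ?sqr_ge0 //.
  have E4 : (2 * vn) ^+ 3 * (2 * vn) = (2 * vn) ^+ 4 by rewrite -exprSr.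
  by rewrite E4 in w5; lra.
have I3 X : 1 <= X -> `|Z - X| <= M' * g ->
    `|h - g * X / 2| <= g ^+ 2 / 2 * M' * (1 + M' / 8 * (g * X)).
  move=> X1 ZX.
  have -> : h - g * X / 2 = (2 * h - g * Z) / 2 + g * (Z - X) / 2 by field.
  apply: le_trans (ler_normD _ _) _.
  rewrite !normrM [`|2^-1|]ger0_norm // [`|g|]ger0_norm ?(ltW g0) //.
  have := ler_wpM2l (ltW g0) ZX.
  have g3 : 0 <= g ^+ 3 * M' ^+ 2 by rewrite mulr_ge0 ?exprn_ge0 // ltW.
  have := ler_wpM2l g3 X1.
  have -> : g ^+ 2 / 2 * M' * (1 + M' / 8 * (g * X)) =
     g * (M' * g) / 2 + g ^+ 3 * M' ^+ 2 * X / 16 by field.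
  lra.
have h0 : 0 <= h by rewrite hE mulr_ge0 //; lra.
have M10 : 0 <= 1 + M by lra.
have hM : h <= g / 2 * (1 + M).
  by rewrite hE; apply: ler_pM => //; lra.
have I5 X : 1 <= X <= 1 + M -> `|Z - X| <= M' * g ->
    `|g * X ^+ 2 / 2 - m| <= g ^+ 2 * (1 + M) * M' * (1 + M' / 8 * (g * X)).
  move=> /andP[X1 XM] ZX.
  have -> : g * X ^+ 2 / 2 - m = - (2 / g * ((h - g * X / 2) * (h + g * X / 2))).
    by rewrite /m; field.
  rewrite normrN (normrM (2 / g)) (normrM (h - _)) [`|2 / g|]ger0_norm; last by rewrite divr_ge0 // ltW.
  have gX : 0 <= g * X by rewrite mulr_ge0 ?(ltW g0) //; lra.
  rewrite [`|h + g * X / 2|]ger0_norm; last by rewrite addr_ge0 // divr_ge0.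
  have s1 : h + g * X / 2 <= g * (1 + M).
    by have := ler_wpM2l (ltW g0) XM; lra.
  have := ler_pM (normr_ge0 _) _ (I3 X X1 ZX) s1.
  have h2 : 0 <= h + g * X / 2 by rewrite addr_ge0 // divr_ge0.
  move=> /(_ h2) key.
  rewrite mulrC -ler_pdivlMr ?divr_gt0 //; apply: (le_trans key).
  by rewrite le_eqVlt; apply/orP; left; apply/eqP; field.
split; first exact: I1.
split; first exact: I2.
split; first exact: I3.
split; first exact: I3.
split.
  have -> : mp + mm = g / 2 * ((B - A) * (B + A)) by rewrite mpE mmE /g; field.
  rewrite (normrM (g / 2)) (normrM (B - A)) [`|g / 2|]ger0_norm; last by rewrite divr_ge0 // ltW.
  have BA0 : 0 <= B + A by lra.
  rewrite [`|B + A|]ger0_norm //.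
  have s1 : B + A <= 2 * (1 + M) by lra.
  have := ler_pM (normr_ge0 _) BA0 BA s1.
  have gh : 0 <= g / 2 by rewrite divr_ge0 // ltW.
  move=> /(ler_wpM2l gh) /le_trans; apply.
  by rewrite le_eqVlt; apply/orP; left; apply/eqP; rewrite -/g; field.
split; first by rewrite mpE; apply: I5 => //; rewrite B1.
rewrite mmE -/g -[X in X <= _]normrN opprD opprK; apply: I5 => //; rewrite A1.
exact: AM.
Qed.

End Estimates.

(** * Boundary values on a gap *)

Section Boundary.
Variable R : realType.
Notation C := R[i].

Lemma eq0_small (x : R) : (forall e, 0 < e -> `|x| <= e) -> x = 0.
Proof.
move=> H; apply/eqP; rewrite -normr_le0; apply/ler_addgt0Pr => e e0.
by rewrite add0r; exact: H.
Qed.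

(** The relation z - c = (k - pi n)^2 / (2 m) (1 + o(1)) solved for the square.
    In particular m is not 0, since otherwise z = c for all z near c. *)
Lemma effective_mass_expansion (zm zp : int -> R) (k : C -> C) (n : int) (c m : R) :
  effective_mass (gap_domain zm zp) k n c m ->
  forall e : R, 0 < e -> exists2 r : R, 0 < r & forall z, gap_domain zm zp z ->
    normc (z - c%:C) < r ->
    normc ((k z - (pi * n%:~R)%:C) ^+ 2 - (2 * m)%:C * (z - c%:C)) <= e * normc (z - c%:C).
Proof.
move=> [eps [eps0 Heq]] e e0.
have {}eps0 := (cvg_withinP (gap_domain zm zp) eps c%:C 0).1 eps0.
move: Heq; rewrite near_withinE => Hn.
have [_ /= /pos_complex[r1 r10 ->] H1] := (@nbhs_normP C C^o c%:C _).1 Hn.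
have {}H1 z : gap_domain zm zp z -> normc (z - c%:C) < r1 ->
    z = c%:C + (k z - (pi * n%:~R)%:C) ^+ 2 / (2 * m)%:C * (1 + eps z).
  by move=> Dz hz; apply: H1 => //=; rewrite complex_normE ltcR normcB.
have m0 : m != 0.
  apply/eqP => m0; have y0 : 0 < r1 / 2 by rewrite divr_gt0.
  have := H1 (c +i* (r1 / 2)).
  have -> : (c +i* (r1 / 2)) - c%:C = 0 +i* (r1 / 2).
    by congr (_ +i* _); [rewrite subrr|rewrite subr0].
  have Dz : gap_domain zm zp (c +i* (r1 / 2)).
    by apply: gap_domain_nonreal; rewrite /= gt_eqF.
  have lt : r1 / 2 < r1 by lra.
  rewrite normc_imag gtr0_norm // => /(_ Dz lt).
  rewrite m0 mulr0 invr0 mulr0 mul0r addr0 => -[E]; lra.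
have m20 : (2 * m)%:C != 0 :> C.
  by rewrite eq_complex /= eqxx andbT mulf_neq0.
pose eta := Num.min (1 / 2) (e / (4 * `|m| + 1)).
have mm0 : 0 < 4 * `|m| + 1 by have := normr_ge0 m; lra.
have eta0 : 0 < eta by rewrite lt_min divr_gt0 //= divr_gt0.
have [r2 r20 H2] := eps0 _ eta0.
exists (Num.min r1 r2); first by rewrite lt_min r10.
move=> z Dz; rewrite lt_min => /andP[/(H1 _ Dz) Ez /(H2 _ Dz)].
rewrite subr0 lt_min => /andP[e1 e2].
set kk := (k z - _) ^+ 2.
have E : kk * (1 + eps z) = (2 * m)%:C * (z - c%:C).
  have -> : z - c%:C = kk / (2 * m)%:C * (1 + eps z).
    by apply/eqP; rewrite subr_eq addrC; apply/eqP.
  by rewrite mulrA [_ * (kk / _)]mulrC divfK.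
have n1 : normc kk * normc (1 + eps z) = 2 * `|m| * normc (z - c%:C).
  by rewrite -Normc.normcM E Normc.normcM normc_real normrM ger0_norm.
have n2 : 1 / 2 <= normc (1 + eps z).
  have E1 : 1 + eps z - 0 - eps z = 1 by ring.
  have := normc_tri (1 + eps z) (1 : C) 0; rewrite !subr0 Normc.normc1.
  have -> : 1 - (1 + eps z) = - eps z by ring.
  by rewrite normcN; lra.
have n3 : normc kk <= 4 * `|m| * normc (z - c%:C).
  have := ler_wpM2l (normc_ge0 kk) n2; rewrite n1; lra.
have -> : kk - (2 * m)%:C * (z - c%:C) = - (eps z * kk) by rewrite -E; ring.
rewrite normcN Normc.normcM.
have e3 : normc (eps z) * (4 * `|m| + 1) <= e by rewrite -ler_pdivlMr // ltW.
apply: (le_trans (ler_wpM2l (normc_ge0 _) n3)).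
rewrite mulrA ler_wpM2r ?normc_ge0 // (le_trans _ e3) //.
by rewrite ler_wpM2l ?normc_ge0 // lerDl.
Qed.

Lemma expansion_limit (D : set C) (k : C -> C) (p c m : R) :
  (forall e : R, 0 < e -> exists2 r : R, 0 < r & forall z, D z ->
    normc (z - c%:C) < r ->
    normc ((k z - p%:C) ^+ 2 - (2 * m)%:C * (z - c%:C)) <= e * normc (z - c%:C)) ->
  forall e : R, 0 < e -> exists2 r : R, 0 < r & forall z, D z ->
    normc (z - c%:C) < r -> normc (k z - p%:C) < e.
Proof.
move=> H e e0; have [r r0 Hr] := H _ ltr01.
have M0 : 0 < 2 * `|m| + 1 by have := normr_ge0 m; lra.
have e2 : 0 < e ^+ 2 by rewrite exprn_gt0.
exists (Num.min r (e ^+ 2 / (2 * `|m| + 1))); first by rewrite lt_min r0 divr_gt0.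
move=> z Dz; rewrite lt_min => /andP[/(Hr _ Dz) h1]; rewrite ltr_pdivlMr // => h2.
rewrite -(ltr_pXn2r (n := 2)) ?nnegrE ?normc_ge0 ?(ltW e0) //.
apply: le_lt_trans h2.
have -> : normc (k z - p%:C) ^+ 2 = normc ((k z - p%:C) ^+ 2).
  by rewrite !expr2 Normc.normcM.
have := normc_tri ((2 * m)%:C * (z - c%:C)) ((k z - p%:C) ^+ 2) 0.
rewrite !subr0 (Normc.normcM (2 * m)%:C) normc_real normrM [`|2|]ger0_norm //; lra.
Qed.

(** Passage to the limit y -> 0 in the expansion at z = x + iy, where
    (k - pi n)^2 tends to - v^2. *)
Lemma mass_on_gap (D : set C) (k : C -> C) (p c m x v e r : R) :
  (forall z, complex.Im z != 0 -> D z) ->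
  complex.Re (k (x +i* y)) @[y --> 0^'+] --> p ->
  complex.Im (k (x +i* y)) @[y --> 0^'+] --> v ->
  (forall z, D z -> normc (z - c%:C) < r ->
    normc ((k z - p%:C) ^+ 2 - (2 * m)%:C * (z - c%:C)) <= e * normc (z - c%:C)) ->
  0 <= e -> `|x - c| < r -> `|v ^+ 2 + 2 * m * (x - c)| <= e * `|x - c|.
Proof.
move=> Dz lu lv H e0 xr.
have lF : `|(complex.Re (k (x +i* y)) - p) * (complex.Re (k (x +i* y)) - p) -
    complex.Im (k (x +i* y)) * complex.Im (k (x +i* y)) - 2 * m * (x - c)| - e * y
    @[y --> 0^'+] --> `|(p - p) * (p - p) - v * v - 2 * m * (x - c)| - e * 0.
  have id0 : y @[y --> (0 : R)^'+] --> (0 : R).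
    by apply: cvg_at_right_filter; exact: cvg_id.
  apply: cvgB; last by apply: cvgM; [exact: cvg_cst|exact: id0].
  apply: cvg_norm; apply: cvgB; last exact: cvg_cst.
  apply: cvgB; last exact: cvgM.
  by apply: cvgM; apply: cvgB => //; exact: cvg_cst.
have -> : `|v ^+ 2 + 2 * m * (x - c)| =
    `|(p - p) * (p - p) - v * v - 2 * m * (x - c)| - e * 0.
  by rewrite mulr0 subr0 -normrN; congr `|_|; ring.
apply: (cvgr_to_le lF); near=> y.
have y0 : 0 < y by near: y; exact: nbhs_right_gt.
have yr : y < r - `|x - c| by near: y; apply: nbhs_right_lt; rewrite subr_gt0.
have Dy : D (x +i* y) by apply: Dz; rewrite /= gt_eqF.
have nz : normc ((x +i* y) - c%:C) <= `|x - c| + y.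
  apply: le_trans (normc_le_ReIm _) _.
  by rewrite cReD cReN cImD cImN /= subr0 (gtr0_norm y0).
have nr : normc ((x +i* y) - c%:C) < r by apply: le_lt_trans nz _; lra.
have := le_trans (H _ Dy nr) (ler_wpM2l e0 nz).
rewrite (mulrDr e) lerBlDr => K; apply: le_trans K.
apply: le_trans (le_Re_normc _); rewrite le_eqVlt; apply/orP; left; apply/eqP.
congr `|_|; rewrite expr2 cReD cReM cReN cReM cImD cImN cReD cReN cImD cImN cReD cReN /=.
ring.
Unshelve. all: by end_near.
Qed.

(** Passage to the limit y -> 0 in the expansion of Delta = cos k at a zero of
    its derivative; cos k tends to (-1)^n cosh v. *)
Lemma cosh_on_gap (D : set C) (Delta k : C -> C) (n : int) (zn h x v e r : R) :
  (forall z, complex.Im z != 0 -> D z) ->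
  (forall z, D z -> ccos (k z) = Delta z) ->
  complex.Re (k (x +i* y)) @[y --> 0^'+] --> (pi * n%:~R : R) ->
  complex.Im (k (x +i* y)) @[y --> 0^'+] --> v ->
  (forall w, normc (w - zn%:C) < r ->
    normc (Delta w - Delta zn%:C) <= e * normc (w - zn%:C)) ->
  (cosh h)%:C = (-1) ^ n * Delta zn%:C ->
  0 <= e -> `|x - zn| < r -> `|cosh v - cosh h| <= e * `|x - zn|.
Proof.
move=> Dz cosD lu lv H hh e0 xr.
have ReD : complex.Re (Delta zn%:C) = (-1) ^ n * cosh h.
  have := congr1 (@complex.Re R) hh; rewrite signz_complex cReM /= mul0r subr0.
  by move=> ->; rewrite mulrA signz_sqr mul1r.
have lcos : cos (complex.Re (k (x +i* y))) @[y --> 0^'+] --> ((-1) ^ n : R).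
  by rewrite -cos_pi_int; apply: continuous_cvg => //; exact: continuous_cos.
have lcosh : cosh (complex.Im (k (x +i* y))) @[y --> 0^'+] --> cosh v.
  apply: continuous_cvg => //; apply/rcontP; exact: rderiv_cont (cosh_rderiv v).
have lF : `|cos (complex.Re (k (x +i* y))) * cosh (complex.Im (k (x +i* y)))
    - (-1) ^ n * cosh h| - e * y
    @[y --> 0^'+] --> `|(-1) ^ n * cosh v - (-1) ^ n * cosh h| - e * 0.
  have id0 : y @[y --> (0 : R)^'+] --> (0 : R).
    by apply: cvg_at_right_filter; exact: cvg_id.
  apply: cvgB; last by apply: cvgM; [exact: cvg_cst|exact: id0].
  by apply: cvg_norm; apply: cvgB; [exact: cvgM|exact: cvg_cst].
have -> : `|cosh v - cosh h| = `|(-1) ^ n * cosh v - (-1) ^ n * cosh h| - e * 0.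
  rewrite mulr0 subr0 -mulrBr normrM.
  suff -> : `|(-1) ^ n : R| = 1 by rewrite mul1r.
  by rewrite -sqrtr_sqr expr2 signz_sqr sqrtr1.
apply: (cvgr_to_le lF); near=> y.
have y0 : 0 < y by near: y; exact: nbhs_right_gt.
have yr : y < r - `|x - zn| by near: y; apply: nbhs_right_lt; rewrite subr_gt0.
have Dy : D (x +i* y) by apply: Dz; rewrite /= gt_eqF.
have nz : normc ((x +i* y) - zn%:C) <= `|x - zn| + y.
  apply: le_trans (normc_le_ReIm _) _.
  by rewrite cReD cReN cImD cImN /= subr0 (gtr0_norm y0).
have nr : normc ((x +i* y) - zn%:C) < r by apply: le_lt_trans nz _; lra.
have := le_trans (H _ nr) (ler_wpM2l e0 nz).
rewrite (mulrDr e) lerBlDr => K; apply: le_trans K; apply: le_trans (le_Re_normc _).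
by rewrite cReD cReN ReD -cosD // Re_ccos.
Unshelve. all: by end_near.
Qed.

End Boundary.

(** * The estimates on a nonempty gap *)

Section NonemptyGap.
Variable R : realType.
Notation C := R[i].
Variables (zm zp h : int -> R) (Delta k : C -> C) (v : R -> R) (mm mp : int -> R).
Notation D := (gap_domain zm zp).
Hypothesis h_ge0 : forall n, 0 <= h n.
Hypothesis k_quasi : quasimomentum zm zp h Delta k.
Hypothesis v_lim : forall x : R, complex.Im (k (x +i* y)) @[y --> 0^'+] --> v x.
Hypothesis mass_left : forall n, zm n < zp n -> effective_mass D k n (zm n) (mm n).
Hypothesis mass_right : forall n, zm n < zp n -> effective_mass D k n (zp n) (mp n).

Let k_bij : set_bij D (~` slits zm zp h) k.
Proof. by case: k_quasi => -[]. Qed.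

Let k_hol z : D z -> exists d, cderiv k z d.
Proof.
case: k_quasi => -[_ hol] _ _ /hol dk.
by exists ('D_1 (k : C^o -> C^o) (z : C^o)); apply/cderivP; split.
Qed.

Let k_infty : asymptotic_to_id D k.
Proof. by case: k_quasi. Qed.

Let k_left n : zm n < zp n -> forall e : R, 0 < e ->
  exists2 r : R, 0 < r & forall z, D z -> normc (z - (zm n)%:C) < r ->
    normc (k z - (pi * n%:~R)%:C) < e.
Proof. by move=> /mass_left/effective_mass_expansion/expansion_limit. Qed.

Let k_right n : zm n < zp n -> forall e : R, 0 < e ->
  exists2 r : R, 0 < r & forall z, D z -> normc (z - (zp n)%:C) < r ->
    normc (k z - (pi * n%:~R)%:C) < e.
Proof. by move=> /mass_right/effective_mass_expansion/expansion_limit. Qed.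

Variable n : int.
Hypothesis gap : zm n < zp n.
Let a := zm n.
Let b := zp n.
Let pn : R := pi * n%:~R.

Let Dnonreal z : complex.Im z != 0 -> D z.
Proof. exact: gap_domain_nonreal. Qed.

Let Dupper z : upper z -> D z.
Proof. by move=> Uz; apply: Dnonreal; rewrite gt_eqF. Qed.

Let Re_lim x : a < x < b -> complex.Re (k (x +i* y)) @[y --> 0^'+] --> pn.
Proof.
move=> /andP[ax xb]; apply/rightP => e e0.
have xab : a <= x <= b by rewrite !ltW.
have [r r0 Hr] := Re_k_gap_limit h_ge0 k_bij k_hol k_left k_right gap xab e0.
exists r => // y y0 yr; apply: Hr; first by rewrite /= gt_eqF.
rewrite (_ : _ - _ = 0 +i* y); first by rewrite normc_imag gtr0_norm.
by congr (_ +i* _); [rewrite subrr|rewrite subr0].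
Qed.

(** By [mass_on_gap], - 2 m^- is the limit of v^2 / (x - a). *)
Lemma mass_left_le0 : mm n <= 0.
Proof.
have K : 2 * mm n <= 0; last lra.
apply/ler_addgt0Pr => e e0; rewrite add0r.
have [r r0 Hr] := effective_mass_expansion (mass_left gap) e0.
have m0 : 0 < Num.min r (b - a) / 2 by rewrite divr_gt0 // lt_min r0 subr_gt0.
have m1 : Num.min r (b - a) / 2 < Num.min r (b - a) by lra.
move: m0 m1; set s := _ / 2 => s0; rewrite lt_min => /andP[sr sb].
have xab : a < a + s < b by apply/andP; split; lra.
have E : a + s - zm n = s by rewrite /a; ring.
have := mass_on_gap Dnonreal (Re_lim xab) (@v_lim (a + s)) Hr (ltW e0).
rewrite E gtr0_norm // => /(_ sr); rewrite ler_norml => /andP[_ H].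
rewrite -(ler_pM2r s0); apply: le_trans H.
by rewrite lerDr sqr_ge0.
Qed.

Lemma mass_right_ge0 : 0 <= mp n.
Proof.
have K : - (2 * mp n) <= 0; last lra.
apply/ler_addgt0Pr => e e0; rewrite add0r.
have [r r0 Hr] := effective_mass_expansion (mass_right gap) e0.
have m0 : 0 < Num.min r (b - a) / 2 by rewrite divr_gt0 // lt_min r0 subr_gt0.
have m1 : Num.min r (b - a) / 2 < Num.min r (b - a) by lra.
move: m0 m1; set s := _ / 2 => s0; rewrite lt_min => /andP[sr sb].
have xab : a < b - s < b by apply/andP; split; lra.
have E : b - s - zp n = - s by rewrite /b; ring.
have := mass_on_gap Dnonreal (Re_lim xab) (@v_lim (b - s)) Hr (ltW e0).
rewrite E normrN gtr0_norm // => /(_ sr); rewrite ler_norml => /andP[_ H].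
rewrite -(ler_pM2r s0); apply: le_trans H.
by rewrite mulrN -mulNr lerDr sqr_ge0.
Qed.

Lemma uplim_sq_ratio (c c' m : R) : c != c' ->
  (forall e : R, 0 < e -> exists2 r : R, 0 < r & forall z, D z ->
    normc (z - c%:C) < r ->
    normc ((k z - pn%:C) ^+ 2 - (2 * m)%:C * (z - c%:C)) <= e * normc (z - c%:C)) ->
  uplim (fun z => (k z - pn%:C) ^+ 2 / (z - c%:C) / (z - c'%:C)) c%:C
    (2 * m / (c - c'))%:C.
Proof.
move=> cc' H.
have -> : (2 * m / (c - c'))%:C = (2 * m)%:C * (c%:C - c'%:C)^-1.
  by rewrite -rmorphB -fmorphV -rmorphM.
apply: uplimM; last first.
  apply: uplimV; first by rewrite -rmorphB eq_complex /= eqxx andbT subr_eq0.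
  by apply: uplimD; [exact: uplim_id|exact: uplim_cst].
move=> e e0; have e2 : 0 < e / 2 by rewrite divr_gt0.
have [r r0 Hr] := H _ e2; exists r => // z Uz hz.
have zc : z - c%:C != 0 by apply: upper_neq0; exact: upper_sub.
have n0 : 0 < normc (z - c%:C) by rewrite normc_gt0.
have -> : (k z - pn%:C) ^+ 2 / (z - c%:C) - (2 * m)%:C =
   ((k z - pn%:C) ^+ 2 - (2 * m)%:C * (z - c%:C)) / (z - c%:C).
  by rewrite mulrBl mulfK.
rewrite Normc.normcM Normc.normcV ltr_pdivrMr //.
apply: le_lt_trans (Hr _ (Dupper Uz) hz) _.
by rewrite ltr_pM2r //; lra.
Qed.

Lemma v_lower_bound x : a < x < b -> Num.sqrt (x - a) * Num.sqrt (b - x) <= v x.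
Proof.
move=> xab.
have ab : a != b by rewrite lt_eqF.
apply: (@gap_lower_bound R a b pn k gap) => //.
- by move=> z Uz; apply: k_hol; apply: Dupper.
- by move=> z Uz; apply: (Im_k_pos h_ge0 k_bij k_hol k_infty k_left k_right).
- move=> e e0; have [r Hr] := k_infty e0; exists r => z Uz; apply: Hr; exact: Dupper.
- move=> t; have [c Hc] := Re_k_limit h_ge0 k_bij k_hol k_infty k_left k_right t.
  exists c => e /Hc[r r0 Hr]; exists r => // z Uz; apply: Hr; by rewrite gt_eqF.
- move=> t e /andP[ta tb] e0; have tab : a <= t <= b by rewrite !ltW.
  have [r r0 Hr] := Re_k_gap_limit h_ge0 k_bij k_hol k_left k_right gap tab e0.
  by exists r => // z Uz; apply: Hr; rewrite gt_eqF.
- move=> t /andP[ta tb].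
  have [d d0 Hd] := k_near_gap h_ge0 k_bij k_hol k_left gap ltr01.
  exists (h n + 1), (Num.min d (Num.min (t - a) (b - t))).
    by rewrite !lt_min d0 !subr_gt0 ta.
  move=> [s y] y0; rewrite !lt_min => /and3P[h1 h2 h3].
  have hs e : normc ((s +i* y) - t%:C) < e -> `|s - t| < e.
    by apply: le_lt_trans; apply: le_trans (le_Re_normc _); rewrite cReD cReN.
  have y1 : `|y| < d.
    apply: le_lt_trans h1; apply: le_trans (le_Im_normc _).
    by rewrite cImD cImN /= subr0.
  have sn : a < s < b.
    move: (hs _ h2) (hs _ h3); rewrite !ltr_norml => /andP[? ?] /andP[? ?].
    by apply/andP; split; lra.
  have yn : 0 < `|y| by rewrite normr_gt0 gt_eqF.
  by have [_ /ltW] := Hd s y sn yn y1; apply: le_trans; exact: ler_norm.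
- exists (2 * mm n / (a - b)).
    rewrite -mulrNN -invrN opprB divr_ge0 ?subr_ge0 ?(ltW gap) //.
    by have := mass_left_le0; lra.
  apply: (_ : uplim _ _ _ -> _) (uplim_sq_ratio ab (effective_mass_expansion (mass_left gap))).
  move=> H e /H[r r0 Hr]; exists r => // w Uw /(Hr _ Uw).
  by rewrite -mulrA -invfM.
- exists (2 * mp n / (b - a)).
    rewrite divr_ge0 ?subr_ge0 ?(ltW gap) //.
    by have := mass_right_ge0; lra.
  rewrite eq_sym in ab.
  apply: (_ : uplim _ _ _ -> _) (uplim_sq_ratio ab (effective_mass_expansion (mass_right gap))).
  move=> H e /H[r r0 Hr]; exists r => // w Uw /(Hr _ Uw).
  by rewrite -mulrA -invfM [X in _ / X]mulrC.
Qed.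

Variables (V : R -> R) (M M' zn : R).
Hypothesis V_ratio : gap_ratio v V a b.
Hypothesis V_max : is_max `[a, b] V M.
Hypothesis V'_max : is_max `[a, b] (fun x => `|derive1 V x|) M'.

Let V_rderiv x : a <= x <= b -> rderiv V x (derive1 V x).
Proof.
case: V_ratio => _ H xab; have [|d dV] := real_analytic_rderiv (H x _).
  by rewrite in_itv.
by rewrite (derive1_rderiv dV).
Qed.

Let aleb : a <= b. Proof. exact: ltW. Qed.

Lemma v_formula x : a < x < b ->
  v x = Num.sqrt (x - a) * Num.sqrt (b - x) * (1 + V x) /\ 0 <= V x.
Proof.
move=> xab; have /andP[ax xb] := xab.
have s0 : 0 < Num.sqrt (x - a) * Num.sqrt (b - x).
  by rewrite mulr_gt0 // sqrtr_gt0 subr_gt0.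
have gr : gap_root a b x = Num.sqrt (x - a) * Num.sqrt (b - x).
  rewrite /gap_root -sqrtrM ?subr_ge0 ?(ltW ax) //; congr Num.sqrt.
  rewrite -[x - b]opprB mulrN normrN ger0_norm // mulr_ge0 // subr_ge0 ltW //.
case: V_ratio => /(_ x); rewrite in_itv /= => /(_ xab) + _; rewrite gr => VE.
split.
  rewrite (_ : 1 + V x = v x / (Num.sqrt (x - a) * Num.sqrt (b - x))).
    by rewrite [RHS]mulrC divfK // gt_eqF.
  by rewrite VE; ring.
by rewrite VE subr_ge0 ler_pdivlMr // mul1r v_lower_bound.
Qed.

Lemma v_sqr x : a < x < b -> v x ^+ 2 = (x - a) * (b - x) * (1 + V x) ^+ 2.
Proof.
move=> xab; have [-> _] := v_formula xab; have /andP[ax xb] := xab.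
by rewrite !exprMn !sqr_sqrtr // subr_ge0 ltW.
Qed.

Lemma v_ge0 x : a < x < b -> 0 <= v x.
Proof.
move=> xab; have [-> V0] := v_formula xab.
by rewrite !mulr_ge0 ?sqrtr_ge0 // addr_ge0.
Qed.

Lemma near_in_gap c (r : R) : a <= c <= b -> 0 < r ->
  exists2 x, a < x < b & `|x - c| < r.
Proof.
move=> /andP[ac cb] r0; have ab : a < b := gap.
have m0 : 0 < Num.min r (b - a) / 4 by rewrite divr_gt0 // lt_min r0 subr_gt0.
have m1 : Num.min r (b - a) / 4 < Num.min r (b - a) / 2 by lra.
have m2 : Num.min r (b - a) <= r by rewrite ge_min lexx.
have m3 : Num.min r (b - a) <= b - a by rewrite ge_min lexx orbT.
have [cm|cm] := leP c ((a + b) / 2).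
  exists (c + Num.min r (b - a) / 4); first by apply/andP; split; lra.
  by rewrite addrAC subrr add0r gtr0_norm //; lra.
exists (c - Num.min r (b - a) / 4); first by apply/andP; split; lra.
by rewrite addrAC subrr add0r normrN gtr0_norm //; lra.
Qed.

Lemma V_ge0 x : a <= x <= b -> 0 <= V x.
Proof.
move=> xab; rewrite leNgt; apply/negP => V0.
have V0' : 0 < - V x by rewrite oppr_gt0.
have [r r0 Hr] := rderiv_cont (V_rderiv xab) V0'.
have [y yab /Hr] := near_in_gap xab r0; have [_ Vy] := v_formula yab.
by rewrite ltr_norml => /andP[_]; lra.
Qed.

Lemma V_lipschitz x y : a <= x <= b -> a <= y <= b -> `|V x - V y| <= M' * (b - a).
Proof.
wlog xy : x y / x <= y.
  move=> H hx hy; have [/H|/ltW/H] := leP x y; first exact.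
  by rewrite distrC; apply.
move=> /andP[ax xb] /andP[ay yb].
have [|c /andP[xc cy] E] := @rderiv_MVT R V (derive1 V) x y xy.
  by move=> t /andP[xt ty]; apply: V_rderiv; apply/andP; split; lra.
have cab : a <= c <= b by apply/andP; split; lra.
have dM : `|derive1 V c| <= M'.
  by case: V'_max => _; apply; exists c => //=; rewrite in_itv.
rewrite distrC E normrM [`|y - x|]ger0_norm ?subr_ge0 //.
by apply: ler_pM => //; lra.
Qed.

(** Both sides are limits of - v^2 / (2 (x - a)) = - (b - x) (1 + V)^2 / 2. *)
Lemma mass_left_eq : mm n = - ((b - a) * (1 + V a) ^+ 2 / 2).
Proof.
have ab : a < b := gap; have aab : a <= a <= b by rewrite lexx aleb.
suff : (b - a) * (1 + V a) ^+ 2 + 2 * mm n = 0 by lra.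
apply: eq0_small => e e0; have e2 : 0 < e / 2 by rewrite divr_gt0.
have [r1 r10 H1] := effective_mass_expansion (mass_left gap) e2.
have dpsi : rderiv (fun x => (b - x) * ((1 + V x) * (1 + V x))) a
  ((b - a) * ((1 + V a) * (0 + derive1 V a) + (1 + V a) * (0 + derive1 V a))
   + (1 + V a) * (1 + V a) * (0 - 1)).
  apply: rderivM; first by apply: rderivB; [exact: rderiv_cst|exact: rderiv_id].
  by apply: rderivM; apply: rderivD; [exact: rderiv_cst|exact: V_rderiv
   |exact: rderiv_cst|exact: V_rderiv].
have [r2 r20 H2] := rderiv_cont dpsi e2.
have r0 : 0 < Num.min r1 r2 by rewrite lt_min r10.
have [x xab] := near_in_gap aab r0; rewrite lt_min => /andP[h1 /H2 h2].
have /andP[ax xb] := xab; have xa0 : 0 < x - a by rewrite subr_gt0.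
have := mass_on_gap Dnonreal (Re_lim xab) (@v_lim x) H1 (ltW e2) h1.
rewrite (v_sqr xab) -/a.
have -> : (x - a) * (b - x) * (1 + V x) ^+ 2 + 2 * mm n * (x - a) =
   ((b - x) * ((1 + V x) * (1 + V x)) + 2 * mm n) * (x - a) by ring.
rewrite normrM (gtr0_norm xa0) ler_pM2r // => h3; move: h2 h3; rewrite expr2.
set p := (b - x) * _; set q := (b - a) * _.
rewrite ltr_norml !ler_norml => /andP[? ?] /andP[? ?]; apply/andP; split; lra.
Qed.

Lemma mass_right_eq : mp n = (b - a) * (1 + V b) ^+ 2 / 2.
Proof.
have ab : a < b := gap; have bab : a <= b <= b by rewrite lexx aleb.
suff : (b - a) * (1 + V b) ^+ 2 - 2 * mp n = 0 by lra.
apply: eq0_small => e e0; have e2 : 0 < e / 2 by rewrite divr_gt0.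
have [r1 r10 H1] := effective_mass_expansion (mass_right gap) e2.
have dpsi : rderiv (fun x => (x - a) * ((1 + V x) * (1 + V x))) b
  ((b - a) * ((1 + V b) * (0 + derive1 V b) + (1 + V b) * (0 + derive1 V b))
   + (1 + V b) * (1 + V b) * (1 - 0)).
  apply: rderivM; first by apply: rderivB; [exact: rderiv_id|exact: rderiv_cst].
  by apply: rderivM; apply: rderivD; [exact: rderiv_cst|exact: V_rderiv
   |exact: rderiv_cst|exact: V_rderiv].
have [r2 r20 H2] := rderiv_cont dpsi e2.
have r0 : 0 < Num.min r1 r2 by rewrite lt_min r10.
have [x xab] := near_in_gap bab r0; rewrite lt_min => /andP[h1 /H2 h2].
have /andP[ax xb] := xab; have xb0 : 0 < b - x by rewrite subr_gt0.
have := mass_on_gap Dnonreal (Re_lim xab) (@v_lim x) H1 (ltW e2) h1.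
rewrite (v_sqr xab) -/b.
have -> : (x - a) * (b - x) * (1 + V x) ^+ 2 + 2 * mp n * (x - b) =
   ((x - a) * ((1 + V x) * (1 + V x)) - 2 * mp n) * (b - x) by ring.
rewrite normrM (distrC x) (gtr0_norm xb0) ler_pM2r // => h3; move: h2 h3; rewrite expr2.
set p := (x - a) * _; set q := (b - a) * _.
rewrite ltr_norml !ler_norml => /andP[? ?] /andP[? ?]; apply/andP; split; lra.
Qed.

Hypothesis zn_in : a <= zn <= b.
Hypothesis Delta_crit : is_complex_derive Delta zn%:C 0.
Hypothesis h_zn : (cosh (h n))%:C = (-1) ^ n * Delta zn%:C.
Hypothesis Delta_left : Delta a%:C = (-1) ^ n.
Hypothesis Delta_right : Delta b%:C = (-1) ^ n.

Let cosh_near (e : R) : 0 < e -> exists2 r : R, 0 < r & forall x, a < x < b ->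
  `|x - zn| < r -> `|cosh (v x) - cosh (h n)| <= e * `|x - zn|.
Proof.
move=> e0; have [r r0 Hr] := (cderivP _ _ _).2 Delta_crit _ e0.
exists r => // x xab xr.
apply: (cosh_on_gap (D := D) (Delta := Delta)) (Re_lim xab) (@v_lim x) _ h_zn (ltW e0) xr => //.
  by case: k_quasi.
by move=> w /Hr; rewrite mul0r subr0.
Qed.

(** At an endpoint Delta = (-1)^n, so a zero of its derivative would give
    cosh v - 1 = o(|x - c|), whereas v^2 >= (x - a) (b - x). *)
Lemma critical_point_not_endpoint (c : R) : c = a \/ c = b -> zn != c.
Proof.
move=> cE; apply/eqP => znc.
have ab : a < b := gap.
have Dc : Delta zn%:C = (-1) ^ n by case: cE => cE; rewrite znc cE.
have ch1 : cosh (h n) = 1.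
  apply: complexI; rewrite h_zn Dc signz_complex -rmorphM /=.
  by rewrite signz_sqr.
have g8 : 0 < (b - a) / 8 by rewrite divr_gt0 // subr_gt0.
have [r r0 Hr] := cosh_near g8.
have g2 : 0 < Num.min r ((b - a) / 2) by rewrite lt_min r0 divr_gt0 // subr_gt0.
have [x xab] := near_in_gap zn_in g2; rewrite lt_min => /andP[xr xg].
have := Hr _ xab xr; have := cosh_sqr_dist (lexx 0) (v_ge0 xab).
have cosh0 : cosh 0 = 1 :> R by rewrite /cosh oppr0 expR0; lra.
rewrite ch1 cosh0 expr0n subr0 ger0_norm ?sqr_ge0 // (v_sqr xab) => h1 h2.
have /andP[ax xb] := xab.
have V1 : 1 <= (1 + V x) ^+ 2.
  by have [_ V0] := v_formula xab; have := sqr_ge0 (V x); nra.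
have p0 : 0 <= (x - a) * (b - x) by rewrite mulr_ge0 // subr_ge0 ltW.
have h3 : (x - a) * (b - x) <= 2 * ((b - a) / 8 * `|x - zn|).
  apply: le_trans (le_trans h1 _); last by rewrite ler_pM2l.
  by rewrite ler_peMr.
case: cE => cE; rewrite znc cE in h3 xg.
  have xa : 0 < x - a by rewrite subr_gt0.
  rewrite gtr0_norm // in h3 xg.
  have : (x - a) * (b - x) <= (x - a) * ((b - a) / 4) by lra.
  by rewrite ler_pM2l //; lra.
have xa : 0 < b - x by rewrite subr_gt0.
rewrite distrC gtr0_norm // in h3 xg.
have : (b - x) * (x - a) <= (b - x) * ((b - a) / 4) by lra.
by rewrite ler_pM2l //; lra.
Qed.

Lemma critical_point_inside : a < zn < b.
Proof.
move: zn_in => /andP[az zb]; rewrite !lt_neqAle az zb !andbT.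
by rewrite eq_sym !critical_point_not_endpoint //; [right|left].
Qed.

Lemma v_critical : v zn = h n.
Proof.
have zab := critical_point_inside.
have [r r0 Hr] := cosh_near ltr01.
have := Hr _ zab; rewrite subrr normr0 mulr0 normr_le0 => /(_ r0).
move=> /eqP E; have := cosh_sqr_dist (h_ge0 n) (v_ge0 zab); rewrite E.
rewrite normr0 mulr0 normr_le0 subr_eq0 eqrXn2 ?v_ge0 //.
by move/eqP.
Qed.

(** By [cosh_sqr_dist] the square (x - a) (b - x) (1 + V)^2 of v is stationary
    together with cosh v; divide its derivative by 1 + V. *)
Lemma v_stationary : (a + b - 2 * zn) * (1 + V zn)
  + 2 * ((zn - a) * (b - zn) * derive1 V zn) = 0.
Proof.
have zab := critical_point_inside; have /andP[az zb] := zab.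
pose W x := (x - a) * (b - x) * ((1 + V x) * (1 + V x)).
have W0 : rderiv W zn 0.
  move=> e e0; have e2 : 0 < e / 2 by rewrite divr_gt0.
  have [r r0 Hr] := cosh_near e2.
  exists (Num.min r (Num.min (zn - a) (b - zn))); first by rewrite !lt_min r0 !subr_gt0 az.
  move=> x; rewrite !lt_min => /and3P[xr h1 h2].
  have xab : a < x < b.
    by move: h1 h2; rewrite !ltr_norml => /andP[? ?] /andP[? ?]; apply/andP; split; lra.
  rewrite mul0r subr0 /W -!expr2 -(v_sqr xab) -(v_sqr zab).
  apply: le_trans (cosh_sqr_dist (v_ge0 zab) (v_ge0 xab)) _.
  have := Hr _ xab xr; rewrite v_critical; lra.
have zab' : a <= zn <= b by rewrite !ltW.
have W1 : rderiv W zn ((zn - a) * (b - zn) * ((1 + V zn) * (0 + derive1 V zn)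
    + (1 + V zn) * (0 + derive1 V zn))
   + (1 + V zn) * (1 + V zn) * ((zn - a) * (0 - 1) + (b - zn) * (1 - 0))).
  apply: rderivM; first by apply: rderivM; apply: rderivB; [exact: rderiv_id
    |exact: rderiv_cst|exact: rderiv_cst|exact: rderiv_id].
  by apply: rderivM; apply: rderivD; [exact: rderiv_cst|exact: V_rderiv
   |exact: rderiv_cst|exact: V_rderiv].
have := rderiv_unique W1 W0.
have Z0 : 1 + V zn != 0 by have := V_ge0 zab'; move=> ?; rewrite gt_eqF //; lra.
move=> E; apply: (mulfI Z0); rewrite mulr0 -[RHS]E; ring.
Qed.

Lemma nonempty_gap_estimates :
  let g := b - a in
  let z0 := (a + b) / 2 in
  let hm := Num.sqrt (g * `|mm n| / 2) in
  let hp := Num.sqrt (g * `|mp n| / 2) in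
  let m := 2 * h n ^+ 2 / g in
  `|zn - z0| <= g ^+ 2 / 4 * M' /\
  `|2 * h n - g * (1 + V zn)| <= g ^+ 3 / 8 * M' ^+ 2 /\
  `|h n - hm| <= g ^+ 2 / 2 * M' * (1 + M' / 8 * Num.sqrt (2 * g * `|mm n|)) /\
  `|h n - hp| <= g ^+ 2 / 2 * M' * (1 + M' / 8 * Num.sqrt (2 * g * `|mp n|)) /\
  `|mp n + mm n| <= g ^+ 2 * (1 + M) * M' /\
  `|mp n - m| <= g ^+ 2 * (1 + M) * M' * (1 + M' / 8 * Num.sqrt (2 * g * `|mp n|)) /\
  `|mm n + m| <= g ^+ 2 * (1 + M) * M' * (1 + M' / 8 * Num.sqrt (2 * g * `|mm n|)).
Proof.
have zab := critical_point_inside; have /andP[az zb] := zab.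
have aab : a <= a <= b by rewrite lexx aleb.
have bab : a <= b <= b by rewrite lexx aleb.
have V1 x : a <= x <= b -> 1 <= 1 + V x <= 1 + M.
  move=> xab; rewrite lerDl V_ge0 //= lerD2l.
  by case: V_max => _; apply; exists x => //=; rewrite in_itv.
have lip x y : a <= x <= b -> a <= y <= b ->
    `|1 + V x - (1 + V y)| <= M' * (b - a).
  by move=> hx hy; rewrite opprD addrACA subrr add0r; apply: V_lipschitz.
apply: (@gap_estimates R a b zn (1 + V a) (1 + V b) (1 + V zn) (derive1 V zn)
  (Num.sqrt (zn - a) * Num.sqrt (b - zn)) (h n) M M' (mm n) (mp n)) => //.
- by rewrite exprMn !sqr_sqrtr // subr_ge0 ltW.
- exact: V1.
- exact: V1.
- exact: V1.
- by case: V'_max => _; apply; exists zn => //=; rewrite in_itv.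
- rewrite exprMn !sqr_sqrtr ?subr_ge0 ?(ltW az) ?(ltW zb) //.
  exact: v_stationary.
- by rewrite -v_critical; have [->] := v_formula zab.
- exact: lip.
- exact: lip.
- exact: lip.
- exact: mass_left_eq.
- exact: mass_right_eq.
Qed.

End NonemptyGap.

Unset Implicit Arguments.
Set Strict Implicit.

Theorem theorem1p3 (R : realType) (q1 q2 : R -> R)
  (hq1 : periodic_L2 q1) (hq2 : periodic_L2 q2)
  (psi : R -> R[i] -> 'M[R[i]]_2) (hpsi : fundamental_solution q1 q2 psi)
  (* endpoints of the gaps, and the labelling convention *)
  (zm zp : int -> R)
  (hlt : forall n : int, zp (n - 1) < zm n)
  (hle : forall n : int, zm n <= zp n)
  (hspec : TD_spectrum q1 q2 = bands zm zp)
  (hDm : forall n : int, Lyapunov psi (zm n)%:C = (-1) ^ n)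
  (hDp : forall n : int, Lyapunov psi (zp n)%:C = (-1) ^ n)
  (* zeros of Delta' and heights of the slits *)
  (z h : int -> R)
  (hz : forall n : int, zm n <= z n <= zp n)
  (hz' : forall n : int, is_complex_derive (Lyapunov psi) (z n)%:C 0)
  (hh0 : forall n : int, 0 <= h n)
  (hh : forall n : int, (cosh (h n))%:C = (-1) ^ n * Lyapunov psi (z n)%:C)
  (* the quasimomentum k and v(x) = Im k(x + i0) *)
  (k : R[i] -> R[i])
  (hk : quasimomentum zm zp h (Lyapunov psi) k)
  (v : R -> R)
  (hv : forall x : R, complex.Im (k (x +i* y)) @[y --> 0^'+] --> v x)
  (* effective masses *)
  (mm mp : int -> R)
  (hmm : forall n : int, zm n < zp n ->
     effective_mass (gap_domain zm zp) k n (zm n) (mm n))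
  (hmp : forall n : int, zm n < zp n ->
     effective_mass (gap_domain zm zp) k n (zp n) (mp n))
  (hm0 : forall n : int, zm n = zp n -> mm n = 0 /\ mp n = 0)
  (* V_n, M_n and M_n' *)
  (V : int -> R -> R)
  (hV : forall n : int, zm n < zp n -> gap_ratio v (V n) (zm n) (zp n))
  (hV0 : forall n : int, zm n = zp n -> V n = cst 0)
  (M M' : int -> R)
  (hM : forall n : int, is_max `[zm n, zp n] (V n) (M n))
  (hM' : forall n : int, is_max `[zm n, zp n] (fun x => `|derive1 (V n) x|) (M' n)) :
  forall n : int,
  let g := zp n - zm n in
  let z0 := (zm n + zp n) / 2 in
  let hm := Num.sqrt (g * `|mm n| / 2) in
  let hp := Num.sqrt (g * `|mp n| / 2) in
  let m := 2 * h n ^+ 2 / g in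
  `|z n - z0| <= g ^+ 2 / 4 * M' n /\
  `|2 * h n - g * (1 + V n (z n))| <= g ^+ 3 / 8 * M' n ^+ 2 /\
  `|h n - hm| <= g ^+ 2 / 2 * M' n * (1 + M' n / 8 * Num.sqrt (2 * g * `|mm n|)) /\
  `|h n - hp| <= g ^+ 2 / 2 * M' n * (1 + M' n / 8 * Num.sqrt (2 * g * `|mp n|)) /\
  `|mp n + mm n| <= g ^+ 2 * (1 + M n) * M' n /\
  `|mp n - m| <= g ^+ 2 * (1 + M n) * M' n
                   * (1 + M' n / 8 * Num.sqrt (2 * g * `|mp n|)) /\
  `|mm n + m| <= g ^+ 2 * (1 + M n) * M' n
                   * (1 + M' n / 8 * Num.sqrt (2 * g * `|mm n|)).
Proof.
move=> n; have [gap|] := ltP (zm n) (zp n).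
  apply: (nonempty_gap_estimates (zm := zm) (zp := zp) (h := h)
    (Delta := Lyapunov psi) (k := k) (v := v)) => //.
  exact: hV.
move=> le; have E : zm n = zp n by apply/eqP; rewrite eq_le hle le.
have zE : z n = zm n by apply/eqP; have := hz n; rewrite eq_le -E => /andP[-> ->].
have [mm0 mp0] := hm0 _ E.
have h0 : h n = 0.
  have c1 : cosh (h n) = 1.
    by apply: complexI; rewrite hh zE hDm signz_complex -rmorphM /= signz_sqr.
  have := cosh_sqr_dist (lexx 0) (hh0 n).
  rewrite c1 (_ : cosh 0 = 1 :> R); last by rewrite /cosh oppr0 expR0; lra.
  rewrite subrr normr0 mulr0 normr_le0 expr0n subr0 expf_eq0 /=.
  by move/eqP.
rewrite /= mm0 mp0 h0 zE -E subrr !(expr0n, mul0r, mulr0, sqrtr0, normr0, subr0, oppr0, addr0).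
rewrite (_ : zm n - (zm n + zm n) / 2 = 0); last by field.
by rewrite normr0 lexx.
Qed.
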